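(* Let $\mathbf X=(\xi_{jk}X_{jk})_{1\le j\le N,\,1\le k\le n}$ be the sparse random matrix described in the context, with $\mathbb E X_{jk}=0$ and $\mathbb E|X_{jk}|^2=1$. Suppose that for some $\delta>0$ there is a constant $\mu_{4+\delta}>0$ such that $\mathbb E|X_{jk}|^{4+\delta}\le \mu_{4+\delta}<\infty$ for all $j,k\ge1$. Put $\varkappa=\frac{\delta}{2(4+\delta)}$ and suppose that there exists a constant $B>0$ such that $Np\ge B(\log N)^{\frac{3}{2\varkappa}}$. Then there exists a constant $\tau_0>0$ such that for any $\tau\le\tau_0$, any $Q\ge 1$ and any $A>0$ there exists a constant $C$, depending on $A$, $\delta$ and $Q$ (and on the constants $\mu_{4+\delta}$, $B$ fixed in the hypotheses), such that $$\Pr\{s_n\le\tau\sqrt{Np}\}\le CN^{-Q}+N^2p\,\Pr\{|X_{11}|>A(Np)^{\frac12-\varkappa}\ln N\}.$$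
   Context: For integers $N>n\ge 1$, the $X_{jk}$ ($1\le j\le N$, $1\le k\le n$) are independent identically distributed real random variables with mean zero and $\mathbb E X_{jk}^2=1$; their common distribution may depend on $N$. They are independent of a family $\xi_{jk}$ ($1\le j\le N$, $1\le k\le n$) of independent Bernoulli ($\{0,1\}$-valued) random variables with $\mathbb E\xi_{jk}=p=p_N$. The matrix is $\mathbf X=(\xi_{jk}X_{jk})_{1\le j\le N,1\le k\le n}$, with singular values $s_1\ge\cdots\ge s_n$. Standing assumption: $n=n(N)$ and $n/N\to y_0\in(0,1)$ as $N\to\infty$; only the parameter $N$ is varied. Hypotheses are understood uniformly in $N$ and constants do not depend on $N$. *)

(* Defs.v *)
From HB Require Import structures.
From mathcomp Require Import all_boot all_order all_algebra.
From mathcomp Require Import complex.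
From mathcomp Require Import all_classical all_reals all_analysis.

Set Implicit Arguments.
Unset Strict Implicit.
Unset Printing Implicit Defensive.

Import Order.TTheory GRing.Theory Num.Theory.
Import numFieldNormedType.Exports.

Local Open Scope classical_set_scope.
Local Open Scope ring_scope.

(* The singular values of an m x n matrix A are the square roots of the
   eigenvalues of A^T A, counted with algebraic multiplicity; there are n of
   them, listed as s_1 >= ... >= s_n >= 0.  Equality of characteristic
   polynomials encodes "with multiplicity", and forces [size s = n]. *)
Definition is_singular_values (R : realType) (m n : nat) (A : 'M[R]_(m, n))
    (s : seq R) : Prop :=
  [/\ sorted >=%R s, all (>= 0) s &
      char_poly (A^T *m A) = \prod_(x <- s) ('X - (x ^+ 2)%:P)].

Definition singular_values (R : realType) (m n : nat) (A : 'M[R]_(m, n)) :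
    seq R :=
  xget [::] [set s | is_singular_values A s].

(* s_k is stored at position k.-1, so this is s_n. *)
Definition smin (R : realType) (m n : nat) (A : 'M[R]_(m, n)) : R :=
  (singular_values A)`_n.-1.

Section singular_values_wf.
Local Open Scope sesquilinear_scope.

Lemma char_poly_unitary_diag (C : numClosedFieldType) (n : nat)
    (P : 'M[C]_n) (D : 'rV[C]_n) : P \in unitmx ->
  char_poly (invmx P *m diag_mx D *m P) = \prod_(i < n) ('X - (D 0 i)%:P).
Proof.
move=> Pu; rewrite /char_poly.
have -> : char_poly_mx (invmx P *m diag_mx D *m P) =
    map_mx polyC (invmx P) *m char_poly_mx (diag_mx D) *m map_mx polyC P.
  rewrite /char_poly_mx mulmxBr mulmxBl -!map_mxM /= scalar_mxC.
  by rewrite -(mulmxA 'X%:M) -map_mxM mulVmx// map_mx1 mulmx1.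
rewrite !det_mulmx mulrC mulrA -det_mulmx -map_mxM mulmxV// map_mx1 det1 mul1r.
rewrite -/(char_poly _) char_poly_trig ?diag_mx_is_trig//.
by apply: eq_bigr => i _; rewrite mxE eqxx mulr1n.
Qed.

Lemma singular_values_exists (R : realType) (m n : nat) (A : 'M[R]_(m, n)) :
  exists s, is_singular_values A s.
Proof.
pose AC := map_mx (real_complex R) A; pose B := AC^T *m AC.
have ACr : map_mx Num.Def.conjC AC = AC.
  by apply/matrixP => i j; rewrite !mxE; exact: conjc_real.
have ACtr : map_mx Num.Def.conjC AC^T = AC^T by rewrite -map_trmx ACr.
have BtC : B ^t* = B by rewrite /B trmx_mul trmxK map_mxM ACtr ACr.
have /orthomx_spectralP : B \is normalmx by apply/normalmxP; rewrite BtC.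
set P := spectralmx B; set D := spectral_diag B => BE.
have Pu : P \is unitarymx := spectral_unitarymx B.
have D0 i : 0 <= D 0 i.
  have DE : diag_mx D = (AC *m P ^t*)^t* *m (AC *m P^t*).
    rewrite trmx_mul map_mxM trmxCK ACtr.
    rewrite -mulmxA (mulmxA AC^T) -/B BE invmx_unitary// -!mulmxA.
    by rewrite (mulmxA P) (unitarymxP Pu) mul1mx mulmx1.
  suff : 0 <= diag_mx D i i by rewrite mxE eqxx mulr1n.
  rewrite DE mxE; apply: sumr_ge0 => k _.
  by rewrite !mxE mulrC mul_conjC_ge0.
pose r i := Num.sqrt (complex.Re (D 0 i)).
have rE i : (real_complex R) (r i ^+ 2) = D 0 i.
  by rewrite sqr_sqrtr ?RRe_real ?ger0_real//; move: (D0 i); rewrite lecE => /andP[].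
exists (sort >=%R [seq r i | i <- enum 'I_n]); split.
- by apply: sort_sorted => x y; exact: le_total.
- rewrite all_sort all_map; apply/allP => i _ /=; exact: sqrtr_ge0.
- rewrite (perm_big [seq r i | i <- enum 'I_n]) ?perm_sort//= big_map big_enum/=.
  apply: (@map_poly_inj _ _ (real_complex R)).
  rewrite map_char_poly map_mxM -map_trmx -/AC -/B BE.
  rewrite char_poly_unitary_diag ?unitarymx_unit// rmorph_prod/=.
  apply: eq_bigr => i _.
  by rewrite rmorphB/= map_polyX map_polyC/= rE.
Qed.

Lemma singular_valuesP (R : realType) (m n : nat) (A : 'M[R]_(m, n)) :
  is_singular_values A (singular_values A).
Proof.
rewrite /singular_values; case: xgetP => [s -> //|none].
by have [s /none] := singular_values_exists A.
Qed.

Lemma size_singular_values (R : realType) (m n : nat) (A : 'M[R]_(m, n)) :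
  size (singular_values A) = n.
Proof.
have [_ _ /(congr1 (fun p : {poly R} => size p))] := singular_valuesP A.
rewrite size_char_poly -(big_map (fun x => x ^+ 2) xpredT (fun x => 'X - x%:P)).
by rewrite size_prod_XsubC size_map => -[].
Qed.

End singular_values_wf.

Definition mutually_independent (R : realType) d (T : measurableType d)
    (P : probability T R) (I : finType) (X : I -> {RV P >-> R}) : Prop :=
  forall (J : {set I}) (E : I -> set R), (forall i, measurable (E i)) ->
    (P (\bigcap_(i in [set` J]) (X i @^-1` E i)) =
     \prod_(i in J) P (X i @^-1` E i))%E.

Definition sigma_family (R : realType) d (T : measurableType d)
    (P : probability T R) (I : Type) (X : I -> {RV P >-> R}) :
    set (set T) :=
  <<s [set A | exists i, preimage_set_system setT (X i) measurable A] >>.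

Definition independent_families (R : realType) d (T : measurableType d)
    (P : probability T R) (I J : Type)
    (X : I -> {RV P >-> R}) (Y : J -> {RV P >-> R}) : Prop :=
  forall A B : set T, sigma_family X A -> sigma_family Y B ->
    (P (A `&` B) = P A * P B)%E.

Definition identically_distributed (R : realType) d (T : measurableType d)
    (P : probability T R) (I : Type) (X : I -> {RV P >-> R}) : Prop :=
  forall (i i' : I) (E : set R), measurable E ->
    distribution P (X i) E = distribution P (X i') E.

Definition bernoulli_rv (R : realType) d (T : measurableType d)
    (P : probability T R) (p : R) (Y : {RV P >-> R}) : Prop :=
  (forall t, Y t = 0 \/ Y t = 1) /\ ('E_P[Y] = p%:E)%E.

Record sparse_model (R : realType) d (T : measurableType d)
    (P : probability T R) (N n : nat) (p : R)
    (X xi : 'I_N * 'I_n -> {RV P >-> R}) : Prop := SparseModel {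
  sm_X_independent : mutually_independent X ;
  sm_X_identical : identically_distributed X ;
  sm_X_mean : forall jk, ('E_P[X jk] = 0)%E ;
  sm_X_variance : forall jk, ('E_P[fun t => (X jk t ^+ 2)%R] = 1)%E ;
  sm_xi_independent : mutually_independent xi ;
  sm_xi_bernoulli : forall jk, bernoulli_rv p (xi jk) ;
  sm_X_xi_independent : independent_families X xi }.

Definition sparse_matrix (R : realType) d (T : measurableType d)
    (P : probability T R) (N n : nat)
    (X xi : 'I_N * 'I_n -> {RV P >-> R}) (t : T) : 'M[R]_(N, n) :=
  \matrix_(j, k) (xi (j, k) t * X (j, k) t).

Definition varkappa (R : realType) (delta : R) : R :=
  delta / (2 * (4 + delta)).

(* Main.v *)
Require Import Defs.
From HB Require Import structures.
From mathcomp Require Import all_boot all_order all_algebra.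
From mathcomp Require Import all_classical all_reals all_analysis.
From mathcomp Require Import measurable_realfun.
From mathcomp Require Import ring lra.

(** The smallest eigenvalue of the Gram matrix of the rows is bounded from
below by a barrier argument in the manner of Batson, Spielman and Srivastava.

Let [A] be the Gram matrix of the rows added so far and [l] a level below its
spectrum; all the information is kept in the resolvent [R] of [A] at [l], the
inverse of [A - l].  Start with [A = 0] and [l = - M N], add the rows one at a
time, and raise [l] by [del = M + nu] before each addition.  The final level is
[nu N], so the smallest eigenvalue exceeds [nu N] as soon as [A - l] stays
positive definite throughout.  Raising the level, from [R] to [R'] say,
increases the trace of [R] by at most [del tr R'^2], while a row [x] decreases
it by [x R'^2 x / (1 + x R' x)].  A row is isotropic and [x R' x] concentrates
around [tr R'], which is at most some [phim]; the mean decrease is therefore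
nearly [tr R'^2 / (1 + phim)].  Since [n / N] stays below some [y < 1], the
parameters can be chosen with [(del + nu) (1 + phim) = 1], and the decrease
wins by the margin [nu tr R'^2].

The concentration of [x R' x] needs control of [tr R], of the diagonal of [R]
and of [tr R^2] at every step, with a probability of failure below any power of
[N].  The three are put into one potential, a sum of an exponential of
[tr R - phim], of exponentials of [R_kk - C / N], and of a high power of
[tr R^2] times an exponential of [tr R].  While the potential is below [1] it
gives exactly the a priori bounds needed for a step, and its conditional mean
does not increase ([pot_step]); by induction on the number of rows left, the
probability that the barrier is ever hit is at most the initial potential
([barrier_walk]), which is at most [(n + 2) exp (- m)] ([barrier_constants]).
Here [m] may be taken of order [(ln N)^2], and this beats every power of [N].
The only moments used are the mean of [x F x] and the mean of
[(x F x) (x K x)], controlled by a bound [k2] on the squares of the entries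
([iid_moment2]); the argument tolerates [m k2 <= N / K].

To reach this situation, put [Lam = N p] and truncate at
[lev = Lam ^ (1/2 - varkappa)], chosen so that [lev ^ (4 + delta) = Lam ^ 2].
A row containing a larger entry is discarded, which can only lower the smallest
eigenvalue; by Markov's inequality a row is discarded with probability
[O (1 / Lam)].  By the same moment bound the truncated entries are almost
centred with variance almost [p], and centring them exactly moves the matrix
by a negligible amount ([smin_from_gram]).  After normalisation the squares of
the entries are at most [8 lev^2 / p], and the growth hypothesis on [N p] is
what makes [m lev^2 / p] small compared with [N].

Before the barrier argument the entries are rounded to a finite grid much finer
than all these errors ([cidx], [cval]).  The rounded matrix takes finitely many
values and its law is a product of weights ([prob_conf_eq]), so the expectation
of the potential is a finite sum and no measurability has to be checked for
functions of the resolvent.  Only the event itself must be measurable: [s_n <= c]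
means that [X^T X - c^2] is not positive definite ([smin_leE]), and positive
definiteness is a countable condition over rational vectors ([pd_ratP]). *)

Set Implicit Arguments.
Unset Strict Implicit.
Unset Printing Implicit Defensive.

Import Order.TTheory GRing.Theory Num.Theory.
Import numFieldNormedType.Exports.

Local Open Scope classical_set_scope.
Local Open Scope ring_scope.

(** * Quadratic forms on row vectors *)

Section QuadraticForms.
Variables (R : rcfType) (n : nat).
Implicit Types (u v w : 'rV[R]_n) (M K F : 'M[R]_n).

Definition dot u v : R := (u *m v^T) 0 0.
Definition qf M u : R := dot (u *m M) u.
Definition psd M : Prop := M^T = M /\ forall u, 0 <= qf M u.
Definition pd M : Prop := M^T = M /\ forall u, u != 0 -> 0 < qf M u.

Lemma dotE u v : dot u v = \sum_i u 0 i * v 0 i.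
Proof. by rewrite /dot mxE; apply: eq_bigr => i _; rewrite mxE. Qed.

Lemma dotC u v : dot u v = dot v u.
Proof. by rewrite !dotE; apply: eq_bigr => i _; rewrite mulrC. Qed.

Lemma dotDl u v w : dot (u + v) w = dot u w + dot v w.
Proof. by rewrite /dot mulmxDl mxE. Qed.
Lemma dotDr u v w : dot w (u + v) = dot w u + dot w v.
Proof. by rewrite dotC dotDl !(dotC w). Qed.
Lemma dotZl a u v : dot (a *: u) v = a * dot u v.
Proof. by rewrite /dot -scalemxAl mxE. Qed.
Lemma dotZr a u v : dot u (a *: v) = a * dot u v.
Proof. by rewrite dotC dotZl dotC. Qed.
Lemma dotNl u v : dot (- u) v = - dot u v.
Proof. by rewrite /dot mulNmx mxE. Qed.
Lemma dotNr u v : dot u (- v) = - dot u v.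
Proof. by rewrite dotC dotNl dotC. Qed.
Lemma dotBl u v w : dot (u - v) w = dot u w - dot v w.
Proof. by rewrite dotDl dotNl. Qed.
Lemma dotBr u v w : dot w (u - v) = dot w u - dot w v.
Proof. by rewrite dotDr dotNr. Qed.
Lemma dot0l v : dot 0 v = 0. Proof. by rewrite /dot mul0mx mxE. Qed.

Lemma dot_ge0 u : 0 <= dot u u.
Proof. by rewrite dotE; apply: sumr_ge0 => i _; rewrite -expr2 sqr_ge0. Qed.

Lemma dot_eq0 u : (dot u u == 0) = (u == 0).
Proof.
apply/eqP/eqP => [|->]; last by rewrite dot0l.
rewrite dotE => /psumr_eq0P h; apply/rowP => i; rewrite mxE.
have : u 0 i * u 0 i = 0 by apply: h => // j _; rewrite -expr2 sqr_ge0.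
by move/eqP; rewrite mulf_eq0 orbb => /eqP.
Qed.

Lemma dot_gt0 u : u != 0 -> 0 < dot u u.
Proof. by move=> u0; rewrite lt_neqAle dot_ge0 eq_sym dot_eq0 u0. Qed.

Lemma dot_mul M u v : dot (u *m M) v = dot u (v *m M^T).
Proof. by rewrite /dot trmx_mul trmxK mulmxA. Qed.

Lemma dot_sym M u v : M^T = M -> dot (u *m M) v = dot u (v *m M).
Proof. by move=> sM; rewrite dot_mul sM. Qed.

Lemma dot_delta u i : dot u (delta_mx 0 i) = u 0 i.
Proof.
rewrite dotE (bigD1 i)//= mxE !eqxx mulr1 big1 ?addr0// => j ji.
by rewrite mxE (negPf ji) andbF mulr0.
Qed.

Lemma mxE_dot M i j : M i j = dot (delta_mx 0 i *m M) (delta_mx 0 j).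
Proof. by rewrite dot_delta -rowE mxE. Qed.

Lemma diag_qf M i : M i i = qf M (delta_mx 0 i).
Proof. exact: mxE_dot. Qed.

Lemma qfD M K u : qf (M + K) u = qf M u + qf K u.
Proof. by rewrite /qf mulmxDr dotDl. Qed.
Lemma qfN M u : qf (- M) u = - qf M u.
Proof. by rewrite /qf mulmxN dotNl. Qed.
Lemma qfB M K u : qf (M - K) u = qf M u - qf K u.
Proof. by rewrite qfD qfN. Qed.
Lemma qfZ a M u : qf (a *: M) u = a * qf M u.
Proof. by rewrite /qf -scalemxAr dotZl. Qed.
Lemma qf_scalar a u : qf a%:M u = a * dot u u.
Proof. by rewrite /qf mul_mx_scalar dotZl. Qed.
Lemma qf0 M : qf M 0 = 0.
Proof. by rewrite /qf mul0mx dot0l. Qed.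
Lemma qf_mul M K u : K^T = K -> qf (K *m M *m K) u = qf M (u *m K).
Proof. by move=> sK; rewrite /qf !mulmxA -dot_sym. Qed.
Lemma qf_sq K u : K^T = K -> qf (K *m K) u = dot (u *m K) (u *m K).
Proof. by move=> sK; rewrite /qf -(dot_sym _ _ sK) mulmxA. Qed.

Lemma qf_outer u v : qf (v^T *m v) u = dot u v ^+ 2.
Proof.
rewrite /qf mulmxA (mx11_scalar (u *m v^T)) mul_scalar_mx dotZl.
by rewrite -/(dot u v) (dotC v u) expr2.
Qed.

Lemma sym_outer u : (u^T *m u)^T = u^T *m u.
Proof. by rewrite trmx_mul trmxK. Qed.

Lemma pd_psd M : pd M -> psd M.
Proof.
case=> sM pM; split=> // u; have [->|/pM/ltW//] := eqVneq u 0.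
by rewrite qf0.
Qed.

Lemma pdD M K : pd M -> psd K -> pd (M + K).
Proof.
case=> sM pM [sK pK]; split; first by rewrite linearD /= sM sK.
by move=> u u0; rewrite qfD ltr_wpDr ?pM.
Qed.

Lemma psd_outer u : psd (u^T *m u).
Proof. by split=> [|v]; rewrite ?sym_outer// qf_outer sqr_ge0. Qed.

Lemma discriminant_le (A B C : R) :
  0 <= A -> 0 <= C -> (forall t, 0 <= A + 2 * t * B + t ^+ 2 * C) ->
  B ^+ 2 <= A * C.
Proof.
move=> A0; rewrite le_eqVlt => /predU1P[<-|C0] h.
  have [->|B0] := eqVneq B 0; first by rewrite expr0n mulr0.
  have := h (- (A + 1) / (2 * B)).
  have -> : A + 2 * (- (A + 1) / (2 * B)) * B + (- (A + 1) / (2 * B)) ^+ 2 * 0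
    = -1 by field.
  by rewrite oppr_ge0 ler10.
have := h (- B / C).
have -> : A + 2 * (- B / C) * B + (- B / C) ^+ 2 * C = (A * C - B ^+ 2) / C.
  by field; rewrite gt_eqF.
by rewrite pmulr_lge0 ?invr_gt0// subr_ge0.
Qed.

Lemma psd_CS M u v : psd M -> dot (u *m M) v ^+ 2 <= qf M u * qf M v.
Proof.
case=> sM pM; apply: discriminant_le => // t; have := pM (u + t *: v).
rewrite /qf mulmxDl -scalemxAl !(dotDl, dotDr, dotZl, dotZr).
by rewrite (dot_sym v u sM) (dotC v); congr (0 <= _); ring.
Qed.

Lemma dot_CS u v : dot u v ^+ 2 <= dot u u * dot v v.
Proof.
have p1 : psd 1%:M by split=> [|w]; rewrite ?trmx1// /qf mulmx1 dot_ge0.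
by have := psd_CS u v p1; rewrite /qf !mulmx1.
Qed.

Lemma pd_unit M : pd M -> M \in unitmx.
Proof.
case=> _ pM; rewrite -row_free_unit -kermx_eq0; apply/rowV0P => u.
move/sub_kermxP => uM; apply: contraTeq isT => /pM.
by rewrite /qf uM dot0l ltxx.
Qed.

(** An isotropic vector of a semidefinite form lies in its kernel, by the
Cauchy-Schwarz inequality. *)
Lemma psd_unit_pd M : psd M -> M \in unitmx -> pd M.
Proof.
move=> pM uM; split; first by case: pM.
move=> u u0; rewrite lt_neqAle (proj2 pM) andbT eq_sym.
apply: contra_neq u0 => q0.
have h v : dot (u *m M) v = 0.
  have := psd_CS u v pM; rewrite q0 mul0r => h.
  by apply/eqP; rewrite -sqrf_eq0 eq_le h sqr_ge0.
have /eqP := h (u *m M); rewrite dot_eq0 => /eqP uM0.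
by rewrite -(mulmxK uM u) uM0 mul0mx.
Qed.

Lemma pd_inv M : pd M -> pd (invmx M).
Proof.
move=> pM; have uM := pd_unit pM; have sM := proj1 pM.
have sI : (invmx M)^T = invmx M by rewrite trmx_inv sM.
split=> // u u0.
have -> : qf (invmx M) u = qf M (u *m invmx M).
  by rewrite /qf mulmxKV// dotC.
apply: (proj2 pM); apply: contra_neq u0 => h.
by rewrite -(mulmxKV uM u) h mul0mx.
Qed.

Lemma trmul_sym M K : \tr (M *m K) = \sum_i dot (row i M) (row i K^T).
Proof.
apply: eq_bigr => i _; rewrite mxE dotE; apply: eq_bigr => j _.
by rewrite !mxE.
Qed.

Lemma tr_sq M : M^T = M -> \tr (M *m M) = \sum_i dot (row i M) (row i M).
Proof. by move=> sM; rewrite trmul_sym sM. Qed.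

Lemma tr_sq_ge0 M : M^T = M -> 0 <= \tr (M *m M).
Proof. by move=> sM; rewrite tr_sq//; apply: sumr_ge0 => i _; exact: dot_ge0. Qed.

Lemma dot_mul_le_frob M u : M^T = M -> dot (u *m M) (u *m M) <= \tr (M *m M) * dot u u.
Proof.
move=> sM; rewrite tr_sq// [in leLHS]dotE mulr_suml; apply: ler_sum => j _.
have -> : (u *m M) 0 j = dot u (row j M).
  rewrite mxE dotE; apply: eq_bigr => i _; rewrite !mxE.
  by rewrite -[in LHS]sM mxE.
by rewrite -expr2 mulrC dot_CS.
Qed.

(** The operator norm of [M] is at most its Frobenius norm.  The latter is the
only norm used below, as the potential controls [\tr (M *m M)] directly. *)
Lemma qf_le_frob M u : psd M -> qf M u <= Num.sqrt (\tr (M *m M)) * dot u u.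
Proof.
move=> pM; have sM := proj1 pM.
rewrite -(@ler_pXn2r _ 2%N) ?nnegrE ?(proj2 pM)// ?mulr_ge0 ?sqrtr_ge0 ?dot_ge0//.
rewrite exprMn sqr_sqrtr ?tr_sq_ge0//.
apply: le_trans (dot_CS _ _) _; rewrite [dot u u ^+ 2]expr2 mulrA.
by apply: ler_wpM2r; rewrite ?dot_ge0// dot_mul_le_frob.
Qed.

End QuadraticForms.

(** * Resolvents of positive definite matrices *)

Section Resolvent.
Variables (R : rcfType) (n : nat).
Implicit Types (u v w x : 'rV[R]_n) (M S F : 'M[R]_n).

Lemma mxtrace_le S F : (forall u, qf S u <= qf F u) -> \tr S <= \tr F.
Proof. by move=> h; apply: ler_sum => i _; rewrite !diag_qf. Qed.

(** The diagonal and trace estimates of the barrier step all reduce to comparing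
the forms of consecutive powers of one matrix [S] with [S <= rho]. *)
Section Powers.
Variables (S : 'M[R]_n) (rho : R).
Hypotheses (pS : psd S) (S_le : forall u, qf S u <= rho * dot u u).
Hypothesis (rho_ge0 : 0 <= rho).
Let sS := proj1 pS.

Lemma qf_sq_le u : dot (u *m S) (u *m S) <= rho * qf S u.
Proof.
have [h|h0] := eqVneq (dot (u *m S) (u *m S)) 0.
  by rewrite h mulr_ge0// (proj2 pS).
have hp : 0 < dot (u *m S) (u *m S) by rewrite lt_neqAle eq_sym h0 dot_ge0.
rewrite -(ler_pM2r hp) -expr2; apply: le_trans (psd_CS _ _ pS) _.
by rewrite [rho * _]mulrC -mulrA; apply: ler_wpM2l; rewrite ?(proj2 pS).
Qed.

Lemma qf2E u : qf (S *m S) u = dot (u *m S) (u *m S).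
Proof. by rewrite qf_sq. Qed.
Lemma qf3E u : qf (S *m S *m S) u = qf S (u *m S).
Proof. by rewrite qf_mul. Qed.
Lemma qf4E u : qf (S *m S *m (S *m S)) u = dot (u *m S *m S) (u *m S *m S).
Proof. by rewrite -(mulmxA u) -qf_sq// trmx_mul sS. Qed.
Lemma sym3 : (S *m S *m S)^T = S *m S *m S.
Proof. by rewrite !trmx_mul sS mulmxA. Qed.
Lemma sym2 : (S *m S)^T = S *m S.
Proof. by rewrite !trmx_mul sS. Qed.

Lemma qf2_le u : qf (S *m S) u <= rho * qf S u.
Proof. by rewrite qf2E qf_sq_le. Qed.
Lemma qf3_le u : qf (S *m S *m S) u <= rho * qf (S *m S) u.
Proof. by rewrite qf3E qf2E. Qed.
Lemma qf3_ge0 u : 0 <= qf (S *m S *m S) u.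
Proof. by rewrite qf3E (proj2 pS). Qed.
Lemma qf4_le u : qf (S *m S *m (S *m S)) u <= rho * qf (S *m S *m S) u.
Proof. by rewrite qf4E qf3E qf_sq_le. Qed.
Lemma qf6_le u : qf (S *m S *m S *m (S *m S *m S)) u
  <= rho ^+ 3 * qf (S *m S *m S) u.
Proof.
rewrite qf_sq ?sym3// !mulmxA (le_trans (qf_sq_le _))//.
rewrite exprS -mulrA; apply: ler_wpM2l => //.
apply: le_trans (S_le _) _; rewrite exprS expr1 -mulrA; apply: ler_wpM2l => //.
by rewrite qf3E qf_sq_le.
Qed.
Lemma qf2_CS u : qf (S *m S) u ^+ 2 <= qf S u * qf (S *m S *m S) u.
Proof. by rewrite qf2E qf3E psd_CS. Qed.

Lemma offdiag_CS i j : S i j ^+ 2 <= S i i * S j j.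
Proof. by rewrite mxE_dot !diag_qf psd_CS. Qed.
End Powers.

(** The smallest eigenvalue of [M] is at least the inverse of the Frobenius norm
of its inverse: this quantifies how far a level may be raised. *)
Lemma dot_le_qf M u : pd M ->
  dot u u <= Num.sqrt (\tr (invmx M *m invmx M)) * qf M u.
Proof.
move=> pM; have uM := pd_unit pM; set S := invmx M.
have pS : psd S := pd_psd (pd_inv pM).
have [->|u0] := eqVneq u 0; first by rewrite dot0l qf0 mulr0.
have hp := dot_gt0 u0.
rewrite -(ler_pM2r hp) -expr2.
have -> : dot u u ^+ 2 = dot (u *m S *m M) u ^+ 2 by rewrite mulmxKV.
apply: le_trans (psd_CS _ _ (pd_psd pM)) _.
have -> : qf M (u *m S) = qf S u by rewrite /qf mulmxKV// dotC.
rewrite mulrAC; apply: ler_wpM2r; rewrite ?qf_le_frob//.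
exact: (proj2 (pd_psd pM)).
Qed.

(** Raising the level by [del] replaces [S = invmx M] by [S' = invmx (M - del)].
The hypothesis [small] keeps [del] below a quarter of the smallest eigenvalue
of [M]. *)
Section Shift.
Variables (M : 'M[R]_n) (del : R).
Hypotheses (pM : pd M) (del_ge0 : 0 <= del).
Let S := invmx M.
Hypothesis small : 16 * del ^+ 2 * \tr (S *m S) <= 1.
Let M' := M - del%:M.
Let S' := invmx M'.

Let rho := Num.sqrt (\tr (S *m S)).
Let pS : psd S := pd_psd (pd_inv pM).
Let sS := proj1 pS.

Lemma shift_radius_le : del * rho <= 1 / 4.
Proof.
rewrite -(@ler_pXn2r _ 2%N) ?nnegrE ?mulr_ge0 ?sqrtr_ge0//.
rewrite exprMn sqr_sqrtr ?tr_sq_ge0//.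
have -> : (1 / 4 : R) ^+ 2 = 1 / 16 by field.
by move: small; set t := \tr _; set d := del ^+ 2; lra.
Qed.

Lemma pd_shift : pd M'.
Proof.
split; first by rewrite /M' linearB /= (proj1 pM) tr_scalar_mx.
move=> u u0; rewrite qfB qf_scalar subr_gt0.
have q0 := proj2 pM u u0.
have h1 := dot_le_qf u pM; have h2 := shift_radius_le.
have h3 : del * dot u u <= (del * rho) * qf M u.
  by rewrite -mulrA; apply: ler_wpM2l.
have h4 : (del * rho) * qf M u <= 1 / 4 * qf M u.
  by apply: ler_wpM2r => //; apply: ltW.
by apply: (le_lt_trans h3); apply: (le_lt_trans h4); lra.
Qed.

Let pS' : psd S' := pd_psd (pd_inv pd_shift).
Let sS' := proj1 pS'.

(** The resolvent identity. *)
Lemma resolvent_idl : S' - S = del *: (S *m S').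
Proof.
have h : S *m M' = 1%:M - del *: S.
  by rewrite mulmxBr mulVmx ?pd_unit// mul_mx_scalar.
have : S *m M' *m S' = S by rewrite mulmxK// pd_unit//; exact: pd_shift.
by rewrite h mulmxBl mul1mx -scalemxAl => e; rewrite -[X in _ - X]e subKr.
Qed.

Lemma resolvent_idr : S' - S = del *: (S' *m S).
Proof.
by rewrite -[LHS]trmxK linearB /= sS sS' resolvent_idl linearZ /= trmx_mul sS sS'.
Qed.

Lemma resolvent_comm : del *: (S *m S') = del *: (S' *m S).
Proof. by rewrite -resolvent_idl resolvent_idr. Qed.

Lemma shift_mono u : qf S u <= qf S' u.
Proof.
rewrite -subr_ge0 -qfB resolvent_idl.
have e : S' = S + del *: (S' *m S) by rewrite -resolvent_idr addrC subrK.
rewrite qfZ mulr_ge0//.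
rewrite {1}e mulmxDr -scalemxAr mulmxA qfD qf_sq// qfZ qf_mul//.
by rewrite addr_ge0 ?dot_ge0// mulr_ge0// (proj2 pS').
Qed.

(** Exactly [S' - S = del S' S]; replacing [S] by the larger [S'] on the right
expresses every increment through the new resolvent, the one that the next row
will meet. *)
Lemma shift_diag u : qf S' u <= qf S u + del * qf (S' *m S') u.
Proof.
rewrite -lerBlDl -qfB resolvent_idr qfZ; apply: ler_wpM2l => //.
rewrite -subr_ge0 -qfB -mulmxBr resolvent_idl -scalemxAr mulmxA qfZ qf_mul//.
by rewrite mulr_ge0// (proj2 pS).
Qed.

Lemma shift_sq u :
  qf (S' *m S') u <= qf (S *m S) u + 2 * del * qf (S' *m S' *m S') u.
Proof.
have A1 : S' *m S' - S *m S = del *: (S' *m S *m S') + del *: (S *m S' *m S).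
  have -> : S' *m S' - S *m S = (S' - S) *m S' + S *m (S' - S).
    by rewrite mulmxBl mulmxBr addrA subrK.
  by rewrite [in X in X + _]resolvent_idr resolvent_idr -scalemxAl -scalemxAr mulmxA.
rewrite -lerBlDl -qfB A1 qfD !qfZ.
have h1 : qf (S' *m S *m S') u <= qf (S' *m S' *m S') u.
  by rewrite !qf_mul//; exact: shift_mono.
have h2 : del * qf (S *m S' *m S) u <= del * qf (S' *m S *m S') u.
  rewrite -!qfZ -subr_ge0 -qfB.
  have -> : del *: (S *m S' *m S) = del *: (S' *m S *m S).
    by rewrite scalemxAl resolvent_comm -scalemxAl.
  rewrite -scalerBr qfZ mulr_ge0// -mulmxBr resolvent_idl -scalemxAr qfZ mulr_ge0//.
  have -> : S' *m S *m (S *m S') = (S' *m S) *m (S' *m S)^T.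
    by rewrite trmx_mul sS sS'.
  by rewrite /qf mulmxA dot_mul trmxK dot_ge0.
have h3 : del * qf (S' *m S *m S') u <= del * qf (S' *m S' *m S') u.
  exact: ler_wpM2l.
lra.
Qed.

Lemma shift_sq2 u : qf (S' *m S') u <= 2 * qf (S *m S) u.
Proof.
rewrite !qf_sq//; set w := u *m S'.
have -> : u *m S = w - del *: (w *m S).
  by rewrite /w -mulmxA scalemxAr -resolvent_idr mulmxBr subKr.
rewrite !(dotBl, dotBr, dotZl, dotZr) (dotC w).
have h1 : qf S w <= rho * dot w w by exact: qf_le_frob.
have h2 : del * qf S w <= 1 / 4 * dot w w.
  apply: le_trans (ler_wpM2l del_ge0 h1) _; rewrite mulrA.
  by apply: ler_wpM2r; rewrite ?dot_ge0 ?shift_radius_le.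
have h3 : 0 <= del * (del * dot (w *m S) (w *m S)).
  by rewrite !mulr_ge0 ?dot_ge0.
move: h2 h3; rewrite /qf; lra.
Qed.
End Shift.

Section RankOne.
Variables (M : 'M[R]_n) (x : 'rV[R]_n).
Hypothesis pM : pd M.
Let S := invmx M.
Let y := x *m S.
Let b := qf S x.
Let M2 := M + x^T *m x.
Let S2 := invmx M2.
Let c := (1 + b)^-1.

(** The Sherman-Morrison formula. *)
Lemma rank1_inv : S2 = S - c *: (y^T *m y).
Proof.
have pM2 : pd M2 by apply: pdD pM (psd_outer x).
have sM := proj1 pM.
have b0 : 0 <= b by apply: (proj2 (pd_psd (pd_inv pM))).
suff h : M2 *m (S - c *: (y^T *m y)) = 1%:M.
  by rewrite -[RHS](mulKmx (pd_unit pM2)) h mulmx1.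
rewrite mulmxBr mulmxDl mulmxV ?pd_unit// -scalemxAr mulmxDl.
have -> : M *m (y^T *m y) = x^T *m y.
  by rewrite mulmxA -{1}sM -trmx_mul mulmxKV// pd_unit.
have -> : x^T *m x *m (y^T *m y) = b *: (x^T *m y).
  rewrite -mulmxA (mulmxA x) (mx11_scalar (x *m y^T)) mul_scalar_mx.
  by rewrite -/(dot x y) dotC -scalemxAr.
rewrite -/S -mulmxA -/y -{2}(scale1r (x^T *m y)) -scalerDl scalerA mulVf ?scale1r ?addrK//.
by rewrite gt_eqF// ltr_wpDr.
Qed.

Lemma tr_outer u v : \tr (u^T *m v) = dot u v.
Proof. by rewrite mxtrace_mulC /mxtrace big_ord1 dotC. Qed.

Lemma rank1_tr : \tr S2 = \tr S - c * qf (S *m S) x.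
Proof.
have sS := proj1 (pd_inv pM).
by rewrite rank1_inv linearB /= linearZ /= tr_outer qf_sq.
Qed.

Lemma rank1_diag k : S2 k k = S k k - c * (y 0 k) ^+ 2.
Proof.
rewrite rank1_inv 2!mxE [in X in _ + X]mxE !mxE big_ord1 !mxE.
by rewrite -/S -/c expr2.
Qed.

Lemma rank1_tr2 : \tr (S2 *m S2) =
  \tr (S *m S) - 2 * c * qf (S *m S *m S) x + (c * qf (S *m S) x) ^+ 2.
Proof.
have sS := proj1 (pd_inv pM).
have e : \tr (S *m (y^T *m y)) = qf (S *m S *m S) x.
  have -> : S *m (y^T *m y) = (y *m S)^T *m y.
    by rewrite (trmx_mul y S) [S^T]sS mulmxA.
  by rewrite tr_outer (qf3E (pd_psd (pd_inv pM))).
have trB (F K : 'M[R]_n) : \tr (F - K) = \tr F - \tr K by rewrite raddfB.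
rewrite rank1_inv mulmxBl !mulmxBr !trB.
rewrite -!scalemxAl -!scalemxAr !mxtraceZ (mxtrace_mulC (y^T *m y) S) !e.
have -> : \tr (y^T *m y *m (y^T *m y)) = (qf (S *m S) x) ^+ 2.
  rewrite -mulmxA (mulmxA y) (mx11_scalar (y *m y^T)) mul_scalar_mx.
  by rewrite -scalemxAr mxtraceZ tr_outer qf_sq// expr2.
by rewrite -/S; ring.
Qed.
End RankOne.

End Resolvent.

(** * One step of the barrier *)

(** Expectations over a finite weighted set: the barrier argument is carried out
on such sets only, so that every function is integrable and measurable. *)
Section FiniteExpectation.
Variables (R : realType) (T : finType) (pr : T -> R).
Hypotheses (pr_ge0 : forall t, 0 <= pr t) (pr_sum : \sum_t pr t = 1).
Implicit Types f g : T -> R.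

Definition esp f : R := \sum_t pr t * f t.

Lemma esp_le f g : (forall t, f t <= g t) -> esp f <= esp g.
Proof. by move=> h; apply: ler_sum => t _; apply: ler_wpM2l. Qed.
Lemma espD f g : esp (fun t => f t + g t) = esp f + esp g.
Proof. by rewrite -big_split; apply: eq_bigr => t _; rewrite mulrDr. Qed.
Lemma espZ c f : esp (fun t => c * f t) = c * esp f.
Proof. by rewrite mulr_sumr; apply: eq_bigr => t _; rewrite mulrCA. Qed.
Lemma espC c : esp (fun=> c) = c.
Proof. by rewrite /esp -mulr_suml pr_sum mul1r. Qed.
Lemma espN f : esp (fun t => - f t) = - esp f.
Proof. by rewrite -sumrN; apply: eq_bigr => t _; rewrite mulrN. Qed.
Lemma espB f g : esp (fun t => f t - g t) = esp f - esp g.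
Proof. by rewrite espD espN. Qed.
Lemma eq_esp f g : f =1 g -> esp f = esp g.
Proof. by move=> h; apply: eq_bigr => t _; rewrite h. Qed.
Lemma esp_sum (I : finType) (F : I -> T -> R) :
  esp (fun t => \sum_i F i t) = \sum_i esp (F i).
Proof.
by rewrite exchange_big; apply: eq_bigr => t _ /=; rewrite mulr_sumr.
Qed.

Lemma expRN_le (y : R) : 0 <= y -> expR (- y) <= 1 - y + y ^+ 2.
Proof.
move=> y0; have h := expR_ge1Dx y; have h0 : 0 < 1 + y by lra.
rewrite expRN; apply: (@le_trans _ _ (1 + y)^-1).
  by rewrite lef_pV2 ?posrE ?expR_gt0.
rewrite -[leLHS]mul1r ler_pdivrMr//.
have -> : (1 - y + y ^+ 2) * (1 + y) = 1 + y ^+ 3 by ring.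
by rewrite lerDl exprn_ge0.
Qed.

Lemma esp_expN f : (forall t, 0 <= f t) ->
  esp (fun t => expR (- f t)) <= expR (- esp f + esp (fun t => f t ^+ 2)).
Proof.
move=> f0; apply: le_trans (expR_ge1Dx _).
have -> : 1 + (- esp f + esp (fun t => f t ^+ 2)) =
    esp (fun t => 1 - f t + f t ^+ 2) by rewrite espD espB espC addrA.
by apply: esp_le => t; exact: expRN_le.
Qed.

(** Second order bound of an exponential moment: an increment [up - f] with [f]
nonnegative has exponential moment at most [1] as soon as its mean is negative
enough to absorb [lam] times the second moment of [f]. *)
Lemma esp_exp_drift_le1 f (lam up m s : R) :
  (forall t, 0 <= f t) -> 0 <= lam ->
  m <= esp f -> esp (fun t => f t ^+ 2) <= s -> up - m + lam * s <= 0 ->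
  esp (fun t => expR (lam * (up - f t))) <= 1.
Proof.
move=> f0 l0 mf sf h.
have -> : esp (fun t => expR (lam * (up - f t))) =
    expR (lam * up) * esp (fun t => expR (- (lam * f t))).
  by rewrite -espZ; apply: eq_esp => t; rewrite -expRD; congr expR; ring.
have h1 := @esp_expN (fun t => lam * f t) _.
apply: le_trans (ler_wpM2l (expR_ge0 _) (h1 _)) _ => [t|]; first exact: mulr_ge0.
rewrite -expRD -expR0 ler_expR espZ.
have -> : esp (fun t => (lam * f t) ^+ 2) = lam ^+ 2 * esp (fun t => f t ^+ 2).
  by rewrite -espZ; apply: eq_esp => t; rewrite exprMn.
set E1 := esp f in mf *; set E2 := esp _ in sf *.
have e1 : lam * (up - m + lam * s) <= 0 by rewrite mulr_ge0_le0.
have e2 : lam * m <= lam * E1 by exact: ler_wpM2l.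
have e3 : lam ^+ 2 * E2 <= lam ^+ 2 * s by rewrite ler_wpM2l ?sqr_ge0.
nra.
Qed.
End FiniteExpectation.

Section Step.
Variables (R : realType) (n : nat) (T : finType) (pr : T -> R).
Variables (x : T -> 'rV[R]_n) (om k2 : R).
Hypotheses (pr_ge0 : forall t, 0 <= pr t) (pr_sum : \sum_t pr t = 1).
Local Notation E := (esp pr).

(** Isotropy of the random row, up to the factor [om], which is slightly smaller
than [1] because rows with a large entry are set to zero. *)
Definition moment1 := forall F : 'M[R]_n, F^T = F ->
  E (fun t => qf F (x t)) = om * \tr F.
(** For independent entries the mean of a product of two quadratic forms is
[\tr F * \tr K + 2 * \tr (F *m K)] plus a correction by the fourth cumulant. *)
Definition moment2 := forall F K : 'M[R]_n, psd F -> psd K ->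
  E (fun t => qf F (x t) * qf K (x t)) <=
    \tr F * \tr K + 2 * \tr (F *m K) + k2 * \sum_k F k k * K k k.

Variables (del nu phim ck cp lam1 lam2 a : R) (m3 : nat).
Hypotheses (M1 : moment1) (M2 : moment2).
Hypotheses (n_gt0 : (0 < n)%N) (om_le1 : om <= 1).
Hypotheses (k2_ge0 : 0 <= k2) (del_ge0 : 0 <= del).
Hypotheses (phim_ge0 : 0 <= phim) (ck_gt0 : 0 < ck) (cp_gt0 : 0 < cp).
Hypotheses (lam1_ge0 : 0 <= lam1) (lam2_ge0 : 0 <= lam2) (a_ge0 : 0 <= a).

(** The relative error made by replacing [x S' x] by its upper bound [phim], when
[Num.sqrt (2 * cp)] bounds the norm of [S'] and [2 * ck] its diagonal.  [err]
adds the effect of one shift on the trace and of the defect [1 - om]. *)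
Definition err1 : R := 3 * Num.sqrt (2 * cp) + 2 * ck * k2.
Definition err : R := 2 * del * cp + err1 + 2 * (1 - om).
Local Notation r := (Num.sqrt (2 * cp)).
Local Notation e1 := err1.
Local Notation e := err.

(* [slope] is the balance between the shift and the mean effect of a row; it
   leaves the margin [nu].  The others say that the margin absorbs all errors:
   [h1] allows the shift, [h2] and [h3] serve [pot1] and [pot2], [h4] and [h5]
   the two parts of the exponent of [pot3]. *)
Hypothesis slope : (del + nu) * (1 + phim) = 1.
Hypothesis h1 : 16 * del ^+ 2 * cp <= 1.
Hypothesis h2 : e + lam1 * (r * e1) <= nu.
Hypothesis h3 : e + lam2 * (2 * ck * e1) <= nu.
Hypothesis h4 : 2 * e + e1 + 16 * m3%:R * e1 <= 2 * nu.
Hypothesis h5 : 2 + 2 * m3%:R * a ^+ 2 * (r * e1) <= a * (nu - e).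

(** The three parts of the potential control [\tr S], the diagonal of [S] and
[\tr (S *m S)].  The third one needs the factor [expR (a * \tr S)]: by itself
[\tr (S *m S)] may grow by [2 * del * \tr S'^3] plus the square of the drop of
the trace, and the latter is compensated by the decrease of [\tr S]. *)
Definition pot1 (S : 'M[R]_n) : R := expR (lam1 * (\tr S - phim)).
Definition pot2 (S : 'M[R]_n) (k : 'I_n) : R := expR (lam2 * (S k k - ck)).
Definition pot3 (S : 'M[R]_n) : R :=
  (\tr (S *m S) / cp * expR (a * \tr S)) ^+ m3.
Definition pot (S : 'M[R]_n) : R := pot1 S + \sum_k pot2 S k + pot3 S.

Lemma pot3_ge0 (S : 'M[R]_n) : S^T = S -> 0 <= pot3 S.
Proof.
move=> sS; rewrite exprn_ge0// mulr_ge0 ?expR_ge0// divr_ge0 ?tr_sq_ge0//.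
exact: ltW.
Qed.

(** Each part of the potential being nonnegative, a potential below [1] keeps
each of them below [1]. *)
Section Good.
Variable S : 'M[R]_n.
Hypotheses (pS : pd S) (potS : pot S < 1).
Let sS := proj1 pS.

Let pot2_ge0 : 0 <= \sum_k pot2 S k.
Proof. by apply: sumr_ge0 => k _; exact: expR_ge0. Qed.

Lemma pot_lt1_tr : \tr S <= phim.
Proof.
have : pot1 S < 1.
  apply: le_lt_trans potS; rewrite /pot -addrA lerDl addr_ge0 ?pot3_ge0//.
rewrite expR_lt1 => h; rewrite leNgt; apply/negP => h'.
by move: h; rewrite ltNge mulr_ge0// subr_ge0 ltW.
Qed.

Lemma pot_lt1_diag k : S k k <= ck.
Proof.
have : pot2 S k < 1.
  apply: le_lt_trans potS.
  have -> : pot S = pot2 S k +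
      (\sum_(i < n | i != k) pot2 S i + (pot1 S + pot3 S)).
    rewrite /pot (bigD1 k)//=; ring.
  rewrite lerDl addr_ge0 ?addr_ge0 ?expR_ge0 ?pot3_ge0//.
  by apply: sumr_ge0 => i _; exact: expR_ge0.
rewrite expR_lt1 => h; rewrite leNgt; apply/negP => h'.
by move: h; rewrite ltNge mulr_ge0// subr_ge0 ltW.
Qed.

Lemma pot_lt1_sq : \tr (S *m S) <= cp.
Proof.
have : pot3 S < 1.
  by apply: le_lt_trans potS; rewrite /pot lerDr addr_ge0 ?expR_ge0.
rewrite leNgt => h; apply/negP => h'; move: h; apply/negP; rewrite -leNgt.
rewrite exprn_ege1// -[leLHS]mulr1 ler_pM ?ler01//.
  by rewrite ler_pdivlMr// mul1r ltW.
rewrite -expR0 ler_expR mulr_ge0//; apply: sumr_ge0 => k _.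
by rewrite diag_qf (proj2 (pd_psd pS)).
Qed.
End Good.

Section OneStep.
Variable M : 'M[R]_n.
Hypotheses (pM : pd M).
Let S := invmx M.
Hypothesis potS : pot S < 1.
Let M' := M - del%:M.
Let S' := invmx M'.
Let pS : pd S := pd_inv pM.
Let trS := \tr S.
Let psi := \tr (S *m S).
Let t2 := \tr (S' *m S').
Let t3 := \tr (S' *m S' *m S').
Let rho := Num.sqrt t2.
Let q k := (S' *m S') k k.
Let b t := qf S' (x t).

Let psi_le : psi <= cp. Proof. exact: pot_lt1_sq. Qed.

Let small : 16 * del ^+ 2 * \tr (S *m S) <= 1.
Proof.
apply: le_trans h1; apply: ler_wpM2l => //.
by rewrite mulr_ge0// sqr_ge0.
Qed.

Lemma pot_lt1_pd_shift : pd M'. Proof. exact: pd_shift. Qed.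
Let pS' : psd S' := pd_psd (pd_inv pot_lt1_pd_shift).
Let sS' := proj1 pS'.
Let rho_le u : qf S' u <= rho * dot u u. Proof. exact: qf_le_frob. Qed.
Let rho0 : 0 <= rho. Proof. exact: sqrtr_ge0. Qed.
Let rho2 : rho ^+ 2 = t2. Proof. by rewrite sqr_sqrtr// tr_sq_ge0. Qed.
Let t2_ge0 : 0 <= t2. Proof. exact: tr_sq_ge0. Qed.
Let t3_ge0 : 0 <= t3.
Proof. by apply: sumr_ge0 => k _; rewrite diag_qf; exact: qf3_ge0. Qed.

Lemma tr_shift : \tr S' <= trS + del * t2.
Proof.
rewrite -mxtraceZ -mxtraceD; apply: mxtrace_le => u; rewrite qfD qfZ.
exact: shift_diag.
Qed.

Lemma diag_shift k : S' k k <= S k k + del * q k.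
Proof. by rewrite /q !diag_qf; exact: shift_diag. Qed.

Lemma sq_shift : t2 <= psi + 2 * del * t3.
Proof.
rewrite -mxtraceZ -mxtraceD; apply: mxtrace_le => u; rewrite qfD qfZ.
exact: shift_sq.
Qed.

Lemma sq_shift2 : t2 <= 2 * psi.
Proof.
by rewrite -mxtraceZ; apply: mxtrace_le => u; rewrite qfZ; exact: shift_sq2.
Qed.

Lemma rho_le_r : rho <= r.
Proof.
rewrite ler_wsqrtr//; apply: le_trans sq_shift2 _.
by apply: ler_wpM2l.
Qed.

Lemma S'_ge0 k : 0 <= S' k k. Proof. by rewrite diag_qf (proj2 pS'). Qed.

Lemma q_le k : q k <= rho * S' k k.
Proof. by rewrite /q !diag_qf; exact: qf2_le. Qed.

(* The diagonal entries at most double: [del * rho <= 1 / 2] makes the shift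
   of [S' k k] at most half of itself. *)
Lemma S'_le k : S' k k <= 2 * ck.
Proof.
have h := diag_shift k; have hq := q_le k; have hk := pot_lt1_diag pS potS k.
have dr : del * rho <= 1 / 2.
  rewrite -(@ler_pXn2r _ 2%N) ?nnegrE ?mulr_ge0 ?divr_ge0//.
  rewrite exprMn rho2.
  have g1 : del ^+ 2 * t2 <= del ^+ 2 * (2 * cp).
    apply: ler_wpM2l; rewrite ?sqr_ge0//; apply: le_trans sq_shift2 _.
    exact: ler_wpM2l.
  have -> : (1 / 2 : R) ^+ 2 = 1 / 4 by field.
  move: h1 g1; set d2 := del ^+ 2; lra.
have h' : del * q k <= 1 / 2 * S' k k.
  apply: le_trans (ler_wpM2l del_ge0 hq) _; rewrite mulrA.
  by apply: ler_wpM2r => //; exact: S'_ge0.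
have : S k k <= ck by []. lra.
Qed.

Lemma b_ge0 t : 0 <= b t. Proof. exact: (proj2 pS'). Qed.
Lemma b1_gt0 t : 0 < 1 + b t. Proof. by rewrite ltr_wpDr ?b_ge0. Qed.

Lemma e1_ge : 3 * rho + 2 * ck * k2 <= e1.
Proof. by rewrite /err1 lerD2r; apply: ler_wpM2l; [exact: ler0n|exact: rho_le_r]. Qed.

Lemma e1_ge0 : 0 <= e1.
Proof. by apply: le_trans e1_ge; rewrite addr_ge0 ?mulr_ge0 ?(ltW ck_gt0). Qed.

Lemma e_ge0 : 0 <= e.
Proof.
have h0 : 0 <= 2 * del * cp by rewrite mulr_ge0 ?(ltW cp_gt0)// mulr_ge0.
have h0' : 0 <= 2 * (1 - om) by rewrite mulr_ge0// subr_ge0.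
by rewrite /err addr_ge0// addr_ge0// e1_ge0.
Qed.

Lemma tr_shift_phim : \tr S' <= phim + 2 * del * cp.
Proof.
apply: le_trans tr_shift _; apply: lerD; first exact: pot_lt1_tr.
rewrite [2 * del]mulrC -mulrA; apply: ler_wpM2l => //.
by apply: le_trans sq_shift2 _; apply: ler_wpM2l.
Qed.

(** The drop caused by a row is a quotient [qf F x / (1 + b)] with
[b = qf S' x].  The convex function [1 / (1 + b)] lies above its tangent at
[phim], which is affine in [b], so that a lower bound for the mean needs only
the two moments of the row. *)
Lemma esp_drop_ge F : F^T = F -> (forall u, 0 <= qf F u) ->
  \tr (F *m S') <= rho * \tr F ->
  \tr F * (del + nu - e) <= E (fun t => qf F (x t) / (1 + b t)).
Proof.
move=> sF pF trF; set s := del + nu; set tF := \tr F.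
have dF k : 0 <= F k k by rewrite diag_qf.
have tF0 : 0 <= tF by apply: sumr_ge0.
have p1 : 0 < 1 + phim by rewrite ltr_wpDr.
have s0 : 0 < s.
  by rewrite -(pmulr_lgt0 s p1) slope.
have s1 : s <= 1 by rewrite -slope ler_peMr ?(ltW s0)// lerDl.
have tang t : s ^+ 2 * (1 + 2 * phim) * qf F (x t) -
    s ^+ 2 * (qf F (x t) * qf S' (x t)) <= qf F (x t) / (1 + b t).
  rewrite -/(b t) ler_pdivlMr ?b1_gt0//.
  have -> : (s ^+ 2 * (1 + 2 * phim) * qf F (x t) - s ^+ 2 * (qf F (x t) * b t))
      * (1 + b t) = qf F (x t) * (1 - (s * (b t - phim)) ^+ 2
         + ((s * (1 + phim)) ^+ 2 - 1)) by ring.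
  rewrite /s slope expr1n subrr addr0 -[leRHS]mulr1; apply: ler_wpM2l => //.
  by rewrite gerBl sqr_ge0.
apply: le_trans (esp_le pr_ge0 tang).
rewrite espB !espZ M1//.
have m2 := M2 (conj sF pF) pS'.
have dsum : \sum_k F k k * S' k k <= 2 * ck * tF.
  rewrite mulr_sumr; apply: ler_sum => k _; rewrite mulrC.
  by apply: ler_wpM2r => //; exact: S'_le.
have k2sum : k2 * \sum_k F k k * S' k k <= k2 * (2 * ck * tF).
  exact: ler_wpM2l.
have trS' : tF * \tr S' <= tF * (phim + 2 * del * cp).
  by apply: ler_wpM2l => //; exact: tr_shift_phim.
have m2' : E (fun t => qf F (x t) * qf S' (x t)) <=
    tF * (phim + 2 * del * cp + e1).
  apply: le_trans m2 _.
  have : tF * (3 * rho + 2 * ck * k2) <= tF * e1.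
    by apply: ler_wpM2l => //; exact: e1_ge.
  have : 0 <= tF * rho by rewrite mulr_ge0.
  move: trF k2sum trS'; rewrite -/tF; set X := k2 * \sum_k _; lra.
have s2 : 0 <= s ^+ 2 by rewrite sqr_ge0.
have := ler_wpM2l s2 m2'; set EE := s ^+ 2 * esp _ _ => hEE.
have key : tF * (s - e) <= s ^+ 2 * (1 + 2 * phim) * (om * tF) -
   s ^+ 2 * (tF * (phim + 2 * del * cp + e1)); last by lra.
have -> : s ^+ 2 * (1 + 2 * phim) * (om * tF) -
   s ^+ 2 * (tF * (phim + 2 * del * cp + e1)) =
   tF * (s * (s * (1 + phim)) - s * (s * (1 + 2 * phim)) * (1 - om)
     - s ^+ 2 * (2 * del * cp + e1)) by ring.
have slope' : s * (1 + phim) = 1 by exact: slope.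
apply: ler_wpM2l => //; rewrite slope' mulr1.
have ss : s * (1 + 2 * phim) <= 2.
  have -> : s * (1 + 2 * phim) = 2 * (s * (1 + phim)) - s by ring.
  by rewrite slope; lra.
have ss0 : 0 <= s * (1 + 2 * phim) by rewrite mulr_ge0 ?ltW// ltr_wpDr// mulr_ge0.
have d1 : s * (s * (1 + 2 * phim)) * (1 - om) <= 2 * (1 - om).
  apply: ler_wpM2r; rewrite ?subr_ge0//; apply: le_trans ss.
  by rewrite ler_piMl.
have d2 : s ^+ 2 * (2 * del * cp + e1) <= 2 * del * cp + e1.
  apply: ler_piMl; last by rewrite exprn_ile1 ?(ltW s0).
  by rewrite addr_ge0 ?e1_ge0// mulr_ge0 ?(ltW cp_gt0)// mulr_ge0.
move: d1 d2; rewrite /err; lra.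
Qed.

Lemma esp_drop_sq_le F : F^T = F -> (forall u, 0 <= qf F u) ->
  E (fun t => (qf F (x t) / (1 + b t)) ^+ 2) <=
  \tr F ^+ 2 + 2 * \tr (F *m F) + k2 * \sum_k F k k ^+ 2.
Proof.
move=> sF pF; apply: (le_trans _ (M2 (conj sF pF) (conj sF pF))).
apply: esp_le => // t; rewrite -expr2 ler_pXn2r ?nnegrE ?pF//.
  by rewrite ler_pdivrMr ?b1_gt0// ler_peMr// lerDl b_ge0.
by rewrite divr_ge0// ltW// b1_gt0.
Qed.

Let p2 := S' *m S'.
Let p3 := S' *m S' *m S'.

Lemma tr4_le : \tr (p2 *m p2) <= rho * t3.
Proof. by rewrite -mxtraceZ; apply: mxtrace_le => u; rewrite qfZ; exact: qf4_le. Qed.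

Lemma t3_le : t3 <= rho * t2.
Proof. by rewrite -mxtraceZ; apply: mxtrace_le => u; rewrite qfZ; exact: qf3_le. Qed.

Lemma p2_ge0 u : 0 <= qf p2 u. Proof. by rewrite qf2E ?dot_ge0. Qed.
Lemma p3_ge0 u : 0 <= qf p3 u. Proof. exact: qf3_ge0. Qed.
Lemma q_ge0 k : 0 <= q k. Proof. by rewrite /q diag_qf p2_ge0. Qed.

Lemma q_le_ck k : q k <= rho * (2 * ck).
Proof. by apply: le_trans (q_le k) _; apply: ler_wpM2l => //; exact: S'_le. Qed.

(** Two bounds on the same second moment: one relative to [t2], for the
exponentials of the trace, and one relative to [t3], to be compared with the
drop of [\tr (S *m S)]. *)
Lemma esp_drop2_sq_le_t2 :
  E (fun t => (qf p2 (x t) / (1 + b t)) ^+ 2) <= t2 * (r * e1).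
Proof.
apply: le_trans (esp_drop_sq_le (sym2 pS') p2_ge0) _.
have h4' : \tr (p2 *m p2) <= rho ^+ 2 * t2.
  apply: le_trans tr4_le _; rewrite expr2 -mulrA; apply: ler_wpM2l => //.
  exact: t3_le.
have hs : \sum_k p2 k k ^+ 2 <= rho * (2 * ck) * t2.
  rewrite mulr_sumr; apply: ler_sum => k _; rewrite expr2.
  by apply: ler_wpM2r; [exact: q_ge0|exact: q_le_ck].
have := ler_wpM2l k2_ge0 hs.
have -> : t2 ^+ 2 = rho ^+ 2 * t2 by rewrite rho2 expr2.
have h5' : t2 * (rho * (3 * rho + 2 * ck * k2)) <= t2 * (r * e1).
  apply: ler_wpM2l => //; apply: ler_pM => //; last exact: e1_ge.
    by rewrite addr_ge0 ?mulr_ge0 ?(ltW ck_gt0).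
  exact: rho_le_r.
move: h4' h5'; rewrite -/p2 -/t2; set X := k2 * _; set Y := \tr _.
move=> *; lra.
Qed.

Lemma esp_drop2_sq_le_t3 :
  E (fun t => (qf p2 (x t) / (1 + b t)) ^+ 2) <= t2 ^+ 2 + e1 * t3.
Proof.
apply: le_trans (esp_drop_sq_le (sym2 pS') p2_ge0) _.
have hs : \sum_k p2 k k ^+ 2 <= 2 * ck * t3.
  rewrite mulr_sumr; apply: ler_sum => k _; rewrite !diag_qf.
  apply: le_trans (qf2_CS pS' _) _; rewrite -!diag_qf.
  by apply: ler_wpM2r; [rewrite diag_qf p3_ge0|exact: S'_le].
have := ler_wpM2l k2_ge0 hs.
have h5' : t3 * (3 * rho + 2 * ck * k2) <= t3 * e1.
  by apply: ler_wpM2l => //; exact: e1_ge.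
have h6 : 0 <= rho * t3 by rewrite mulr_ge0.
have := tr4_le.
move: h5' h6; rewrite -/p2 -/t2; set X := k2 * _; set Y := \tr (p2 *m p2).
move=> *; lra.
Qed.

Lemma esp_drop3_sq_le :
  E (fun t => (qf p3 (x t) / (1 + b t)) ^+ 2) <= t3 * t2 * e1.
Proof.
apply: le_trans (esp_drop_sq_le (sym3 pS') p3_ge0) _.
have h6 : \tr (p3 *m p3) <= rho ^+ 3 * t3.
  by rewrite -mxtraceZ; apply: mxtrace_le => u; rewrite qfZ; exact: qf6_le.
have hs : \sum_k p3 k k ^+ 2 <= rho ^+ 2 * (2 * ck) * t3.
  rewrite mulr_sumr; apply: ler_sum => k _; rewrite expr2.
  apply: ler_wpM2r; first by rewrite diag_qf p3_ge0.
  rewrite expr2 -mulrA; apply: (le_trans _ (ler_wpM2l rho0 (q_le_ck k))).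
  by rewrite /q !diag_qf; exact: qf3_le.
have := ler_wpM2l k2_ge0 hs.
have h3' : t3 ^+ 2 <= rho ^+ 3 * t3.
  rewrite expr2; apply: ler_wpM2r => //; rewrite exprSr rho2 mulrC.
  exact: t3_le.
have h5' : t3 * t2 * (3 * rho + 2 * ck * k2) <= t3 * t2 * e1.
  by apply: ler_wpM2l; [rewrite mulr_ge0|exact: e1_ge].
have e3 : rho ^+ 3 * t3 = t3 * t2 * rho by rewrite exprSr rho2; ring.
have e2 : k2 * (rho ^+ 2 * (2 * ck) * t3) = t3 * t2 * (2 * ck * k2).
  by rewrite rho2; ring.
move: h6 h3' h5'; rewrite e2 e3 -/p3 -/t3.
set X := k2 * _; set Y := \tr (p3 *m p3).
move=> *; lra.
Qed.

Let y k := row k S'.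
Let Fk k := (y k)^T *m y k.

(** The drop of the entry [k, k] of the resolvent is itself the quadratic form of
a rank one matrix, so that the general estimates apply to it. *)
Lemma qf_Fk k t : qf (Fk k) (x t) = (x t *m S') 0 k ^+ 2.
Proof.
rewrite qf_outer; congr (_ ^+ 2); rewrite dotE mxE; apply: eq_bigr => j _.
have -> : y k 0 j = S' k j by rewrite [LHS]mxE.
suff -> : S' k j = S' j k by [].
by rewrite -[in LHS]sS' [LHS]mxE.
Qed.

Lemma Fk_diag k l : Fk k l l = S' k l ^+ 2.
Proof.
have outer_diag (v : 'rV[R]_n) : (v^T *m v) l l = v 0 l ^+ 2.
  by rewrite mxE big_ord1 mxE expr2.
by rewrite outer_diag; congr (_ ^+ 2); rewrite mxE.
Qed.

Lemma tr_Fk k : \tr (Fk k) = q k.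
Proof. by rewrite tr_outer /q diag_qf qf2E// -rowE. Qed.

Lemma Fk_offdiag k l : S' k l ^+ 2 <= 2 * ck * (2 * ck).
Proof.
apply: le_trans (offdiag_CS pS' k l) _.
by apply: ler_pM; rewrite ?S'_ge0 ?S'_le.
Qed.

Lemma esp_dropk_sq_le k :
  E (fun t => (qf (Fk k) (x t) / (1 + b t)) ^+ 2) <= q k * (2 * ck * e1).
Proof.
apply: le_trans (esp_drop_sq_le (sym_outer _) _) _.
  by move=> u; rewrite qf_outer sqr_ge0.
have -> : \tr (Fk k *m Fk k) = q k ^+ 2.
  rewrite /Fk -mulmxA (mulmxA (y k)) (mx11_scalar (y k *m _)) mul_scalar_mx.
  by rewrite -scalemxAr mxtraceZ tr_Fk -/(dot _ _) -(tr_outer (y k)) tr_Fk expr2.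
have hs : \sum_l Fk k l l ^+ 2 <= 2 * ck * (2 * ck) * q k.
  rewrite -tr_Fk mulr_sumr; apply: ler_sum => l _; rewrite Fk_diag expr2.
  by apply: ler_wpM2r; rewrite ?sqr_ge0// Fk_offdiag.
have := ler_wpM2l k2_ge0 hs.
have hq : q k ^+ 2 <= q k * (2 * ck) * rho.
  rewrite expr2 -mulrA; apply: ler_wpM2l; first exact: q_ge0.
  by rewrite mulrC q_le_ck.
have h5' : q k * (2 * ck) * (3 * rho + 2 * ck * k2) <= q k * (2 * ck) * e1.
  apply: ler_wpM2l; last exact: e1_ge.
  by rewrite mulr_ge0 ?q_ge0// mulr_ge0 ?(ltW ck_gt0).
rewrite tr_Fk; move: hq h5'; set X := k2 * \sum_l _.
move=> *; lra.
Qed.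

Lemma esp_drop2_ge : t2 * (del + nu - e) <= E (fun t => qf p2 (x t) / (1 + b t)).
Proof.
exact: esp_drop_ge (sym2 pS') p2_ge0 t3_le.
Qed.

Lemma esp_drop3_ge : t3 * (del + nu - e) <= E (fun t => qf p3 (x t) / (1 + b t)).
Proof.
apply: esp_drop_ge (sym3 pS') p3_ge0 _.
by have := tr4_le; rewrite /p2 mulmxA.
Qed.

Lemma esp_dropk_ge k :
  q k * (del + nu - e) <= E (fun t => qf (Fk k) (x t) / (1 + b t)).
Proof.
rewrite -tr_Fk; apply: esp_drop_ge (sym_outer _) _ _.
  by move=> u; rewrite qf_outer sqr_ge0.
rewrite tr_Fk /Fk -mulmxA tr_outer dotC -/(qf S' (y k)) /q.
have -> : y k = delta_mx 0 k *m S' by rewrite -rowE.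
by rewrite -qf3E// diag_qf qf3_le.
Qed.

Let next t := invmx (M' + (x t)^T *m x t).

Lemma pot1_step : E (fun t => pot1 (next t)) <= pot1 S.
Proof.
pose Y t := qf p2 (x t) / (1 + b t).
have hY t : 0 <= Y t by rewrite divr_ge0 ?p2_ge0// ltW// b1_gt0.
apply: (@le_trans _ _ (E (fun t => pot1 S * expR (lam1 * (del * t2 - Y t))))).
  apply: esp_le => // t; rewrite -expRD ler_expR -mulrDr; apply: ler_wpM2l => //.
  rewrite rank1_tr; last exact: pot_lt1_pd_shift.
  have := tr_shift; rewrite /Y /p2 mulrC -/(b t) -/M' -/S' -/trS; lra.
rewrite espZ -[leRHS]mulr1; apply: ler_wpM2l; first exact: expR_ge0.
apply: (@esp_exp_drift_le1 _ _ pr pr_ge0 pr_sum Y _ _ _ _ hY lam1_ge0 esp_drop2_ge esp_drop2_sq_le_t2).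
have -> : del * t2 - t2 * (del + nu - e) + lam1 * (t2 * (r * e1)) =
  t2 * ((e + lam1 * (r * e1)) - nu) by ring.
by rewrite mulr_ge0_le0// subr_le0.
Qed.

Lemma pot2_step k : E (fun t => pot2 (next t) k) <= pot2 S k.
Proof.
pose Y t := qf (Fk k) (x t) / (1 + b t).
have hY t : 0 <= Y t by rewrite divr_ge0 ?(ltW (b1_gt0 t))// qf_outer sqr_ge0.
apply: (@le_trans _ _ (E (fun t => pot2 S k * expR (lam2 * (del * q k - Y t))))).
  apply: esp_le => // t; rewrite -expRD ler_expR -mulrDr; apply: ler_wpM2l => //.
  rewrite rank1_diag; last exact: pot_lt1_pd_shift.
  have := diag_shift k; rewrite /Y qf_Fk mulrC -/(b t) -/M' -/S'; lra.
rewrite espZ -[leRHS]mulr1; apply: ler_wpM2l; first exact: expR_ge0.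
apply: (@esp_exp_drift_le1 _ _ pr pr_ge0 pr_sum Y _ _ _ _ hY lam2_ge0 (esp_dropk_ge k) (esp_dropk_sq_le k)).
have -> : del * q k - q k * (del + nu - e) + lam2 * (q k * (2 * ck * e1)) =
  q k * ((e + lam2 * (2 * ck * e1)) - nu) by ring.
by rewrite mulr_ge0_le0 ?q_ge0// subr_le0.
Qed.

Lemma psi_gt0 : 0 < psi.
Proof.
rewrite /psi tr_sq ?(proj1 pS)// lt_neqAle sumr_ge0 ?andbT; last first.
  by move=> i _; exact: dot_ge0.
apply/eqP => /esym/psumr_eq0P h.
have k : 'I_n := Ordinal n_gt0.
have /eqP : dot (row k S) (row k S) = 0 by apply: h => // i _; exact: dot_ge0.
rewrite dot_eq0 => /eqP r0.
have d0 : (delta_mx 0 k : 'rV[R]_n) != 0.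
  apply/eqP => /rowP /(_ k); rewrite !mxE !eqxx /=; apply/eqP.
  exact: oner_neq0.
by have := proj2 pS _ d0; rewrite /qf -rowE r0 dot0l ltxx.
Qed.

(** The square [Y ^+ 2] in the rank one formula for [\tr (S *m S)] has the wrong
sign, but [Y ^+ 2 <= Y3] by the Cauchy-Schwarz inequality; the relative drop
[V] is thus nonnegative, as the exponential estimate requires. *)
Lemma pot3_step : E (fun t => pot3 (next t)) <= pot3 S.
Proof.
pose Y t := qf p2 (x t) / (1 + b t).
pose Y3 t := qf p3 (x t) / (1 + b t).
pose V t := (2 * Y3 t - Y t ^+ 2) / psi + a * Y t.
have hY t : 0 <= Y t by rewrite divr_ge0 ?p2_ge0// ltW// b1_gt0.
have hY3 t : 0 <= Y3 t by rewrite divr_ge0 ?p3_ge0// ltW// b1_gt0.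
have YY3 t : Y t ^+ 2 <= Y3 t.
  rewrite /Y /Y3 expr_div_n ler_pdivrMr ?exprn_gt0 ?b1_gt0//.
  rewrite expr2 mulrA mulfVK ?gt_eqF ?b1_gt0//.
  have := qf2_CS pS' (x t); rewrite -/(b t) -/p2 -/p3 => h.
  apply: le_trans h _; rewrite mulrC; apply: ler_wpM2l; first exact: p3_ge0.
  by rewrite lerDr.
have psi0 := psi_gt0.
have hV t : 0 <= V t.
  apply: addr_ge0; last exact: mulr_ge0.
  apply: divr_ge0; last exact: ltW.
  by have := YY3 t; have := hY3 t; lra.
pose up := 2 * del * t3 / psi + a * (del * t2).
pose m := (2 * (t3 * (del + nu - e)) - (t2 ^+ 2 + e1 * t3)) / psi
          + a * (t2 * (del + nu - e)).
pose s := 8 * (t3 * t2 * e1) / psi ^+ 2 + 2 * a ^+ 2 * (t2 * (r * e1)).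
have next_le t : pot3 (next t) <= pot3 S * expR (m3%:R * (up - V t)).
  have pN : pd (M' + (x t)^T *m x t) := pdD pot_lt1_pd_shift (psd_outer (x t)).
  have pnx : pd (next t) := pd_inv pN.
  rewrite /pot3 expRM_natl -exprMn; apply: lerXn2r; rewrite ?nnegrE.
  - by rewrite mulr_ge0 ?expR_ge0// divr_ge0 ?(ltW cp_gt0)// tr_sq_ge0// (proj1 pnx).
  - by rewrite !mulr_ge0 ?expR_ge0// ?invr_ge0 ?(ltW cp_gt0)// (ltW psi0).
  pose w := (2 * del * t3 - (2 * Y3 t - Y t ^+ 2)) / psi.
  have n2 : \tr (next t *m next t) <= psi * expR w.
    apply: (@le_trans _ _ (psi * (1 + w))); last first.
      by apply: ler_wpM2l; [exact: ltW|exact: expR_ge1Dx].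
    rewrite /w mulrDr mulr1 mulrCA divff ?gt_eqF// mulr1.
    rewrite rank1_tr2; last exact: pot_lt1_pd_shift.
    have := sq_shift; rewrite /Y /Y3 /p2 /p3 -/M' -/S' -/(b t).
    rewrite ![_ / (1 + b t)]mulrC; lra.
  have n1 : \tr (next t) <= trS + (del * t2 - Y t).
    rewrite rank1_tr; last exact: pot_lt1_pd_shift.
    have := tr_shift; rewrite /Y /p2 -/M' -/S' -/(b t) [_ / (1 + b t)]mulrC; lra.
  apply: (@le_trans _ _ (psi * expR w / cp * expR (a * (trS + (del * t2 - Y t))))).
    apply: ler_pM; rewrite ?expR_ge0// ?divr_ge0 ?(ltW cp_gt0) ?tr_sq_ge0 ?(proj1 pnx)//.
      by rewrite ler_pM2r ?invr_gt0.
    by rewrite ler_expR; apply: ler_wpM2l.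
  rewrite le_eqVlt; apply/orP; left; apply/eqP.
  have -> : up - V t = w + a * (del * t2 - Y t) by rewrite /up /V /w; ring.
  by rewrite mulrDr !expRD; ring.
apply: le_trans (esp_le pr_ge0 next_le) _.
rewrite espZ -[leRHS]mulr1; apply: ler_wpM2l; first exact: pot3_ge0 (proj1 pS).
have EV1 : m <= E V.
  rewrite /V espD espZ.
  have -> : E (fun t => (2 * Y3 t - Y t ^+ 2) / psi) =
      (2 * E Y3 - E (fun t => Y t ^+ 2)) / psi.
    rewrite mulrC -espZ -espB -espZ; apply: eq_esp => t; ring.
  apply: lerD; last by apply: ler_wpM2l => //; exact: esp_drop2_ge.
  rewrite ler_pM2r ?invr_gt0//.
  by have := esp_drop3_ge; have := esp_drop2_sq_le_t3; rewrite -/Y -/Y3; lra.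
have EV2 : E (fun t => V t ^+ 2) <= s.
  apply: (@le_trans _ _ (E (fun t => 8 / psi ^+ 2 * Y3 t ^+ 2 +
      2 * a ^+ 2 * Y t ^+ 2))); last first.
    rewrite espD !espZ; apply: lerD.
      have -> : 8 * (t3 * t2 * e1) / psi ^+ 2 = 8 / psi ^+ 2 * (t3 * t2 * e1) by ring.
      apply: ler_wpM2l; last exact: esp_drop3_sq_le.
      by rewrite divr_ge0 ?sqr_ge0.
    apply: ler_wpM2l; last exact: esp_drop2_sq_le_t2.
    by rewrite mulr_ge0 ?sqr_ge0.
  apply: (esp_le pr_ge0) => t; rewrite /V.
  set z := 2 * Y3 t - Y t ^+ 2.
  have z0 : 0 <= z by rewrite /z; have := YY3 t; have := hY3 t; lra.
  have z1 : z <= 2 * Y3 t by rewrite /z gerBl; exact: sqr_ge0.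
  have zz : z ^+ 2 / psi ^+ 2 <= 4 * Y3 t ^+ 2 / psi ^+ 2.
    rewrite ler_pM2r ?invr_gt0 ?exprn_gt0//.
    by have := lerXn2r 2 z0 _ z1; rewrite !nnegrE exprMn; nra.
  have -> : (z / psi + a * Y t) ^+ 2 = 2 * (z ^+ 2 / psi ^+ 2)
     + 2 * a ^+ 2 * Y t ^+ 2 - (z / psi - a * Y t) ^+ 2.
    by field; rewrite gt_eqF.
  have := sqr_ge0 (z / psi - a * Y t); lra.
apply: (@esp_exp_drift_le1 _ _ pr pr_ge0 pr_sum V _ up m s hV _ EV1 EV2) => //.
pose tau := t3 / psi.
have tau0 : 0 <= tau by rewrite divr_ge0 ?(ltW psi0).
have r20 : 0 <= t2 / psi by rewrite divr_ge0 ?(ltW psi0).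
have r2 : t2 / psi <= 2 by rewrite ler_pdivrMr//; exact: sq_shift2.
(* In units of [t3 / psi] and of [t2], both of which may be arbitrarily small
   or large, the margin beats the errors separately; this is [h4] and [h5]. *)
have -> : up - m + m3%:R * s =
   tau * (- 2 * nu + 2 * e + e1) + t2 * (t2 / psi)
   + m3%:R * 8 * tau * (t2 / psi) * e1
   - t2 * (a * (nu - e) - 2 * m3%:R * a ^+ 2 * (r * e1)).
  by rewrite /up /m /s /tau; field; rewrite gt_eqF.
have b1 : t2 * (t2 / psi) <= t2 * 2 by apply: ler_wpM2l.
have b2 : m3%:R * 8 * tau * (t2 / psi) * e1 <= m3%:R * 8 * tau * 2 * e1.
  apply: ler_wpM2r; first exact: e1_ge0.
  by apply: ler_wpM2l => //; rewrite mulr_ge0// mulr_ge0.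
have b3 : tau * (2 * e + e1 + 16 * m3%:R * e1 - 2 * nu) <= 0.
  by rewrite mulr_ge0_le0// subr_le0.
have b4 : 0 <= t2 * (a * (nu - e) - (2 + 2 * m3%:R * a ^+ 2 * (r * e1))).
  by rewrite mulr_ge0// subr_ge0.
lra.
Qed.

Lemma pot_step : E (fun t => pot (next t)) <= pot S.
Proof.
rewrite /pot !espD esp_sum; apply: lerD; last exact: pot3_step.
apply: lerD; first exact: pot1_step.
by apply: ler_sum => k _; exact: pot2_step.
Qed.

End OneStep.
End Step.

(** * Iterating the step over the rows *)

Section IteratedExpectation.
Variables (R : realType) (T : finType) (pr : T -> R).
Hypotheses (pr_ge0 : forall t, 0 <= pr t) (pr_sum : \sum_t pr t = 1).

Fixpoint espn (N : nat) (f : seq T -> R) : R :=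
  if N is N'.+1 then esp pr (fun t => espn N' (fun s => f (t :: s)))
  else f [::].

Lemma espn_le1 N (f : seq T -> R) : (forall s, f s <= 1) -> espn N f <= 1.
Proof.
elim: N f => [|N IH] f hf //=; rewrite -[leRHS](espC pr_sum).
by apply: esp_le => // t; apply: IH => s.
Qed.

(** Fubini for finitely many independent draws. *)
Lemma espn_tuple N (f : seq T -> R) :
  \sum_(s : N.-tuple T) (\prod_i pr (tnth s i)) * f s = espn N f.
Proof.
elim: N f => [|N IH] f /=.
  rewrite (big_pred1 [tuple]); last by move=> s; apply/esym/eqP; rewrite [s]tuple0.
  by rewrite big_ord0 mul1r.
pose g (p : T * N.-tuple T) : N.+1.-tuple T := cons_tuple p.1 p.2.
rewrite (reindex g); last first.
  exists (fun s : N.+1.-tuple T => (thead s, behead_tuple s)) => s _ /=.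
    by case: s => t s; rewrite /g /=; congr pair; apply: val_inj.
  by rewrite /g /= [RHS]tuple_eta.
rewrite -(pair_bigA _ (fun t s => (\prod_i pr (tnth (g (t, s)) i)) * f (g (t, s))))/=.
apply: eq_bigr => t _; rewrite -IH mulr_sumr; apply: eq_bigr => s _.
rewrite big_ord_recl mulrA; congr (_ * _ * _); apply: eq_bigr => i _.
by rewrite /g /= tnthS.
Qed.
End IteratedExpectation.

Section Walk.
Variables (R : realType) (n : nat) (T : finType) (pr : T -> R).
Variables (x : T -> 'rV[R]_n) (om k2 : R).
Hypotheses (pr_ge0 : forall t, 0 <= pr t) (pr_sum : \sum_t pr t = 1).
Variables (del nu phim ck cp lam1 lam2 a : R) (m3 : nat).
Hypotheses (M1 : moment1 pr x om) (M2 : moment2 pr x k2).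
Hypotheses (n_gt0 : (0 < n)%N) (om_le1 : om <= 1).
Hypotheses (k2_ge0 : 0 <= k2) (del_ge0 : 0 <= del).
Hypotheses (phim_ge0 : 0 <= phim) (ck_gt0 : 0 < ck) (cp_gt0 : 0 < cp).
Hypotheses (lam1_ge0 : 0 <= lam1) (lam2_ge0 : 0 <= lam2) (a_ge0 : 0 <= a).
Local Notation e1 := (err1 k2 ck cp).
Local Notation e := (err om k2 del ck cp).
Local Notation r := (Num.sqrt (2 * cp)).
Hypothesis slope : (del + nu) * (1 + phim) = 1.
Hypothesis h1 : 16 * del ^+ 2 * cp <= 1.
Hypothesis h2 : e + lam1 * (r * e1) <= nu.
Hypothesis h3 : e + lam2 * (2 * ck * e1) <= nu.
Hypothesis h4 : 2 * e + e1 + 16 * m3%:R * e1 <= 2 * nu.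
Hypothesis h5 : 2 + 2 * m3%:R * a ^+ 2 * (r * e1) <= a * (nu - e).
Local Notation pot := (pot phim ck cp lam1 lam2 a m3).

Definition gram (s : seq T) : 'M[R]_n := \sum_(t <- s) (x t)^T *m x t.

Lemma pot_ge0 (S : 'M[R]_n) : S^T = S -> 0 <= pot S.
Proof.
move=> sS; rewrite /pot addr_ge0 ?pot3_ge0// addr_ge0 ?expR_ge0//.
by apply: sumr_ge0 => k _; exact: expR_ge0.
Qed.

(** Induction on the number of rows left: if the potential is at least [1] there
is nothing to prove; otherwise the shift is allowed and the mean of the next
potential is at most the present one. *)
Lemma barrier_walk N (M : 'M[R]_n) : pd M ->
  espn pr N (fun s => (~~ `[< pd (M - (N%:R * del)%:M + gram s) >])%:R)
  <= pot (invmx M).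
Proof.
elim: N M => [|N IH] M pM.
  rewrite /= /gram big_nil mul0r addr0 -scalemx1 scale0r subr0.
  by rewrite (asboolT pM) pot_ge0// (proj1 (pd_inv pM)).
have [potM|potM] := ltP (pot (invmx M)) 1; last first.
  by apply: le_trans potM; apply: espn_le1 => // s; case: (~~ _).
rewrite [leLHS]/=.
apply: le_trans (pot_step pr_ge0 pr_sum M1 M2 n_gt0 om_le1 k2_ge0 del_ge0
  phim_ge0 ck_gt0 cp_gt0 lam1_ge0 lam2_ge0 a_ge0 slope h1 h2 h3 h4 h5
  pM potM).
apply: esp_le => // t.
have pM' : pd (M - del%:M) by apply: pot_lt1_pd_shift h1 _ pM potM => //.
apply: (le_trans _ (IH _ (pdD pM' (psd_outer (x t))))).
rewrite le_eqVlt; apply/orP; left; apply/eqP; congr espn; apply/funext => s.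
congr (nat_of_bool (~~ `[< pd _ >]))%:R.
rewrite /gram big_cons.
have -> : (N.+1%:R * del)%:M = (N%:R * del)%:M + del%:M :> 'M[R]_n.
  by rewrite -natr1 mulrDl mul1r raddfD.
rewrite opprD !addrA; congr (_ + _); rewrite [RHS]addrAC; congr (_ + _).
by rewrite addrAC.
Qed.
End Walk.

(** * Moments of quadratic forms in independent entries *)
Section IidRows.
Variables (R : realType) (n : nat) (S : finType) (w : S -> R) (z : S -> R).
Variable k2 : R.
Hypotheses (w_sum : \sum_s w s = 1).
Hypotheses (z1 : \sum_s w s * z s = 0) (z2 : \sum_s w s * z s ^+ 2 = 1).
Hypotheses (z4 : \sum_s w s * z s ^+ 4 <= k2).
Notation T := {ffun 'I_n -> S}.

Definition iid (f : T) : R := \prod_k w (f k).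
Definition zrow (f : T) : 'rV[R]_n := \row_k z (f k).
Let mu r := \sum_s w s * z s ^+ r.
Local Notation E := (esp iid).

Lemma iid_sum : \sum_f iid f = 1.
Proof. by rewrite -(bigA_distr_bigA (fun=> w)) big1. Qed.

Lemma iid_esp_monomial (c : 'I_n -> nat) :
  E (fun f => \prod_k z (f k) ^+ c k) = \prod_k mu (c k).
Proof.
rewrite [RHS](bigA_distr_bigA (fun k s => w s * z s ^+ c k)).
by apply: eq_bigr => f _; rewrite -big_split.
Qed.

Lemma entry_monomial (f : T) i : z (f i) = \prod_k z (f k) ^+ (k == i).
Proof.
rewrite (bigD1 i)//= eqxx expr1 big1 ?mulr1// => k /negPf ->.
by rewrite expr0.
Qed.

Let mu0 : mu 0 = 1.
Proof. by rewrite -[RHS]w_sum; apply: eq_bigr => s _; rewrite expr0 mulr1. Qed.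
Let mu1 : mu 1 = 0. Proof. exact: z1. Qed.
Let mu2 : mu 2 = 1. Proof. exact: z2. Qed.

Lemma iid_esp2 i j : E (fun f => z (f i) * z (f j)) = (i == j)%:R.
Proof.
have -> : E (fun f => z (f i) * z (f j)) =
    E (fun f => \prod_k z (f k) ^+ ((k == i) + (k == j))).
  apply: eq_esp => f; rewrite (entry_monomial f i) (entry_monomial f j) -big_split.
  by apply: eq_bigr => k _; rewrite exprD.
rewrite iid_esp_monomial (bigD1 i)//= eqxx; have [<-|ij] := eqVneq i j.
  by rewrite mu2 mul1r big1// => k /negPf ->.
by rewrite mu1 mul0r.
Qed.

(** Only the pairings of equal indices survive, since the entries are centred;
the last term corrects the case of four equal indices.  The proof is the
corresponding case distinction on the equalities between the indices. *)
Lemma iid_esp4 i j k l : E (fun f => z (f i) * z (f j) * z (f k) * z (f l)) =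
  (i == j)%:R * (k == l)%:R + (i == k)%:R * (j == l)%:R
  + (i == l)%:R * (j == k)%:R
  + (mu 4 - 3) * ((i == j)%:R * (i == k)%:R * (i == l)%:R).
Proof.
have -> : E (fun f => z (f i) * z (f j) * z (f k) * z (f l)) =
    E (fun f => \prod_m z (f m) ^+ ((m == i) + (m == j) + (m == k) + (m == l))).
  apply: eq_esp => f; rewrite (entry_monomial f i) (entry_monomial f j).
  rewrite (entry_monomial f k) (entry_monomial f l) -!big_split.
  by apply: eq_bigr => m _; rewrite !exprD.
rewrite iid_esp_monomial.
have zero m : ((m == i) + (m == j) + (m == k) + (m == l) = 1)%N ->
    \prod_m mu ((m == i) + (m == j) + (m == k) + (m == l)) = 0.
  by move=> h; rewrite (bigD1 m)//= h mu1 mul0r.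
have pair p q : p != q -> \prod_m mu (2 * (m == p) + 2 * (m == q)) = 1.
  move=> pq; apply: big1 => m _; have [->|_] := eqVneq m p.
    by rewrite (negPf pq) mu2.
  by case: eqVneq => _; rewrite ?mu2 ?mu0.
have [ij|ij] := eqVneq i j.
  subst j; have [ik|ik] := eqVneq i k.
    subst k; have [il|il] := eqVneq i l.
      subst l; rewrite (bigD1 i)//= eqxx big1; last by move=> m /negPf ->.
      have -> : mu (true + true + true + true) = mu 4 by [].
      rewrite /= ?mulr1n; ring.
    rewrite (zero l); first (rewrite /= ?mulr1n ?mulr0n; ring).
    by rewrite eqxx (eq_sym l i) (negPf il).
  have [kl|kl] := eqVneq k l.
    subst l; rewrite (eq_bigr (fun m => mu (2 * (m == i) + 2 * (m == k)))).
      by rewrite pair//; (rewrite /= ?mulr1n ?mulr0n; ring).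
    by move=> m _; congr mu; case: (m == i); case: (m == k).
  have [il|il] := eqVneq i l.
    subst l; rewrite (zero k); first (rewrite /= ?mulr1n ?mulr0n; ring).
    by rewrite eqxx (eq_sym k i) (negPf ik).
  rewrite (zero k); first (rewrite /= ?mulr1n ?mulr0n; ring).
  by rewrite eqxx (eq_sym k i) (negPf ik) (negPf kl).
have [ik|ik] := eqVneq i k.
  subst k; have [jl|jl] := eqVneq j l.
    subst l; rewrite (eq_bigr (fun m => mu (2 * (m == i) + 2 * (m == j)))).
      by rewrite pair// (negPf ij) (eq_sym j i) (negPf ij); (rewrite /= ?mulr1n ?mulr0n; ring).
    by move=> m _; congr mu; case: (m == i); case: (m == j).
  have [il|il] := eqVneq i l.
    subst l; rewrite (zero j); first by rewrite (eq_sym j i) (negPf ij); (rewrite /= ?mulr1n ?mulr0n; ring).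
    by rewrite eqxx (eq_sym j i) (negPf ij).
  rewrite (zero j); first by rewrite (eq_sym j i) (negPf ij); (rewrite /= ?mulr1n ?mulr0n; ring).
  by rewrite eqxx (eq_sym j i) (negPf ij) (negPf jl).
have [il|il] := eqVneq i l.
  subst l; have [jk|jk] := eqVneq j k.
    subst k; rewrite (eq_bigr (fun m => mu (2 * (m == i) + 2 * (m == j)))).
      by rewrite pair// (eq_sym j i) (negPf ij); (rewrite /= ?mulr1n ?mulr0n; ring).
    by move=> m _; congr mu; case: (m == i); case: (m == j).
  rewrite (zero j); first by rewrite (eq_sym j i) (negPf ij) (eq_sym k i) (negPf ik); (rewrite /= ?mulr1n ?mulr0n; ring).
  by rewrite eqxx (eq_sym j i) (negPf ij) (negPf jk).
rewrite (zero i); first (rewrite /= ?mulr1n ?mulr0n; ring).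
by rewrite eqxx (negPf ij) (negPf ik) (negPf il).
Qed.

Lemma qf_entries (F : 'M[R]_n) (u : 'rV[R]_n) :
  qf F u = \sum_i \sum_j F i j * (u 0 i * u 0 j).
Proof.
rewrite /qf dotE exchange_big; apply: eq_bigr => j _ /=.
rewrite mxE mulr_suml; apply: eq_bigr => i _; ring.
Qed.

Lemma iid_moment1 (F : 'M[R]_n) : E (fun f => qf F (zrow f)) = \tr F.
Proof.
under eq_esp do rewrite qf_entries.
rewrite esp_sum; apply: eq_bigr => i _; rewrite esp_sum (bigD1 i)//= big1 ?addr0.
  rewrite espZ; under eq_esp do rewrite !mxE.
  by rewrite iid_esp2 eqxx mulr1.
move=> j ji; rewrite espZ; under eq_esp do rewrite !mxE.
by rewrite iid_esp2 eq_sym (negPf ji) mulr0.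
Qed.

Lemma sum_delta (I : finType) (i : I) (G : I -> R) :
  \sum_j (i == j)%:R * G j = G i.
Proof.
rewrite (bigD1 i)//= eqxx mul1r big1 ?addr0// => j ji.
by rewrite eq_sym (negPf ji) mul0r.
Qed.

Lemma iid_moment2 (F K : 'M[R]_n) : F^T = F -> K^T = K ->
  (forall k, 0 <= F k k) -> (forall k, 0 <= K k k) ->
  E (fun f => qf F (zrow f) * qf K (zrow f)) <=
    \tr F * \tr K + 2 * \tr (F *m K) + k2 * \sum_k F k k * K k k.
Proof.
move=> sF sK dF dK.
have -> : E (fun f => qf F (zrow f) * qf K (zrow f)) =
  \sum_i \sum_j \sum_k \sum_l F i j * K k l *
    ((i == j)%:R * (k == l)%:R + (i == k)%:R * (j == l)%:R
    + (i == l)%:R * (j == k)%:R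
    + (mu 4 - 3) * ((i == j)%:R * (i == k)%:R * (i == l)%:R)).
  under eq_esp do rewrite !qf_entries mulr_suml.
  rewrite esp_sum; apply: eq_bigr => i _.
  under eq_esp do rewrite mulr_suml.
  rewrite esp_sum; apply: eq_bigr => j _.
  under eq_esp do rewrite mulr_sumr.
  rewrite esp_sum; apply: eq_bigr => k _.
  under eq_esp do rewrite mulr_sumr.
  rewrite esp_sum; apply: eq_bigr => l _.
  rewrite -iid_esp4 -espZ; apply: eq_esp => f; rewrite !mxE; ring.
(* Each product of Kronecker symbols is rewritten as a sum over four indices,
   so that the identity can be checked term by term. *)
have -> : \sum_i \sum_j \sum_k \sum_l F i j * K k l *
    ((i == j)%:R * (k == l)%:R + (i == k)%:R * (j == l)%:R
    + (i == l)%:R * (j == k)%:R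
    + (mu 4 - 3) * ((i == j)%:R * (i == k)%:R * (i == l)%:R)) =
  \tr F * \tr K + \sum_i \sum_j F i j * K i j + \sum_i \sum_j F i j * K j i
   + (mu 4 - 3) * \sum_k F k k * K k k.
  have -> : \tr F * \tr K = \sum_i \sum_j (i == j)%:R * (\sum_k \sum_l (k == l)%:R * (F i j * K k l)).
    rewrite /mxtrace mulr_suml; apply: eq_bigr => i _; rewrite sum_delta mulr_sumr.
    by apply: eq_bigr => k _; rewrite sum_delta.
  have -> : \sum_i \sum_j F i j * K i j = \sum_i \sum_j \sum_k (i == k)%:R * (\sum_l (j == l)%:R * (F i j * K k l)).
    by do 2!apply: eq_bigr => ? _; rewrite !sum_delta.
  have -> : \sum_i \sum_j F i j * K j i = \sum_i \sum_j \sum_k (j == k)%:R * (\sum_l (i == l)%:R * (F i j * K k l)).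
    by do 2!apply: eq_bigr => ? _; rewrite !sum_delta.
  have -> : \sum_k F k k * K k k = \sum_i \sum_j (i == j)%:R * (\sum_k (i == k)%:R * (\sum_l (i == l)%:R * (F i j * K k l))).
    by apply: eq_bigr => ? _; rewrite !sum_delta.
  rewrite mulr_sumr -!big_split; apply: eq_bigr => i _ /=.
  rewrite mulr_sumr -!big_split; apply: eq_bigr => j _ /=.
  rewrite !mulr_sumr -!big_split; apply: eq_bigr => k _ /=.
  rewrite !mulr_sumr -!big_split; apply: eq_bigr => l _ /=.
  ring.
have -> : \sum_i \sum_j F i j * K i j = \tr (F *m K).
  apply: eq_bigr => i _; rewrite mxE; apply: eq_bigr => j _.
  by rewrite -[K in LHS]sK mxE.
have -> : \sum_i \sum_j F i j * K j i = \tr (F *m K).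
  by apply: eq_bigr => i _; rewrite mxE.
have : (mu 4 - 3) * \sum_k F k k * K k k <= k2 * \sum_k F k k * K k k.
  apply: ler_wpM2r; first by apply: sumr_ge0 => k _; rewrite mulr_ge0.
  by have : mu 4 <= k2 := z4; lra.
lra.
Qed.
End IidRows.

(** * Rows discarded when an entry is large *)

(** A row with a large entry is replaced by zero.  Given that all entries are
small they are still independent, with the law [w'], and the hypotheses say that
under this law they are centred with unit variance. *)
Section TruncatedRows.
Variables (R : realType) (n : nat) (S : finType) (w z : S -> R) (small : pred S).
Variable k2 : R.
Let om0 := \sum_(s | small s) w s.
Hypothesis om0_gt0 : 0 < om0.
Hypotheses (z1 : \sum_(s | small s) w s * z s = 0)
  (z2 : \sum_(s | small s) w s * z s ^+ 2 = om0)
  (z4 : \sum_(s | small s) w s * z s ^+ 4 <= k2 * om0).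

Definition good_row (f : {ffun 'I_n -> S}) : 'rV[R]_n :=
  if [forall k, small (f k)] then zrow z f else 0.

Let w' s := if small s then w s / om0 else 0.

Lemma sum_conditioned (g : S -> R) :
  \sum_s w' s * g s = (\sum_(s | small s) w s * g s) / om0.
Proof.
rewrite mulr_suml [RHS]big_mkcond; apply: eq_bigr => s _; rewrite /w'.
by case: (small s); rewrite ?mul0r// mulrAC.
Qed.

(** A function vanishing at zero sees only the good rows, which have probability
[om0 ^+ n]. *)
Lemma esp_good_row (g : 'rV[R]_n -> R) : g 0 = 0 ->
  esp (iid w) (fun f => g (good_row f)) =
  om0 ^+ n * esp (iid w') (fun f => g (zrow z f)).
Proof.
move=> g0; rewrite mulr_sumr; apply: eq_bigr => f _.
rewrite /good_row; case: ifPn => [/forallP h|].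
  rewrite mulrA; congr (_ * _); rewrite /iid.
  rewrite -[n in om0 ^+ n]card_ord -prodr_const -big_split.
  apply: eq_bigr => k _; rewrite /w' h /= mulrC divfK// gt_eqF//.
rewrite negb_forall => /existsP[k hk]; rewrite g0 mulr0 /iid (bigD1 k)//=.
by rewrite {1}/w' (negPf hk) !mul0r mulr0.
Qed.

Let w'1 : \sum_s w' s = 1.
Proof.
have := sum_conditioned (fun=> 1); under eq_bigr do rewrite mulr1.
by move=> ->; under eq_bigr do rewrite mulr1; rewrite divff ?gt_eqF.
Qed.
Let w'z1 : \sum_s w' s * z s = 0. Proof. by rewrite sum_conditioned z1 mul0r. Qed.
Let w'z2 : \sum_s w' s * z s ^+ 2 = 1.
Proof. by rewrite sum_conditioned z2 divff ?gt_eqF. Qed.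
Let w'z4 : \sum_s w' s * z s ^+ 4 <= k2.
Proof. by rewrite sum_conditioned ler_pdivrMr. Qed.

Lemma good_row_moment1 : moment1 (iid w) good_row (om0 ^+ n).
Proof.
move=> F _; rewrite (esp_good_row (g := fun u => qf F u)) ?qf0//.
by rewrite (iid_moment1 w'1).
Qed.

Lemma good_row_moment2 : om0 <= 1 -> (forall s, 0 <= w s) ->
  moment2 (iid w) good_row k2.
Proof.
move=> o1 w0 F K [sF pF] [sK pK].
rewrite (esp_good_row (g := fun u => qf F u * qf K u)) ?qf0 ?mul0r//.
have dF k : 0 <= F k k by rewrite diag_qf.
have dK k : 0 <= K k k by rewrite diag_qf.
apply: le_trans (iid_moment2 w'1 w'z1 w'z2 w'z4 sF sK dF dK).
apply: ler_piMl; last by rewrite exprn_ile1 ?(ltW om0_gt0).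
apply: sumr_ge0 => f _; rewrite mulr_ge0 ?mulr_ge0// prodr_ge0// => k _.
by rewrite /w'; case: ifP => // _; rewrite divr_ge0 ?(ltW om0_gt0).
Qed.
End TruncatedRows.

(** * The constants of the barrier *)
Section ScalarMatrix.
Variables (R : realType) (n : nat) (c : R).
Hypothesis c_gt0 : 0 < c.

Lemma pd_scalar : pd (c%:M : 'M[R]_n).
Proof.
split=> [|u u0]; first by rewrite tr_scalar_mx.
by rewrite qf_scalar mulr_gt0// dot_gt0.
Qed.

Lemma invmx_scalar_pos : invmx (c%:M : 'M[R]_n) = c^-1%:M.
Proof. by rewrite invmx_scalar. Qed.
End ScalarMatrix.

Section Core.
Variable R : realType.

(** With [m] free, the estimate can be used at precision [expR (- m%:R)] for every
[m] that is small compared with [Num.sqrt N%:R] and with [N%:R / k2]. *)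
Definition barrier_bound (y nu K : R) : Prop :=
  forall (N n m : nat) (T : finType) (pr : T -> R) (x : T -> 'rV[R]_n)
    (om k2 : R),
  (0 < n)%N -> n%:R <= y * N%:R -> (0 < m)%N ->
  (forall t, 0 <= pr t) -> \sum_t pr t = 1 ->
  om <= 1 -> 0 <= k2 -> moment1 pr x om -> moment2 pr x k2 ->
  K * m%:R <= Num.sqrt N%:R -> K * (m%:R * k2) <= N%:R -> K * (1 - om) <= 1 ->
  \sum_(s : N.-tuple T) (\prod_i pr (tnth s i)) *
    (~~ `[< pd (gram x s - (nu * N%:R)%:M) >])%:R <= (n%:R + 2) * expR (- m%:R).

(** The initial level [- M N] gives a resolvent [1 / (M N)], whose trace is at most
[y / M].  Taking [phim = y / M + 1] leaves a gap of [1] in the exponent of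
[pot1], and likewise [C] and [C'] leave a factor [expR (-1)] in the two other
parts, so that each part is initially at most [expR (- m)].  The slope
condition then forces [(M + 2 nu) (y / M + 2) = 1], whose solution is
positive because [M = (1 - y) / 4] is small enough. *)
Lemma barrier_constants (y : R) : 0 < y -> y < 1 ->
  exists nu K : R, [/\ 0 < nu, 0 < K & barrier_bound y nu K].
Proof.
move=> y0 y1.
pose M := (1 - y) / 4.
have M0 : 0 < M by rewrite divr_gt0// subr_gt0.
pose phim := y / M + 1.
pose nu := M * (1 - y) / (2 * (1 + y)).
have y1' : 0 < 1 + y by rewrite addr_gt0.
have nu0 : 0 < nu by rewrite /nu !(divr_gt0, mulr_gt0) ?subr_gt0.
pose del := M + nu.
pose C := M^-1 + 1.
pose a := 8 / nu.
pose C' := expR 1 * (y / M ^+ 2) * expR (a * (y / M)).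
have del0 : 0 < del by rewrite addr_gt0.
have C0 : 0 < C by rewrite addr_gt0 ?invr_gt0.
have a0 : 0 < a by rewrite divr_gt0.
have C'0 : 0 < C'.
  by rewrite /C' mulr_gt0 ?expR_gt0// mulr_gt0 ?expR_gt0// divr_gt0// exprn_gt0.
pose D0 := 3 * Num.sqrt (2 * C') + 2 * C.
have D00 : 0 < D0.
  by rewrite /D0 ltr_wpDl ?mulr_gt0// mulr_ge0// sqrtr_ge0.
(* One summand for each condition of the step. *)
pose K := 1 + 16 * del ^+ 2 * C' + 32 * D0 / nu + D0 + 8 * C * D0 / nu
  + 8 * (2 * del * C' + 2) / nu.
have yM0 : 0 < y / M by rewrite divr_gt0.
have phim0 : 0 < phim by rewrite addr_gt0.
have slope : (del + nu) * (1 + phim) = 1.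
  by rewrite /del /phim /nu /M; field; rewrite !gt_eqF ?subr_gt0.
have T1 : 0 <= 16 * del ^+ 2 * C'.
  by rewrite mulr_ge0 ?(ltW C'0)// mulr_ge0// sqr_ge0.
have T2 : 0 <= 32 * D0 / nu.
  by rewrite divr_ge0 ?(ltW nu0)// mulr_ge0 ?(ltW D00).
have T4 : 0 <= 8 * C * D0 / nu.
  by rewrite divr_ge0 ?(ltW nu0)// mulr_ge0 ?(ltW D00)// mulr_ge0 ?(ltW C0).
have T5 : 0 <= 8 * (2 * del * C' + 2) / nu.
  rewrite divr_ge0 ?(ltW nu0)// mulr_ge0// addr_ge0// mulr_ge0 ?(ltW C'0)//.
  by rewrite mulr_ge0 ?(ltW del0).
have T3 := ltW D00.
have Kparts : [/\ 1 <= K, 16 * del ^+ 2 * C' <= K, D0 * (32 / nu) <= K, D0 <= K &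
    (D0 * (8 * C / nu) <= K) && (8 * (2 * del * C' + 2) / nu <= K)].
  have -> : D0 * (32 / nu) = 32 * D0 / nu by ring.
  have -> : D0 * (8 * C / nu) = 8 * C * D0 / nu by ring.
  rewrite /K; move: T1 T2 T3 T4 T5.
  set t1 := 16 * _ * _; set t2 := 32 * _ / _; set t4 := 8 * C * _ / _.
  set t5 := 8 * _ / _ => *; split; [lra|lra|lra|lra|].
  by apply/andP; split; lra.
case: Kparts => K1 P1 P2 P3 /andP[P4 P5].
exists nu, K; split => //; first by apply: lt_le_trans K1.
move=> N n m T pr x om k2 n_gt0 nN m_gt0 pr_ge0 pr_sum om_le1 k2_ge0 M1 M2 hN hk hom.
have mR1 : 1 <= m%:R :> R by rewrite ler1n.
have K0 : 0 < K by apply: lt_le_trans K1.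
have sN : K <= Num.sqrt N%:R.
  by apply: le_trans hN; rewrite ler_peMr// ltW.
have N0 : 0 < N%:R :> R by rewrite -sqrtr_gt0; exact: lt_le_trans sN.
have K2N : K ^+ 2 <= N%:R.
  rewrite -[leRHS]sqr_sqrtr ?(ltW N0)//; apply: lerXn2r sN; rewrite nnegrE ?sqrtr_ge0//.
  exact: ltW.
have KN : K <= N%:R.
  by apply: le_trans K2N; rewrite expr2 ler_peMr// ltW.
pose cp := C' / N%:R; pose ck := C / N%:R.
have cp0 : 0 < cp by rewrite divr_gt0.
have ck0 : 0 < ck by rewrite divr_gt0.
pose r := Num.sqrt (2 * cp).
have r_eq : r = Num.sqrt (2 * C') / Num.sqrt N%:R.
  have c20 : 0 <= 2 * C' by rewrite mulr_ge0// ltW.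
  by rewrite /r /cp mulrA (sqrtrM _ c20) sqrtrV// ltW.
pose e1 := err1 k2 ck cp.
pose e0 := D0 / K.
have sN0 : 0 < Num.sqrt N%:R :> R by rewrite sqrtr_gt0.
have me1 : m%:R * e1 <= e0.
  have -> : m%:R * e1 = 3 * Num.sqrt (2 * C') * (m%:R / Num.sqrt N%:R)
      + 2 * C * (m%:R * k2 / N%:R).
    by rewrite /e1 /err1 -/r r_eq /ck; field; rewrite !gt_eqF.
  have -> : e0 = 3 * Num.sqrt (2 * C') * K^-1 + 2 * C * K^-1.
    by rewrite /e0 /D0 mulrDl.
  apply: lerD; apply: ler_wpM2l; rewrite ?mulr_ge0 ?sqrtr_ge0 ?(ltW C0)//.
    by rewrite ler_pdivrMr// ler_pdivlMl.
  by rewrite ler_pdivrMr// ler_pdivlMl.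
have e10 : 0 <= e1.
  by rewrite /e1 /err1 addr_ge0// mulr_ge0 ?sqrtr_ge0// mulr_ge0 ?(ltW ck0).
have e1e0 : e1 <= e0 by apply: le_trans me1; exact: ler_peMl.
have e0K (c : R) : D0 * c <= K -> e0 * c <= 1.
  by move=> h; rewrite /e0 mulrAC ler_pdivrMr// mul1r.
have r0 : 0 <= r by exact: sqrtr_ge0.
have re0 : r <= e0.
  apply: le_trans e1e0; rewrite /e1 /err1 -/r.
  have : 0 <= 2 * ck * k2 by rewrite mulr_ge0// mulr_ge0// ltW.
  by move: r0; clear; lra.
have b2 : e0 <= nu / 32.
  by have := e0K _ P2; rewrite mulrA ler_pdivrMr//; clear; lra.
have b3 : e0 <= 1 by rewrite ler_pdivrMr// mul1r.
have b4 : 8 * C * e0 <= nu.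
  by have := e0K _ P4; rewrite mulrA ler_pdivrMr//; clear; lra.
have cpK : cp <= C' / K.
  by rewrite ler_pM2l// lef_pV2 ?posrE.
have b1 : 16 * del ^+ 2 * cp <= 1.
  apply: (@le_trans _ _ (16 * del ^+ 2 * (C' / K))).
    by apply: ler_wpM2l cpK; rewrite mulr_ge0 ?sqr_ge0.
  by rewrite mulrA ler_pdivrMr// mul1r.
pose e := err om k2 del ck cp.
have ee : e <= nu / 4.
  rewrite /e /err -/e1.
  have c1 : 2 * del * cp <= 2 * del * (C' / K).
    by apply: ler_wpM2l cpK; rewrite mulr_ge0 ?(ltW del0).
  have c2 : 1 - om <= K^-1 by rewrite -[leRHS]mul1r ler_pdivlMr// mulrC.
  have c3 : (2 * del * C' + 2) / K <= nu / 8.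
    rewrite ler_pdivrMr//; move: P5; rewrite ler_pdivrMr//; clear; lra.
  have c4 : (2 * del * C' + 2) / K = 2 * del * (C' / K) + 2 * K^-1.
    by rewrite mulrDl !mulrA.
  move: nu0 e1e0 b2 c1 c2 c3 c4; clear; lra.
have mre : m%:R * (r * e1) <= e0.
  rewrite mulrCA; apply: le_trans (ler_wpM2l r0 me1) _.
  by apply: ler_piMl; rewrite ?(le_trans re0)// divr_ge0 ?(ltW D00) ?(ltW K0).
pose c0 := M * N%:R.
have c00 : 0 < c0 by rewrite mulr_gt0.
have gramE (s : N.-tuple T) : gram x s - (nu * N%:R)%:M =
    c0%:M - (N%:R * del)%:M + gram x s.
  rewrite addrC; congr (_ + _); rewrite -raddfN -raddfB; congr _%:M.
  by rewrite /c0 /del; ring.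
under eq_bigr do rewrite gramE.
rewrite (espn_tuple pr N (fun s => (~~ `[< pd (c0%:M - (N%:R * del)%:M + gram x s) >])%:R)).
have h5 : 2 + 2 * m%:R * a ^+ 2 * (r * e1) <= a * (nu - e).
  have -> : 2 * m%:R * a ^+ 2 * (r * e1) = 2 * a * (a * (m%:R * (r * e1))).
    by ring.
  have ae0 : a * e0 <= 1 / 4.
    by rewrite /a mulrAC ler_pdivrMr//; move: b2; clear; lra.
  have e00 : 0 <= e0 by exact: le_trans e1e0.
  have mre2 : 2 * a * (a * (m%:R * (r * e1))) <= 2 * ((a * e0) * (a * e0)).
    have -> : 2 * ((a * e0) * (a * e0)) = 2 * a * (a * (e0 * e0)) by ring.
    apply: ler_wpM2l; first by rewrite mulr_ge0// ltW.
    apply: ler_wpM2l; first by rewrite ltW.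
    by rewrite mulrCA; apply: ler_pM => //; rewrite mulr_ge0.
  have ae2 : (a * e0) * (a * e0) <= 1 / 4 * (1 / 4).
    by apply: ler_pM => //; rewrite mulr_ge0// ltW.
  have ae : a * e <= 2.
    by rewrite /a mulrAC ler_pdivrMr//; move: ee; clear; lra.
  have -> : a * (nu - e) = 8 - a * e by rewrite mulrBr {1}/a divfK ?gt_eqF.
  move: mre2 ae2 ae; clear; lra.
have lam1_ge0 : (0 : R) <= m%:R by [].
have lam2_ge0 : (0 : R) <= N%:R * m%:R by rewrite mulr_ge0.
have h2 : e + m%:R * (r * e1) <= nu by move: ee mre b2 nu0; clear; lra.
have h3 : e + N%:R * m%:R * (2 * ck * e1) <= nu.
  have -> : N%:R * m%:R * (2 * ck * e1) = 2 * C * (m%:R * e1).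
    by rewrite /ck; field; rewrite gt_eqF.
  have := ler_wpM2l (ltW C0) me1; move: ee b4 nu0; clear; lra.
have h4 : 2 * e + e1 + 16 * m%:R * e1 <= 2 * nu.
  by move: ee e1e0 b2 me1 nu0; clear; lra.
apply: le_trans (barrier_walk pr_ge0 pr_sum M1 M2 n_gt0 om_le1 k2_ge0 (ltW del0)
  (ltW phim0) ck0 cp0 lam1_ge0 lam2_ge0 (ltW a0) slope b1 h2 h3 h4 h5 N
  (pd_scalar n c00)) _.
rewrite invmx_scalar_pos// /pot /pot1 /pot2 /pot3.
rewrite -scalar_mxM mxtrace_scalar mxtrace_scalar.
have nc0 : c0^-1 *+ n <= y / M.
  rewrite -mulr_natl ler_pdivrMr// /c0 mulrA divfK ?gt_eqF//.
have p1 : expR (m%:R * (c0^-1 *+ n - phim)) <= expR (- m%:R).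
  rewrite ler_expR -[leRHS]mulrN1; apply: ler_wpM2l => //.
  by rewrite /phim; move: nc0; clear; lra.
have p2 : \sum_(k < n) expR (N%:R * m%:R * ((c0^-1%:M : 'M[R]_n) k k - ck)) =
    n%:R * expR (- m%:R).
  rewrite (eq_bigr (fun=> expR (- m%:R))) ?sumr_const ?card_ord ?mulr_natl//.
  move=> k _; rewrite mxE eqxx mulr1n; congr expR; rewrite /ck /C /c0; field.
  by rewrite !gt_eqF.
have p3 : (((c0^-1 * c0^-1) *+ n) / cp * expR (a * (c0^-1 *+ n))) ^+ m
    <= expR (- m%:R).
  have -> : - m%:R = m%:R * (- 1) :> R by rewrite mulrN1.
  rewrite expRM_natl; apply: lerXn2r; rewrite ?nnegrE ?expR_ge0//.
    by rewrite mulr_ge0 ?expR_ge0// divr_ge0 ?(ltW cp0)// mulrn_wge0// mulr_ge0 ?invr_ge0 ?(ltW c00).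
  have -> : expR (- 1) = y / M ^+ 2 / C' * expR (a * (y / M)).
    rewrite expRN /C'; field; rewrite !gt_eqF ?expR_gt0//.
  apply: ler_pM; rewrite ?expR_ge0//.
  - by rewrite divr_ge0 ?(ltW cp0)// mulrn_wge0// mulr_ge0 ?invr_ge0 ?(ltW c00).
  - have -> : (c0^-1 * c0^-1) *+ n / cp = n%:R / N%:R / M ^+ 2 / C'.
      by rewrite -mulr_natl /cp /c0; field; rewrite !gt_eqF.
    rewrite ler_pM2r ?invr_gt0// ler_pM2r ?invr_gt0 ?exprn_gt0//.
    by rewrite ler_pdivrMr.
  - by rewrite ler_expR; apply: ler_wpM2l => //; exact: ltW.
rewrite p2; move: p1 p3; clear; lra.
Qed.
End Core.

(** * The smallest singular value and positive definiteness *)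

Section SmallestSingularValue.
Variables (R : realType) (N n : nat) (A : 'M[R]_(N, n)).
Hypothesis n_gt0 : (0 < n)%N.
Let G := A^T *m A.

Let sG : G^T = G. Proof. by rewrite trmx_mul trmxK. Qed.

Lemma qf_gram u : qf G u = \sum_j dot u (row j A) ^+ 2.
Proof.
have -> : qf G u = dot (u *m A^T) (u *m A^T).
  by rewrite /qf /dot /G trmx_mul trmxK !mulmxA.
rewrite dotE; apply: eq_bigr => j _.
have -> : (u *m A^T) 0 j = dot u (row j A).
  by rewrite mxE dotE; apply: eq_bigr => i _; rewrite !mxE.
by rewrite expr2.
Qed.

Lemma smin_ge0 : 0 <= smin A.
Proof.
have [_ /allP s0 _] := singular_valuesP A.
by apply/s0/mem_nth; rewrite size_singular_values prednK.
Qed.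

Lemma smin_le_sv x : x \in singular_values A -> smin A <= x.
Proof.
have [sort_s _ _] := singular_valuesP A.
move=> /(nthP 0)[i]; rewrite size_singular_values => i_n <-.
rewrite /smin.
apply: (sorted_leq_nth ge_trans (fun x => lexx x) 0 sort_s); rewrite ?inE ?size_singular_values ?prednK//.
by rewrite -ltnS prednK.
Qed.

Lemma smin_eigen : root (char_poly G) (smin A ^+ 2).
Proof.
have [_ _ ->] := singular_valuesP A.
rewrite -(big_map (fun x => x ^+ 2) xpredT (fun x => 'X - x%:P)) root_prod_XsubC.
by apply/map_f/mem_nth; rewrite size_singular_values prednK.
Qed.

Lemma eigen_ge z : root (char_poly G) z -> smin A ^+ 2 <= z.
Proof.
have [_ /allP s0 ->] := singular_valuesP A.
rewrite -(big_map (fun x => x ^+ 2) xpredT (fun x => 'X - x%:P)) root_prod_XsubC.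
move=> /mapP[x xs ->]; apply: lerXn2r; rewrite ?nnegrE ?smin_ge0 ?s0//.
exact: smin_le_sv.
Qed.

Lemma pd_smin c : 0 <= c -> pd (G - (c ^+ 2)%:M) -> c < smin A.
Proof.
move=> c0 pG; rewrite ltNge; apply/negP => sc.
have := smin_eigen; rewrite -eigenvalue_root_char => /eigenvalueP[v vG v0].
have := proj2 pG v v0; rewrite qfB qf_scalar /qf vG dotZl -mulrBl.
apply/negP; rewrite -leNgt mulr_le0_ge0 ?dot_ge0// subr_le0.
by apply: lerXn2r; rewrite ?nnegrE ?smin_ge0.
Qed.

(** Let [z] be the supremum of the levels up to [c ^+ 2] at which [G - z] is
definite.  At [z] it is semidefinite, and it is invertible because eigenvalues
of [G] are at least [smin A ^+ 2]; so it is definite, and [z] could still be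
raised by [pd_shift] if it were below [c ^+ 2]. *)
Lemma smin_pd c : 0 <= c -> c < smin A -> pd (G - (c ^+ 2)%:M).
Proof.
move=> c0 sc; have c2 : c ^+ 2 < smin A ^+ 2.
  by rewrite ltr_pXn2r ?nnegrE ?smin_ge0.
pose E := [set z : R | pd (G - z%:M) /\ z <= c ^+ 2].
have Eub : ubound E (c ^+ 2) by move=> z [].
have E1 : E (-1).
  split; last by apply: le_trans (sqr_ge0 c); rewrite lerN10.
  split; first by rewrite linearB /= sG tr_scalar_mx.
  move=> u u0; rewrite qfB qf_scalar mulN1r opprK qf_gram.
  by rewrite ltr_wpDl ?dot_gt0// sumr_ge0// => j _; rewrite sqr_ge0.
have supE : has_sup E by split; [exists (-1)|exists (c ^+ 2)].
pose z := sup E.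
have zc : z <= c ^+ 2 by apply: ge_sup => //; exists (-1).
have psdz : psd (G - z%:M).
  split; first by rewrite linearB /= sG tr_scalar_mx.
  move=> u; rewrite qfB qf_scalar subr_ge0 leNgt; apply/negP => h.
  have [u0|u0] := eqVneq u 0; first by move: h; rewrite u0 qf0 dot0l mulr0 ltxx.
  have d0 := dot_gt0 u0.
  have eps : 0 < z - qf G u / dot u u by rewrite subr_gt0 ltr_pdivrMr.
  have [y [[_ py] _]] := sup_adherent eps supE.
  rewrite subKr ltr_pdivrMr// => hy.
  by have := py u u0; rewrite qfB qf_scalar; lra.
have unitz : G - z%:M \in unitmx.
  rewrite -row_free_unit -kermx_eq0; apply/rowV0P => v /sub_kermxP.
  rewrite mulmxBr mul_mx_scalar => /eqP; rewrite subr_eq0 => /eqP vG.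
  apply: contraTeq isT => v0.
  have : root (char_poly G) z.
    by rewrite -eigenvalue_root_char; apply/eigenvalueP; exists v.
  by move/eigen_ge; rewrite leNgt (le_lt_trans zc c2).
have pz := psd_unit_pd psdz unitz.
have [zc'|zc'] := ltP z (c ^+ 2); last first.
  by have -> : c ^+ 2 = z by apply/eqP; rewrite eq_le zc zc'.
pose t := \tr (invmx (G - z%:M) *m invmx (G - z%:M)).
have t0 : 0 <= t by rewrite tr_sq_ge0// (proj1 (pd_inv pz)).
pose del := Num.min (c ^+ 2 - z) (4 * (1 + t))^-1.
have del0 : 0 < del.
  by rewrite lt_min subr_gt0 zc' invr_gt0 mulr_gt0// ltr_wpDr.
have delt : 16 * del ^+ 2 * t <= 1.
  have d1 : del <= (4 * (1 + t))^-1 by rewrite ge_min lexx orbT.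
  have d2 : 4 * del * (1 + t) <= 1.
    have := d1; rewrite -[X in _ <= X]mul1r ler_pdivlMr ?mulr_gt0 ?ltr_wpDr//; lra.
  have d3 : (4 * del * (1 + t)) ^+ 2 <= 1.
    by rewrite exprn_ile1// mulr_ge0 ?mulr_ge0 ?(ltW del0)// addr_ge0.
  apply: le_trans d3.
  have -> : (4 * del * (1 + t)) ^+ 2 = 16 * del ^+ 2 * (1 + t) ^+ 2 by ring.
  apply: ler_wpM2l; first by rewrite mulr_ge0 ?sqr_ge0.
  have -> : (1 + t) ^+ 2 = 1 + 2 * t + t ^+ 2 by ring.
  have := sqr_ge0 t; lra.
have := pd_shift pz (ltW del0) delt.
have -> : G - z%:M - del%:M = G - (z + del)%:M by rewrite raddfD /= opprD addrA.
move=> pzd.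
have : E (z + del).
  split=> //; rewrite -lerBrDl /del ge_min lexx//.
move/(sup_upper_bound supE); rewrite -/z gerDl => h.
by move: del0; rewrite ltNge h.
Qed.

Lemma smin_leE c : 0 <= c -> (smin A <= c) = ~~ `[< pd (G - (c ^+ 2)%:M) >].
Proof.
move=> c0; rewrite leNgt; congr (~~ _); apply/idP/asboolP.
  exact: smin_pd.
exact: pd_smin.
Qed.
End SmallestSingularValue.

(** * Measurability of the smallest singular value *)

Section PositiveDefiniteRational.
Variables (R : realType) (n : nat).

Definition ratv (u : 'rV[rat]_n) : 'rV[R]_n := map_mx (@ratr R) u.

Lemma ratv_approx (u : 'rV[R]_n) (e : R) : 0 < e ->
  exists v : 'rV[rat]_n, forall i, `|ratv v 0 i - u 0 i| <= e.
Proof.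
move=> e0.
have h i : exists q : rat, `|ratr q - u 0 i| <= e.
  have ui : u 0 i - e < u 0 i + e by rewrite ltrBlDr -addrA ltrDl addr_gt0.
  have [q] := rat_in_itvoo ui; rewrite in_itv /= => /andP[h1 h2].
  by exists q; rewrite ler_norml; apply/andP; split; lra.
have [f hf] := choice h.
by exists (\row_i f i) => i; rewrite !mxE.
Qed.

Lemma dot_bound (v w : 'rV[R]_n) e : (forall i, `|w 0 i| <= e) ->
  `|dot v w| <= e * \sum_i `|v 0 i|.
Proof.
move=> we; rewrite dotE mulr_sumr; apply: le_trans (ler_norm_sum _ _ _) _.
by apply: ler_sum => i _; rewrite normrM mulrC; apply: ler_wpM2r.
Qed.

(** Density of the rational vectors. *)
Lemma qf_dense (F : 'M[R]_n) u : F^T = F ->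
  (forall v : 'rV[rat]_n, 0 <= qf F (ratv v)) -> 0 <= qf F u.
Proof.
move=> sF h; rewrite leNgt; apply/negP => q0.
pose C := 2 * (\sum_i `|(u *m F) 0 i|) + \sum_i \sum_j `|F i j|.
have C0 : 0 <= C.
  by rewrite addr_ge0 ?mulr_ge0 ?sumr_ge0// => i _; rewrite sumr_ge0.
pose e := Num.min 1 (- qf F u / (1 + C) / 2).
have C1 : 0 < 1 + C by rewrite ltr_wpDr.
have qC : 0 < - qf F u / (1 + C) / 2 by rewrite !divr_gt0// oppr_gt0.
have e0 : 0 < e by rewrite lt_min ltr01 qC.
have e1 : e <= 1 by rewrite ge_min lexx.
have e2 : e <= - qf F u / (1 + C) / 2 by rewrite ge_min lexx orbT.
have eC : e * C < - qf F u.
  have := e2; rewrite ler_pdivlMr// ler_pdivlMr//.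
  have := mulr_ge0 (ltW e0) C0; lra.
have [v hv] := ratv_approx u e0.
pose w := ratv v - u.
have hw i : `|w 0 i| <= e by rewrite !mxE; have := hv i; rewrite mxE.
have := h v; have -> : ratv v = u + w by rewrite addrC subrK.
rewrite /qf mulmxDl dotDl !(dotDr u w).
rewrite [dot (w *m F) u]dotC -(dot_sym _ _ sF).
have b1 := dot_bound (u *m F) hw.
have b2 : `|dot (w *m F) w| <= e * (\sum_i \sum_j `|F i j|).
  apply: le_trans (dot_bound _ hw) _; apply: ler_wpM2l; first exact: ltW.
  apply: (@le_trans _ _ (\sum_j \sum_i `|F i j|)); last by rewrite exchange_big.
  apply: ler_sum => j _; rewrite mxE; apply: le_trans (ler_norm_sum _ _ _) _.
  apply: ler_sum => i _; rewrite normrM; apply: ler_piMl => //.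
  exact: le_trans (hw i) e1.
rewrite -/(qf F u); move: b1 b2; rewrite !ler_norml => /andP[b1 b1'] /andP[b2 b2'].
move: eC; rewrite /C; lra.
Qed.

(** On rational vectors alone positivity of the form would not imply definiteness,
as the kernel may contain no rational vector; a uniform lower bound does. *)
Lemma pd_ratP (M : 'M[R]_n) : M^T = M ->
  pd M <-> exists k : nat, forall v : 'rV[rat]_n,
    k.+1%:R^-1 * dot (ratv v) (ratv v) <= qf M (ratv v).
Proof.
move=> sM; split=> [pM|[k hk]].
  set rho := Num.sqrt (\tr (invmx M *m invmx M)).
  have r0 : 0 <= rho by exact: sqrtr_ge0.
  exists (Num.bound rho) => v.
  have h := dot_le_qf (ratv v) pM.
  have kr : rho <= (Num.bound rho).+1%:R.
    by apply: le_trans (ltW (archi_boundP r0)) _; rewrite ler_nat.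
  rewrite ler_pdivrMl; last by rewrite ltr0n.
  apply: le_trans h _; apply: ler_wpM2r => //.
  exact: (proj2 (pd_psd pM)).
split=> // u u0.
have k0 : 0 < k.+1%:R^-1 :> R by rewrite invr_gt0 ltr0n.
have : 0 <= qf (M - k.+1%:R^-1%:M) u.
  apply: qf_dense; first by rewrite linearB /= sM tr_scalar_mx.
  by move=> v; rewrite qfB qf_scalar subr_ge0.
rewrite qfB qf_scalar subr_ge0; apply: lt_le_trans.
by rewrite mulr_gt0// dot_gt0.
Qed.
End PositiveDefiniteRational.

Section MeasurableSmin.
Variables (R : realType) (d : measure_display) (T : measurableType d).
Variables (N n : nat) (a : 'I_N -> 'I_n -> T -> R).
Hypothesis ma : forall j k, measurable_fun setT (a j k).
Let A t : 'M[R]_(N, n) := \matrix_(j, k) a j k t.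

Lemma measurable_pd_gram (z : R) :
  measurable [set t | pd ((A t)^T *m A t - z%:M)].
Proof.
have sG t : ((A t)^T *m A t - z%:M)^T = (A t)^T *m A t - z%:M.
  by rewrite linearB /= tr_scalar_mx trmx_mul trmxK.
pose f (v : 'rV[rat]_n) t := \sum_j (\sum_k ratv R v 0 k * a j k t) ^+ 2.
have mf v : measurable_fun setT (f v).
  apply: measurable_sum => j; apply: measurable_funX.
  by apply: measurable_sum => k; apply: measurable_funM => //; exact: ma.
pose D k v := [set t | k.+1%:R^-1 * dot (ratv R v) (ratv R v) +
  z * dot (ratv R v) (ratv R v) <= f v t].
have mD k v : measurable (D k v).
  have := mf v measurableT _ (measurable_itv `[k.+1%:R^-1 * dot (ratv R v) (ratv R v) +
  z * dot (ratv R v) (ratv R v), +oo[).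
  rewrite setTI; congr measurable; apply/seteqP; split=> t /=;
    by rewrite /D /= in_itv /= andbT.
have -> : [set t | pd ((A t)^T *m A t - z%:M)] =
    \bigcup_k \bigcap_(i : nat) (if unpickle i is Some v then D k v else setT).
  apply/seteqP; split=> t /=.
    move/(pd_ratP (sG t)) => [k hk]; exists k => // i _.
    case: (unpickle i) => // v; rewrite /D /=; have := hk v.
    rewrite qfB qf_scalar lerBrDr; congr (_ <= _).
    rewrite qf_gram; apply: eq_bigr => j _; congr (_ ^+ 2).
    by rewrite dotE; apply: eq_bigr => l _; rewrite !mxE.
  move=> [k _ hk]; apply/(pd_ratP (sG t)); exists k => v.
  have := hk (pickle v) I; rewrite pickleK /D /= qfB qf_scalar lerBrDr.
  congr (_ <= _).
  rewrite qf_gram; apply: eq_bigr => j _; congr (_ ^+ 2).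
  by rewrite dotE; apply: eq_bigr => l _; rewrite !mxE.
apply: bigcupT_measurable => k; apply: bigcapT_measurable => i.
by case: (unpickle i).
Qed.

Lemma measurable_smin_le (c : R) : (0 < n)%N ->
  measurable [set t | smin (A t) <= c].
Proof.
move=> n0; have [c0|c0] := leP 0 c; last first.
  have -> : [set t | smin (A t) <= c] = set0; last exact: measurable0.
  apply/seteqP; split=> t //= h; have := smin_ge0 (A t) n0; lra.
have -> : [set t | smin (A t) <= c] =
    ~` [set t | pd ((A t)^T *m A t - (c ^+ 2)%:M)].
  by apply/seteqP; split=> t /=; rewrite smin_leE// => /asboolPn.
exact/measurableC/measurable_pd_gram.
Qed.
End MeasurableSmin.

(** * Discretisation of a random variable *)

Section Cells.
Variables (R : realType) (lev h : R) (mm : nat).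
Hypotheses (lev_gt0 : 0 < lev) (h_gt0 : 0 < h) (mmh : mm%:R * h = 2 * lev).

(** The cell containing [x], among [mm] half-open cells of width [h] that cover
the window from [- lev] to [lev]; [None] stands for a value outside. *)
Definition cidx (x : R) : option 'I_mm :=
  if (- lev <= x < lev) then insub (Num.truncn ((x + lev) / h)) else None.

(** With [0] for [None], the moments of the rounded variable are those of the
truncated one. *)
Definition cval (o : option 'I_mm) : R :=
  if o is Some i then - lev + i%:R * h else 0.

Lemma cidxP x : - lev <= x < lev ->
  exists2 i : 'I_mm, cidx x = Some i & i%:R * h <= x + lev < i.+1%:R * h.
Proof.
move=> xt; rewrite /cidx xt; have /andP[x1 x2] := xt.
have y0 : 0 <= (x + lev) / h by rewrite divr_ge0 ?(ltW h_gt0)//; lra.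
have /andP[t1 t2] := truncn_itv y0.
have lt_mm : (Num.truncn ((x + lev) / h) < mm)%N.
  rewrite -(ltr_nat R); apply: le_lt_trans t1 _; rewrite ltr_pdivrMr// mmh; lra.
exists (Ordinal lt_mm); first by rewrite insubT.
by rewrite -ler_pdivlMr// -ltr_pdivrMr//; apply/andP; split.
Qed.

Lemma cidx_big x : ~~ (- lev <= x < lev) -> cidx x = None.
Proof. by rewrite /cidx => /negPf ->. Qed.

Lemma cidx_Some (i : 'I_mm) x :
  cidx x = Some i <-> - lev + i%:R * h <= x < - lev + i.+1%:R * h.
Proof.
split=> [|/andP[x1 x2]].
  have [xt|/cidx_big -> //] := boolP (- lev <= x < lev).
  by have [j -> /andP[j1 j2] [<-]] := cidxP xt; apply/andP; split; lra.
have ih : 0 <= i%:R * h by rewrite mulr_ge0// ltW.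
have im : i.+1%:R * h <= 2 * lev by rewrite -mmh ler_pM2r// ler_nat.
have xt : - lev <= x < lev by apply/andP; split; lra.
have [j -> /andP[j1 j2]] := cidxP xt; congr Some; apply/val_inj/eqP => /=.
rewrite eqn_leq; apply/andP.
by split; rewrite -ltnS -(ltr_nat R) -(ltr_pM2r h_gt0); lra.
Qed.

Lemma measurable_cidx o : measurable [set x | cidx x = o].
Proof.
case: o => [i|].
  have -> : [set x | cidx x = Some i] = [set` `[(- lev + i%:R * h), (- lev + i.+1%:R * h)[].
    by apply/seteqP; split=> x /=; rewrite in_itv /= => /cidx_Some.
  exact: measurable_itv.
have -> : [set x | cidx x = None] = ~` [set` `[(- lev), lev[].
  apply/seteqP; split=> x /=; rewrite in_itv /=.
    by move=> cN xt; have [i] := cidxP xt; rewrite cN.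
  by move=> /negP/cidx_big.
apply: measurableC; exact: measurable_itv.
Qed.

Lemma cval_approx x : - lev <= x < lev ->
  `|x - cval (cidx x)| <= h /\ `|cval (cidx x)| <= lev.
Proof.
move=> xt; have [i -> /andP[i1 i2]] := cidxP xt; have /andP[x1 x2] := xt.
have ih : 0 <= i%:R * h by rewrite mulr_ge0// ltW.
have im : i.+1%:R * h <= 2 * lev by rewrite -mmh ler_pM2r// ler_nat.
have iS : i.+1%:R * h = i%:R * h + h by rewrite -natr1 mulrDl mul1r.
rewrite iS in im i2.
by split; rewrite ler_norml /=; apply/andP; split; lra.
Qed.

Lemma cval_big x : ~~ (- lev <= x < lev) -> cval (cidx x) = 0 /\ lev <= `|x|.
Proof.
move=> xt; rewrite cidx_big//; split => //.
rewrite leNgt; apply: contra xt; rewrite ltr_norml => /andP[x1 ->].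
by rewrite ltW.
Qed.

Lemma cval_le o : `|cval o| <= lev.
Proof.
case: o => [i|] /=; last by rewrite normr0 ltW.
have ih : 0 <= i%:R * h by rewrite mulr_ge0// ltW.
have im : i.+1%:R * h <= 2 * lev by rewrite -mmh ler_pM2r// ler_nat.
have iS : i.+1%:R * h = i%:R * h + h by rewrite -natr1 mulrDl mul1r.
rewrite iS in im.
by rewrite ler_norml /=; apply/andP; split; move: ih im h_gt0; set a := _ * h; lra.
Qed.
End Cells.

Section CellMoments.
Variables (R : realType) (d : measure_display) (T : measurableType d).
Variables (P : probability T R) (X : {RV P >-> R}).
Local Notation intg f := (P.-integrable setT (EFin \o f)).
Local Notation Ex f := (Rintegral P setT f).

Lemma Ex_sum (I : Type) (s : seq I) (F : I -> T -> R) :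
  (forall i, intg (F i)) ->
  intg (fun t => \sum_(i <- s) F i t) /\
  Ex (fun t => \sum_(i <- s) F i t) = \sum_(i <- s) Ex (F i).
Proof.
move=> iF; elim: s => [|i s [IH1 IH2]].
  under eq_fun do rewrite big_nil; rewrite big_nil Rintegral_cst// mul0r.
  by split=> //; exact: finite_measure_integrable_cst.
have e : (fun t => \sum_(j <- i :: s) F j t) = (fun t => F i t + \sum_(j <- s) F j t).
  by apply/funext => t; rewrite big_cons.
rewrite e big_cons RintegralD// IH2; split=> //.
by have := integrableD measurableT (iF i) IH1.
Qed.

Lemma intg_cst (c : R) : intg (fun=> c).
Proof. exact: finite_measure_integrable_cst. Qed.

Lemma Ex_cst (c : R) : Ex (fun=> c) = c.
Proof.
have e : fine (P setT) = 1 by rewrite probability_setT.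
by rewrite Rintegral_cst// -[RHS]mulr1; congr (_ * _); exact: e.
Qed.

Lemma intgZ (c : R) f : intg f -> intg (fun t => c * f t).
Proof. by move=> h; have := integrableZl measurableT c h. Qed.

Lemma intgD f g : intg f -> intg g -> intg (fun t => f t + g t).
Proof. by move=> h h'; have := integrableD measurableT h h'. Qed.

Lemma intg_indic (A : set T) : measurable A -> intg (\1_A : T -> R).
Proof. by move=> mA; apply: integrable_indic => //; exact: fin_num_measure. Qed.

Lemma Ex_indic (A : set T) : measurable A -> Ex (\1_A : T -> R) = fine (P A).
Proof. by move=> mA; rewrite /Rintegral integral_indic// setIT. Qed.

Lemma Ex_le f g : intg f -> intg g -> (forall t, f t <= g t) -> Ex f <= Ex g.
Proof. by move=> f1 g1 fg; apply: le_Rintegral. Qed.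

(** A function close to an integrable one, with an error bounded by an integrable
function, is integrable and has nearly the same mean.  This compares a variable
with its discretisation inside and outside the window at once. *)
Lemma Ex_approx (f g Z : T -> R) (a b mu : R) :
  measurable_fun setT f -> intg g -> intg Z -> Ex Z <= mu -> 0 <= b ->
  (forall t, `|f t - g t| <= a + b * Z t) ->
  intg f /\ `|Ex f - Ex g| <= a + b * mu.
Proof.
move=> mf ig iZ Zmu b0 fg.
have mg : measurable_fun setT g by exact/measurable_EFinP/(measurable_int P).
have i1 : intg (fun t => a + b * Z t) by apply: intgD (intg_cst _) (intgZ _ _).
have i2 : intg (fun t => f t - g t).
  apply: (le_integrable measurableT _ _ i1).
    by apply/measurable_EFinP; exact: measurable_funB.
  move=> t _ /=; rewrite lee_fin; apply: le_trans (fg t) _; exact: ler_norm.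
have i3 : intg f.
  have -> : f = (fun t => (f t - g t) + g t) by apply/funext => t; rewrite subrK.
  exact: intgD.
split=> //; rewrite -RintegralB//.
have Eab : Ex (fun t => a + b * Z t) <= a + b * mu.
  rewrite RintegralD//; [|exact: intg_cst|exact: intgZ].
  rewrite Ex_cst RintegralZl//.
  by rewrite lerD2l; apply: ler_wpM2l.
rewrite ler_norml; apply/andP; split.
  rewrite lerNl; apply: le_trans Eab.
  have -> : - Ex (fun t => f t - g t) = Ex (fun t => -1 * (f t - g t)).
    by rewrite RintegralZl// mulN1r.
  apply: Ex_le => // [|t]; first exact: intgZ.
  by rewrite mulN1r; apply: le_trans (fg t); rewrite -normrN; exact: ler_norm.
apply: le_trans Eab; apply: Ex_le => // t.
by apply: le_trans (fg t); exact: ler_norm.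
Qed.

Variables (lev h : R) (mm : nat).
Hypotheses (lev_gt0 : 0 < lev) (h_gt0 : 0 < h) (mmh : mm%:R * h = 2 * lev).
Local Notation cidx := (cidx lev h mm).
Local Notation cval := (@cval _ lev h mm).

Definition cprob (o : option 'I_mm) : R :=
  fine (P (X @^-1` [set x | cidx x = o])).

Let mcell o : measurable (X @^-1` [set x | cidx x = o]).
Proof.
by rewrite -[X in measurable X]setTI; apply: measurable_funPT => //; exact: measurable_cidx.
Qed.

Lemma Ex_cell (c : option 'I_mm -> R) :
  intg (fun t => c (cidx (X t))) /\
  Ex (fun t => c (cidx (X t))) = \sum_o c o * cprob o.
Proof.
have e : (fun t => c (cidx (X t))) =
   (fun t => \sum_o c o * (\1_(X @^-1` [set x | cidx x = o]) t : R)).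
  apply/funext => t; rewrite (bigD1 (cidx (X t)))//= big1 ?addr0.
    by rewrite indicE mem_set// mulr1.
  by move=> o oc; rewrite indicE memNset ?mulr0//= => /esym/eqP; rewrite (negPf oc).
have i1 o : intg (fun t => c o * (\1_(X @^-1` [set x | cidx x = o]) t : R)).
  exact/intgZ/intg_indic.
rewrite e; have [-> ->] := Ex_sum (index_enum _) i1; split=> //.
apply: eq_bigr => o _; rewrite RintegralZl//; last exact: intg_indic.
by rewrite Ex_indic.
Qed.

Lemma cprob_ge0 o : 0 <= cprob o. Proof. exact: fine_ge0. Qed.

Lemma cprob_sum : \sum_o cprob o = 1.
Proof.
have [_] := Ex_cell (fun=> 1); rewrite Ex_cst.
by move=> ->; apply: eq_bigr => o _; rewrite mul1r.
Qed.

Variables (delta mu : R).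
Hypotheses (delta_gt0 : 0 < delta).
Hypothesis X_mean : ('E_P[X] = 0)%E.
Hypothesis X_var : ('E_P[fun t => (X t ^+ 2)%R] = 1)%E.
Hypothesis X_mom : ('E_P[fun t => (`|X t| `^ (4 + delta))%R] <= mu%:E)%E.
Let Z t : R := `|X t| `^ (4 + delta).

Let mX : measurable_fun setT X. Proof. exact: measurable_funPT. Qed.
Let mZ : measurable_fun setT Z.
Proof.
apply: (measurableT_comp (f := fun x : R => x `^ (4 + delta))).
  exact: measurable_powR.
exact: measurableT_comp.
Qed.

Let Z_ge0 t : 0 <= Z t. Proof. exact: powR_ge0. Qed.

Let iZ : intg Z.
Proof.
apply/integrableP; split; first exact/measurable_EFinP.
under eq_integral do rewrite /= ger0_norm//.
by move: X_mom; rewrite unlock => /le_lt_trans; apply; exact: ltry.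
Qed.

Let EZ : Ex Z <= mu.
Proof.
by rewrite -lee_fin fineK ?integrable_fin_num//; move: X_mom; rewrite unlock.
Qed.

(** Outside the window the high moment dominates lower powers. *)
Let tail_le k (x : R) : (k <= 4)%N -> lev <= `|x| ->
  `|x| ^+ k <= (lev `^ (4 + delta - k%:R))^-1 * `|x| `^ (4 + delta).
Proof.
move=> k4 tx; have x0 : 0 < `|x| by apply: lt_le_trans tx.
have s0 : 0 < 4 + delta - k%:R.
  have k4' : k%:R <= 4%:R :> R by rewrite ler_nat.
  by rewrite subr_gt0; apply: le_lt_trans k4' _; rewrite ltrDl.
have -> : `|x| `^ (4 + delta) = `|x| `^ (4 + delta - k%:R) * `|x| ^+ k.
  rewrite -powR_mulrn ?(ltW x0)// -powRD ?subrK//.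
  by apply/implyP => _; rewrite gt_eqF.
rewrite mulrA ler_peMl ?exprn_ge0// mulrC ler_pdivlMr ?powR_gt0// mul1r.
by apply: ge0_ler_powR; rewrite ?nnegrE// ltW.
Qed.

Lemma cprob_None : cprob None <= mu / lev `^ (4 + delta).
Proof.
have m0 : 0 <= (lev `^ (4 + delta))^-1 by rewrite invr_ge0 powR_ge0.
rewrite -[cprob None]Ex_indic//.
apply: (@le_trans _ _ (Ex (fun t => (lev `^ (4 + delta))^-1 * Z t))); last first.
  by rewrite RintegralZl// mulrC; apply: ler_wpM2r.
apply: Ex_le; [exact: intg_indic|exact: intgZ|move=> t].
rewrite indicE; case: (asboolP (cidx (X t) = None)) => [cN|cN]; last first.
  by rewrite memNset// mulr_ge0.
rewrite mem_set//=.
have tX : lev <= `|X t|.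
  have [xt|] := boolP (- lev <= X t < lev); last by case/(cval_big h mm).
  by have [i] := cidxP h_gt0 mmh xt; rewrite cN.
by have := @tail_le 0 _ isT tX; rewrite expr0 subr0.
Qed.

Lemma cprob_mean :
  `|\sum_o cval o * cprob o| <= h + mu / lev `^ (3 + delta).
Proof.
have [ig <-] := Ex_cell cval.
have m0 : 0 <= (lev `^ (3 + delta))^-1 by rewrite invr_ge0 powR_ge0.
have EX : Ex X = 0 by rewrite /Rintegral; move: X_mean; rewrite unlock => ->.
suff fg t : `|X t - cval (cidx (X t))| <= h + (lev `^ (3 + delta))^-1 * Z t.
  have [_] := Ex_approx mX ig iZ EZ m0 fg.
  by rewrite EX sub0r normrN [_ / _]mulrC.
have [xt|xt] := boolP (- lev <= X t < lev).
  have [h1 _] := cval_approx h_gt0 mmh xt.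
  by apply: le_trans h1 _; rewrite lerDl mulr_ge0.
have [-> tx] := cval_big h mm xt; rewrite subr0.
have := @tail_le 1 _ isT tx; rewrite expr1.
have -> : 4 + delta - 1%:R = 3 + delta by lra.
by move=> h1; apply: le_trans h1 _; rewrite lerDr ltW.
Qed.

Lemma cprob_var :
  `|\sum_o cval o ^+ 2 * cprob o - 1| <= 2 * lev * h + mu / lev `^ (2 + delta).
Proof.
have [ig <-] := Ex_cell (fun o => cval o ^+ 2).
have m0 : 0 <= (lev `^ (2 + delta))^-1 by rewrite invr_ge0 powR_ge0.
have mX2 : measurable_fun setT (fun t => X t ^+ 2) by exact: measurable_funX.
have th : 0 <= 2 * lev * h by rewrite !mulr_ge0// ltW.
have EX2 : Ex (fun t => X t ^+ 2) = 1.
  by rewrite /Rintegral; move: X_var; rewrite unlock => ->.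
suff fg t : `|X t ^+ 2 - cval (cidx (X t)) ^+ 2| <=
    2 * lev * h + (lev `^ (2 + delta))^-1 * Z t.
  have [_] := Ex_approx mX2 ig iZ EZ m0 fg.
  by rewrite EX2 distrC [_ / _]mulrC.
have [xt|xt] := boolP (- lev <= X t < lev).
  have [h1 h2] := cval_approx h_gt0 mmh xt.
  apply: (@le_trans _ _ (2 * lev * h)); last by rewrite lerDl mulr_ge0.
  rewrite subr_sqr normrM mulrC; apply: ler_pM => //.
  apply: le_trans (ler_normD _ _) _; rewrite mulr_natl mulr2n.
  by apply: lerD => //; rewrite ler_norml; have /andP[-> /ltW] := xt.
have [-> tx] := cval_big h mm xt; rewrite expr0n subr0.
have := @tail_le 2 _ isT tx; rewrite real_normK ?num_real//.
have -> : 4 + delta - 2%:R = 2 + delta by lra.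
rewrite (ger0_norm (sqr_ge0 _)) => h1; apply: le_trans h1 _.
by rewrite lerDr.
Qed.
End CellMoments.

(** * The law of the discretised matrix *)

Section Configuration.
Variables (R : realType) (d : measure_display) (T : measurableType d).
Variables (P : probability T R) (N n : nat) (p : R).
Variables (X xi : 'I_N * 'I_n -> {RV P >-> R}).
Hypothesis model : sparse_model p X xi.
Variables (lev h : R) (mm : nat).
Hypotheses (lev_gt0 : 0 < lev) (h_gt0 : 0 < h) (mmh : mm%:R * h = 2 * lev).
Local Notation cidx := (cidx lev h mm).
Notation S := (bool * option 'I_mm)%type.

Variable jk0 : 'I_N * 'I_n.
Local Notation q := (cprob (X jk0) lev h (mm := mm)).

Definition sym jk t : S := (xi jk t == 1, cidx (X jk t)).
Definition weight (s : S) : R := (if s.1 then p else 1 - p) * q s.2.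
Definition conf t : N.-tuple {ffun 'I_n -> S} :=
  [tuple [ffun k => sym (j, k) t] | j < N].

Let mcell o : measurable [set x | cidx x = o].
Proof. exact: measurable_cidx. Qed.

Let mpre (Y : {RV P >-> R}) (E : set R) : measurable E -> measurable (Y @^-1` E).
Proof.
by move=> mE; rewrite -[X in measurable X]setTI; exact: measurable_funPT.
Qed.

Let bset (b : bool) : set R := if b then [set 1] else ~` [set 1].
Let mbset b : measurable (bset b).
Proof. by case: b => /=; [|apply: measurableC]; exact: measurable_set1. Qed.

Lemma prob_xi jk : P (xi jk @^-1` [set 1]) = p%:E.
Proof.
have [xi01 <-] := sm_xi_bernoulli model jk.
rewrite -(@expectation_indic _ _ _ P (xi jk @^-1` [set 1])); last first.
  exact: mpre (measurable_set1 _).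
congr ('E_P[_])%E; apply/funext => t; rewrite indicE.
have [e|e] := xi01 t; rewrite e.
  by rewrite memNset//= e => /esym/eqP; rewrite oner_eq0.
by rewrite mem_set.
Qed.

Lemma p_ge0 : 0 <= p.
Proof. by rewrite -lee_fin -(prob_xi jk0). Qed.

Lemma p_le1 : p <= 1.
Proof. by rewrite -lee_fin -(prob_xi jk0) probability_le1//; exact: mpre. Qed.

Let prob_b jk b : P (xi jk @^-1` bset b) = (if b then p else 1 - p)%:E.
Proof.
case: b; first exact: prob_xi.
rewrite /bset -preimage_setC probability_setC; last exact: mpre.
by rewrite prob_xi.
Qed.

Let prob_c jk o : P (X jk @^-1` [set x | cidx x = o]) = (q o)%:E.
Proof.
have := sm_X_identical model jk jk0 (mcell o).
rewrite /distribution /pushforward /= => ->.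
by rewrite fineK// fin_num_measure//; exact: mpre.
Qed.

Lemma weight_ge0 s : 0 <= weight s.
Proof.
rewrite mulr_ge0 ?cprob_ge0//; case: (s.1); first exact: p_ge0.
by rewrite subr_ge0 p_le1.
Qed.

Lemma weight_sum : \sum_s weight s = 1.
Proof.
rewrite -(pair_bigA _ (fun b o => weight (b, o))) /= big_bool /= -!mulr_sumr.
by rewrite (cprob_sum (X jk0) h_gt0 mmh) !mulr1 addrC subrK.
Qed.

Let in_sigma (Y : 'I_N * 'I_n -> {RV P >-> R}) (E : 'I_N * 'I_n -> set R) :
  (forall i, measurable (E i)) ->
  sigma_family Y (\bigcap_(i in [set` [set: 'I_N * 'I_n]%SET]) (Y i @^-1` E i)).
Proof.
move=> mE.
apply: (@fin_bigcap_measurable _ (g_sigma_algebraType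
  [set A | exists i, preimage_set_system setT (Y i) measurable A])).
  exact: finite_finset.
move=> i _; apply: sub_sigma_algebra; exists i; exists (E i) => //.
by rewrite setTI.
Qed.

Lemma prob_conf (s : 'I_N * 'I_n -> S) :
  P [set t | forall jk, sym jk t = s jk] = (\prod_jk weight (s jk))%:E.
Proof.
pose A := \bigcap_(i in [set` [set: 'I_N * 'I_n]%SET])
  (X i @^-1` [set x | cidx x = (s i).2]).
pose B := \bigcap_(i in [set` [set: 'I_N * 'I_n]%SET])
  (xi i @^-1` bset (s i).1).
have -> : [set t | forall jk, sym jk t = s jk] = A `&` B.
  apply/seteqP; split=> t /=.
    move=> hs; split=> i _ /=; rewrite -(hs i)//=.
    by rewrite /bset; case: (eqVneq (xi i t) 1) => // /eqP.
  move=> [hA hB] i; have iT : [set` [set: 'I_N * 'I_n]%SET] i by rewrite /= inE.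
  have := hA i iT; have := hB i iT; rewrite /= /sym /bset.
  case: (s i) => b o /=; case: b => [/= -> ->|/= h1 ->]; first by rewrite eqxx.
  by have /eqP/negPf -> := h1.
rewrite (sm_X_xi_independent model); [|exact: in_sigma|exact: in_sigma].
rewrite (sm_X_independent model)// (sm_xi_independent model)//.
rewrite (eq_bigr (fun i => (q (s i).2)%:E)); last by move=> i _; exact: prob_c.
rewrite [X in (_ * X)%E](eq_bigr (fun i => (if (s i).1 then p else 1 - p)%:E));
  last by move=> i _; exact: prob_b.
rewrite !prodEFin -EFinM -big_split /=; congr EFin.
rewrite (eq_bigl xpredT); last by move=> i; rewrite inE.
by apply: eq_bigr => i _; rewrite /weight mulrC.
Qed.

Lemma prob_conf_eq (s : N.-tuple {ffun 'I_n -> S}) :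
  measurable [set t | conf t = s] /\
  P [set t | conf t = s] = (\prod_j iid weight (tnth s j))%:E.
Proof.
have -> : [set t | conf t = s] =
    [set t | forall jk, sym jk t = tnth s jk.1 jk.2].
  apply/seteqP; split=> t /=.
    by move=> <- [j k] /=; rewrite tnth_mktuple ffunE.
  move=> hs; apply: eq_from_tnth => j; rewrite tnth_mktuple.
  by apply/ffunP => k; rewrite ffunE; exact: (hs (j, k)).
split; last first.
  by rewrite prob_conf /iid pair_bigA.
have -> : [set t | forall jk, sym jk t = tnth s jk.1 jk.2] =
    \bigcap_(i in [set` [set: 'I_N * 'I_n]%SET])
     (X i @^-1` [set x | cidx x = (tnth s i.1 i.2).2] `&`
      xi i @^-1` bset (tnth s i.1 i.2).1).
  apply/seteqP; split=> t /=.
    move=> hs i _ /=; split=> /=; rewrite -(hs i)//=.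
    by rewrite /bset; case: (eqVneq (xi i t) 1) => // /eqP.
  move=> hA i; have iT : [set` [set: 'I_N * 'I_n]%SET] i by rewrite /= inE.
  have [] := hA i iT; rewrite /= /sym /bset.
  case: (tnth s i.1 i.2) => b o /=; case: b => [/= -> ->|/= -> h1].
    by rewrite eqxx.
  by have /eqP/negPf -> := h1.
apply: fin_bigcap_measurable; first exact: finite_finset.
by move=> i _; apply: measurableI; exact: mpre.
Qed.

(** The event itself need not be a union of configurations: it is enough that [bad]
covers it, because its indicator is then at most the sum of theirs. *)
Lemma prob_le_conf (E : set T) (bad : N.-tuple {ffun 'I_n -> S} -> bool) :
  measurable E -> (forall t, E t -> bad (conf t)) ->
  (P E <= (\sum_s (\prod_j iid weight (tnth s j)) * (bad s)%:R)%:E)%E.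
Proof.
move=> mE Ebad.
have mc s : measurable [set t | conf t = s] by have [] := prob_conf_eq s.
pose F s t := (bad s)%:R * (\1_[set t | conf t = s] t : R).
have iF s : P.-integrable setT (EFin \o F s) by exact/intgZ/intg_indic.
have [iS eS] := Ex_sum (index_enum _) iF.
rewrite -(@fineK _ (P E)) ?fin_num_measure// lee_fin -Ex_indic//.
apply: (@le_trans _ _ (Rintegral P setT (fun t => \sum_s F s t))).
  apply: Ex_le => // [|t]; first exact: intg_indic.
  rewrite (bigD1 (conf t))//= /F indicE [X in _ <= _ * X + _]indicE.
  rewrite (@mem_set _ [set _ | _]) ?mulr1//.
  case: (asboolP (E t)) => [Et|nE].
    rewrite mem_set// Ebad// lerDl; apply: sumr_ge0 => s _.
    by rewrite mulr_ge0.
  rewrite memNset// addr_ge0//; apply: sumr_ge0 => s _.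
  by rewrite mulr_ge0.
rewrite eS; apply: ler_sum => s _.
rewrite RintegralZl//; last exact: intg_indic.
rewrite Ex_indic// mulrC; have [_ ->] := prob_conf_eq s.
by [].
Qed.
End Configuration.

(** * From the discretised rows back to the sparse matrix *)

Section Perturbation.
Variables (R : realType) (N n : nat) (S : finType) (z : S -> R) (small : pred S).
Local Notation x := (good_row z small (n := n)).

Lemma qf_gram_sum (s : N.-tuple {ffun 'I_n -> S}) u :
  qf (gram x s) u = \sum_j dot u (x (tnth s j)) ^+ 2.
Proof.
rewrite /gram big_tuple.
have -> : qf (\sum_j (x (tnth s j))^T *m x (tnth s j)) u =
    \sum_j qf ((x (tnth s j))^T *m x (tnth s j)) u.
  elim/big_rec2: _ => [|j a M _ <-]; last by rewrite qfD.
  by rewrite /qf mulmx0 dot0l.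
by apply: eq_bigr => j _; rewrite qf_outer.
Qed.

Lemma dot_small_sq (e u : 'rV[R]_n) (eta : R) : 0 <= eta ->
  (forall k, `|e 0 k| <= eta) -> dot u e ^+ 2 <= n%:R * eta ^+ 2 * dot u u.
Proof.
move=> eta0 he; apply: le_trans (dot_CS _ _) _; rewrite mulrC.
apply: ler_wpM2r; first exact: dot_ge0.
rewrite dotE -[n in n%:R]card_ord mulr_natl -sumr_const; apply: ler_sum => k _.
by rewrite -expr2 -real_normK ?num_real//; apply: lerXn2r; rewrite ?nnegrE.
Qed.

(** On good rows the entries of [A] are, up to [eta], those of the normalised
discrete row times the standard deviation [r], and
[(r a + b)^2 >= r^2 a^2 / 2 - b^2]; the other rows contribute nonnegatively. *)
Lemma smin_from_gram (A : 'M[R]_(N, n)) (s : N.-tuple {ffun 'I_n -> S})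
    (v eta c0 c1 : R) (r : R) :
  (0 < n)%N -> 0 <= eta -> 0 < v -> r ^+ 2 = v -> 0 <= c1 ->
  (forall j k, [forall k, small (tnth s j k)] ->
     `|A j k - r * z (tnth s j k)| <= eta) ->
  pd (gram x s - c0%:M) ->
  c1 ^+ 2 <= v / 2 * c0 - N%:R * n%:R * eta ^+ 2 ->
  c1 < smin A.
Proof.
move=> n0 eta0 v0 rv c10 hA pg hc; apply: pd_smin => //.
split; first by rewrite linearB /= tr_scalar_mx trmx_mul trmxK.
move=> u u0; rewrite qfB qf_scalar subr_gt0 qf_gram.
have d0 := dot_gt0 u0.
have := proj2 pg u u0; rewrite qfB qf_scalar subr_gt0 qf_gram_sum => hg.
have row_le j : v / 2 * dot u (x (tnth s j)) ^+ 2 - n%:R * eta ^+ 2 * dot u u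
    <= dot u (row j A) ^+ 2.
  have nn : 0 <= n%:R * eta ^+ 2 * dot u u.
    by rewrite mulr_ge0 ?(ltW d0)// mulr_ge0// sqr_ge0.
  rewrite /good_row; case: ifPn => [hj|_]; last first.
    rewrite dotC dot0l expr0n mulr0 sub0r; apply: (@le_trans _ _ 0).
      by rewrite oppr_le0.
    exact: sqr_ge0.
  set zj := zrow z _.
  pose e := row j A - r *: zj.
  have he : dot u e ^+ 2 <= n%:R * eta ^+ 2 * dot u u.
    by apply: dot_small_sq => // k; rewrite !mxE; exact: hA.
  have -> : row j A = r *: zj + e by rewrite addrC subrK.
  rewrite dotDr dotZr.
  have h1 : v / 2 * dot u zj ^+ 2 - dot u e ^+ 2 <= (r * dot u zj + dot u e) ^+ 2.
    rewrite -rv; set a := dot u zj; set b := dot u e.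
    have := sqr_ge0 (r * a + 2 * b); nra.
  by apply: le_trans h1; rewrite lerB.
apply: (@lt_le_trans _ _ (\sum_j (v / 2 * dot u (x (tnth s j)) ^+ 2
   - n%:R * eta ^+ 2 * dot u u))); last by apply: ler_sum => j _.
rewrite big_split /= -mulr_sumr sumrN sumr_const card_ord -mulr_natl.
have h1 : v / 2 * (c0 * dot u u) < v / 2 * \sum_j dot u (x (tnth s j)) ^+ 2.
  by rewrite ltr_pM2l// divr_gt0.
have h2 := ler_wpM2r (ltW d0) hc; lra.
Qed.
End Perturbation.

Lemma bernoulli_ineq (R : realType) (a : R) n : 0 <= a -> a <= 1 ->
  1 - a ^+ n <= n%:R * (1 - a).
Proof.
move=> a0 a1; elim: n => [|n IH]; first by rewrite expr0 subrr mul0r.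
rewrite exprS -natr1 mulrDl mul1r.
have -> : 1 - a * a ^+ n = a * (1 - a ^+ n) + (1 - a) by ring.
rewrite lerD2r; apply: le_trans IH; apply: ler_piMl => //.
by rewrite subr_ge0 exprn_ile1.
Qed.

Section SymbolMoments.
Variables (R : realType) (mm : nat) (p lev h : R) (q : option 'I_mm -> R).
Local Notation S := (bool * option 'I_mm)%type.
Hypotheses (p_ge0 : 0 <= p) (p_le1 : p <= 1).
Hypotheses (q_ge0 : forall o, 0 <= q o) (q_sum : \sum_o q o = 1).
Let w (s : S) := (if s.1 then p else 1 - p) * q s.2.

(** An absent entry is small whatever the value of its variable. *)
Definition small_sym (s : S) : bool := ~~ (s.1 && (s.2 == None)).
Definition val_sym (s : S) : R := if s.1 then cval lev h s.2 else 0.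

Lemma sum_small (f : S -> R) :
  \sum_(s | small_sym s) w s * f s =
  p * (\sum_o q o * f (true, o) - q None * f (true, None))
  + (1 - p) * \sum_o q o * f (false, o).
Proof.
rewrite big_mkcond (eq_bigr (fun s => if small_sym (s.1, s.2)
  then w (s.1, s.2) * f (s.1, s.2) else 0)); last by case.
rewrite -(pair_bigA _ (fun b o => if small_sym (b, o)
  then w (b, o) * f (b, o) else 0)) /= big_bool /=.
congr (_ + _); last by rewrite mulr_sumr; apply: eq_bigr => o _; rewrite mulrA.
rewrite mulrBr mulr_sumr !(bigD1 (P := xpredT) None)//= add0r addrAC.
rewrite subrr add0r; apply: eq_bigr => o oN.
by rewrite /small_sym /w /= (negPf oN) mulrA.
Qed.

Let om0 := \sum_(s | small_sym s) w s.
Let A1 := \sum_o cval lev h o * q o.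
Let A2 := \sum_o cval lev h o ^+ 2 * q o.

Lemma small_mass : om0 = 1 - p * q None.
Proof.
have := sum_small (fun=> 1); under eq_bigr do rewrite mulr1.
rewrite -/om0 => ->; under eq_bigr do rewrite mulr1.
by rewrite q_sum; ring.
Qed.

Lemma small_mean : \sum_(s | small_sym s) w s * val_sym s = p * A1.
Proof.
rewrite sum_small /val_sym /= mulr0 subr0 [X in _ + _ * X]big1 ?mulr0 ?addr0.
  by congr (_ * _); apply: eq_bigr => o _; rewrite mulrC.
by move=> o _; rewrite mulr0.
Qed.

Lemma small_second : \sum_(s | small_sym s) w s * val_sym s ^+ 2 = p * A2.
Proof.
rewrite sum_small /val_sym /= expr0n mulr0 subr0 [X in _ + _ * X]big1 ?mulr0 ?addr0.
  by congr (_ * _); apply: eq_bigr => o _; rewrite mulrC.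
by move=> o _; rewrite mulr0.
Qed.

Definition mean_sym : R := p * A1 / om0.
Definition var_sym : R := p * A2 / om0 - mean_sym ^+ 2.
(** Centring and normalisation under the law conditioned on the symbol being
small. *)
Definition z_sym (s : S) : R := (val_sym s - mean_sym) / Num.sqrt var_sym.

Hypotheses (om0_gt0 : 0 < om0) (var_gt0 : 0 < var_sym).
Let sd := Num.sqrt var_sym.
Let sd0 : 0 < sd. Proof. by rewrite sqrtr_gt0. Qed.
Let sd2 : sd ^+ 2 = var_sym. Proof. by rewrite sqr_sqrtr// ltW. Qed.

Lemma z_mean : \sum_(s | small_sym s) w s * z_sym s = 0.
Proof.
have -> : \sum_(s | small_sym s) w s * z_sym s =
    (\sum_(s | small_sym s) w s * val_sym s - mean_sym * om0) / sd.
  rewrite mulr_sumr -sumrB mulr_suml; apply: eq_bigr => s _.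
  by rewrite /z_sym; ring.
by rewrite small_mean /mean_sym divfK ?gt_eqF// subrr mul0r.
Qed.

Lemma z_var : \sum_(s | small_sym s) w s * z_sym s ^+ 2 = om0.
Proof.
have -> : \sum_(s | small_sym s) w s * z_sym s ^+ 2 =
    (\sum_(s | small_sym s) w s * val_sym s ^+ 2
     - 2 * mean_sym * \sum_(s | small_sym s) w s * val_sym s
     + mean_sym ^+ 2 * om0) / sd ^+ 2.
  rewrite !mulr_sumr -sumrB -big_split mulr_suml; apply: eq_bigr => s _ /=.
  by rewrite /z_sym expr_div_n -/sd; ring.
rewrite small_mean small_second sd2.
have e : p * A2 - 2 * mean_sym * (p * A1) + mean_sym ^+ 2 * om0 = var_sym * om0.
  by rewrite /var_sym /mean_sym; field; rewrite gt_eqF.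
by rewrite e mulrAC divff ?gt_eqF// mul1r.
Qed.

Lemma z_four k2 : (forall s, (val_sym s - mean_sym) ^+ 2 <= k2 * var_sym) ->
  \sum_(s | small_sym s) w s * z_sym s ^+ 4 <= k2 * om0.
Proof.
move=> hk; rewrite -z_var mulr_sumr; apply: ler_sum => s _.
have w0 : 0 <= w s.
  by rewrite mulr_ge0//; case: (s.1) => //; rewrite subr_ge0.
rewrite [leRHS]mulrCA; apply: ler_wpM2l => //.
rewrite [_ ^+ 4](_ : _ = z_sym s ^+ 2 * z_sym s ^+ 2); last by rewrite -exprD.
apply: ler_wpM2r; first exact: sqr_ge0.
by rewrite /z_sym expr_div_n -/sd sd2 ler_pdivrMr.
Qed.
End SymbolMoments.

(** * The bound at a fixed size *)

(** Here [Lam = N p].  All error terms are monomials in the two small quantities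
[e = 1 / Lam] and [t = lev / Lam], with [t ^+ 2 <= e] and with constants that
depend on [D1 = 1 + mu] only; the hypotheses [Lam1], [Lam2] and [Lam3] make them
harmless. *)
Section FixedSize.
Variables (R : realType) (y nu K : R).
Hypotheses (nu_gt0 : 0 < nu) (K_gt0 : 0 < K) (core : barrier_bound y nu K).
Variables (d : measure_display) (T : measurableType d) (P : probability T R).
Variables (N n : nat) (p delta mu lev : R) (m : nat).
Variables (X xi : 'I_N * 'I_n -> {RV P >-> R}).
Hypotheses (n_gt0 : (0 < n)%N) (nN : (n <= N)%N) (nyN : n%:R <= y * N%:R).
Hypotheses (m_gt0 : (0 < m)%N) (model : sparse_model p X xi).
Hypotheses (delta_gt0 : 0 < delta) (mu_gt0 : 0 < mu).
Hypothesis moments :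
  forall jk, ('E_P[fun t => (`|X jk t| `^ (4 + delta))%R] <= mu%:E)%E.
Let Lam := N%:R * p.
Let D1 := 1 + mu.
Hypotheses (lev_ge1 : 1 <= lev) (levE : lev `^ (4 + delta) = Lam ^+ 2).
Hypotheses (lev_sq : lev ^+ 2 <= Lam) (Lam1 : 16 * D1 ^+ 2 <= Lam).
Hypotheses (Lam2 : 72 * D1 ^+ 2 <= nu * Lam ^+ 2) (Lam3 : K * mu <= Lam).
Hypotheses (mlev : 8 * K * m%:R * lev ^+ 2 <= Lam).
Hypotheses (mN : K * m%:R <= Num.sqrt N%:R).

Let N_gt0 : (0 < N)%N. Proof. exact: leq_trans nN. Qed.
Let jk0 : 'I_N * 'I_n := (Ordinal N_gt0, Ordinal n_gt0).
Let NR : 0 < N%:R :> R. Proof. by rewrite ltr0n. Qed.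
Let p_ge0 : 0 <= p. Proof. exact: p_ge0 model jk0. Qed.
Let p_le1 : p <= 1. Proof. exact: p_le1 model jk0. Qed.
Let D1_ge1 : 1 <= D1. Proof. by rewrite /D1 lerDl ltW. Qed.
Let Lam16 : 16 <= Lam.
Proof. by apply: le_trans Lam1; rewrite ler_peMr// exprn_ege1. Qed.
Let Lam_gt0 : 0 < Lam. Proof. by apply: lt_le_trans Lam16. Qed.
Let p_gt0 : 0 < p.
Proof. by move: Lam_gt0; rewrite /Lam pmulr_rgt0. Qed.
Let lev_gt0 : 0 < lev. Proof. by apply: lt_le_trans lev_ge1. Qed.

(* So many cells that the rounding error [h] is below [p * (t * e)], the size of
   the mean created by the truncation. *)
Let mm := (Num.truncn (2 * Lam ^+ 2 / p)).+1.
Let mm_gt0 : 0 < mm%:R :> R. Proof. by rewrite ltr0n. Qed.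
Let h := 2 * lev / mm%:R.
Let h_gt0 : 0 < h. Proof. by rewrite divr_gt0// mulr_gt0. Qed.
Let mmh : mm%:R * h = 2 * lev.
Proof. by rewrite mulrC /h divfK// gt_eqF. Qed.

Let e := Lam^-1.
Let t := lev / Lam.
Let e_gt0 : 0 < e. Proof. by rewrite invr_gt0. Qed.
Let e_ge0 : 0 <= e. Proof. exact: ltW. Qed.
Let t_ge0 : 0 <= t. Proof. by rewrite divr_ge0// ltW. Qed.
Let LamE : Lam * e = 1. Proof. by rewrite mulfV// gt_eqF. Qed.
Let e16 : 16 * e <= 1.
Proof. by have := ler_wpM2r e_ge0 Lam16; rewrite LamE. Qed.
Let D1e : 16 * (D1 ^+ 2 * e) <= 1.
Proof. by have := ler_wpM2r e_ge0 Lam1; rewrite LamE mulrA. Qed.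
Let D1_ge0 : 0 <= D1. Proof. exact: le_trans D1_ge1. Qed.
Let D1e1 : 16 * (D1 * e) <= 1.
Proof.
apply: le_trans D1e; apply: ler_wpM2l => //; apply: (ler_wpM2r e_ge0).
by rewrite expr2 ler_peMl.
Qed.
Let t2 : t ^+ 2 <= e.
Proof.
rewrite /t /e expr_div_n ler_pdivrMr ?exprn_gt0//.
by rewrite expr2 mulKf ?gt_eqF.
Qed.
Let t_le1 : t <= 1.
Proof.
rewrite ler_pdivrMr// mul1r; apply: le_trans lev_sq.
by rewrite expr2 ler_peMr// ltW.
Qed.
Let tLam : lev / Lam ^+ 2 = t * e.
Proof. by rewrite /t /e expr2 invfM mulrA. Qed.

Let h_le : h <= p * (t * e).
Proof.
have mmb : 2 * Lam ^+ 2 / p <= mm%:R.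
  by rewrite ltW// truncnS_gt.
rewrite /h -tLam ler_pdivrMr//.
have -> : 2 * lev = p * (lev / Lam ^+ 2) * (2 * Lam ^+ 2 / p).
  by field; rewrite !gt_eqF.
apply: ler_wpM2l mmb; rewrite mulr_ge0// divr_ge0 ?(ltW lev_gt0)//.
exact: sqr_ge0.
Qed.

Let powE (k : R) : lev `^ (4 + delta - k) = Lam ^+ 2 / lev `^ k.
Proof.
rewrite -levE powRD; last by apply/implyP => _; rewrite gt_eqF.
by rewrite powRN.
Qed.

Let q := cprob (X jk0) lev h (mm := mm).
Let A1 := \sum_o cval lev h o * q o.
Let A2 := \sum_o cval lev h o ^+ 2 * q o.
Let q_ge0 o : 0 <= q o. Proof. exact: cprob_ge0. Qed.
Let q_sum : \sum_o q o = 1. Proof. exact: cprob_sum. Qed.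

Let q0_le : q None <= mu * e ^+ 2.
Proof.
have := cprob_None lev_gt0 h_gt0 mmh delta_gt0 (moments jk0).
by rewrite levE /e exprVn.
Qed.

Let lev_pow k : (k <= 4)%N ->
  mu / lev `^ (4 - k%:R + delta) = mu * (lev ^+ k * e ^+ 2).
Proof.
move=> k4; have := powE k%:R; rewrite addrAC => ->.
by rewrite powR_mulrn ?(ltW lev_gt0)// /e exprVn invf_div.
Qed.

Let A1_le : `|A1| <= D1 * (t * e).
Proof.
have := cprob_mean lev_gt0 h_gt0 mmh delta_gt0 (sm_X_mean model jk0) (moments jk0).
have -> : 3 + delta = 4 - 1%:R + delta by lra.
rewrite lev_pow// expr1 => h1; apply: le_trans h1 _.
have -> : D1 * (t * e) = t * e + mu * (t * e) by rewrite /D1; ring.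
have -> : lev * e ^+ 2 = t * e by rewrite /t /e expr2 mulrA.
rewrite lerD2r.
by apply: le_trans h_le _; apply: ler_piMl => //; rewrite mulr_ge0// ltW.
Qed.

Let A2_le : `|A2 - 1| <= 2 * D1 * e.
Proof.
have := cprob_var lev_gt0 h_gt0 mmh delta_gt0 (sm_X_variance model jk0) (moments jk0).
have -> : 2 + delta = 4 - 2%:R + delta by lra.
rewrite lev_pow// => h1; apply: le_trans h1 _.
have te : lev ^+ 2 * e ^+ 2 = t ^+ 2 by rewrite /t /e exprMn.
have h2 : 2 * lev * h <= 2 * (lev ^+ 2 * e ^+ 2).
  have -> : 2 * (lev ^+ 2 * e ^+ 2) = 2 * lev * (t * e) by rewrite /t /e; ring.
  apply: ler_wpM2l; first by rewrite mulr_ge0// ltW.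
  by apply: le_trans h_le _; apply: ler_piMl => //; rewrite mulr_ge0// ltW.
have h3 := ler_wpM2l (ltW mu_gt0) t2.
have -> : 2 * D1 * e = 2 * e + mu * e + mu * e by rewrite /D1; ring.
have mue0 : 0 <= mu * e by rewrite mulr_ge0// ltW.
move: h2 h3 t2 mue0; rewrite te; set s2 := t ^+ 2; lra.
Qed.

Local Notation weight := (weight p X lev h jk0 (mm := mm)).
Local Notation small := (@small_sym mm).
Let om0 := \sum_(s | small s) weight s.
Let m1 := mean_sym p lev h q.
Let v := var_sym p lev h q.
Local Notation z := (z_sym p lev h q).

Let om0_eq : om0 = 1 - p * q None. Proof. exact: small_mass. Qed.
Let pq_le : p * q None <= p * (mu * e ^+ 2).
Proof. exact: ler_wpM2l. Qed.
Let mue : mu * e ^+ 2 <= e / 16.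
Proof.
have a1 : mu * e <= D1 * e by apply: ler_wpM2r; rewrite ?(ltW e_gt0)// /D1 lerDr.
have a2 : mu * e <= 1 / 16 by have := D1e1; lra.
have := ler_wpM2r (ltW e_gt0) a2; rewrite expr2; lra.
Qed.

Let om0_ge : 1 / 2 <= om0.
Proof.
have a3 : p * (mu * e ^+ 2) <= mu * e ^+ 2.
  by apply: ler_piMl => //; rewrite mulr_ge0 ?sqr_ge0// ltW.
by rewrite om0_eq; have := pq_le; have := mue; have := e16; lra.
Qed.
Let om0_gt0 : 0 < om0. Proof. by have := om0_ge; lra. Qed.
Let om0_le1 : om0 <= 1. Proof. by rewrite om0_eq gerBl mulr_ge0. Qed.
Let om0V : om0^-1 <= 2.
Proof. by rewrite -[leRHS]invrK lef_pV2 ?posrE ?invr_gt0//; have := om0_ge; lra. Qed.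

Let m1_le : `|m1| <= 2 * D1 * (p * (t * e)).
Proof.
have -> : m1 = p * A1 / om0 by [].
rewrite !normrM (gtr0_norm p_gt0) (gtr0_norm (x := om0^-1)) ?invr_gt0//.
have -> : 2 * D1 * (p * (t * e)) = p * (D1 * (t * e)) * 2 by ring.
apply: ler_pM; rewrite ?invr_ge0 ?(ltW om0_gt0)//; first by rewrite mulr_ge0.
exact: ler_wpM2l A1_le.
Qed.

Let m1_tr : `|m1| <= lev.
Proof.
apply: le_trans m1_le _; apply: le_trans lev_ge1.
have -> : 2 * D1 * (p * (t * e)) = (p * t) * (2 * (D1 * e)) by ring.
have pt : p * t <= 1 by rewrite mulr_ile1.
have De : 2 * (D1 * e) <= 1 by have := D1e1; have := D1_ge0; have := e_gt0; nra.
by rewrite mulr_ile1// ?mulr_ge0// ltW.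
Qed.

Let v_ge : p / 2 <= v.
Proof.
have -> : v = p * A2 / om0 - m1 ^+ 2 by [].
have a1 : 7 / 8 <= A2.
  have := A2_le; rewrite ler_norml => /andP[+ _].
  by have := D1e1; lra.
have a2 : p * (7 / 8) <= p * A2 / om0.
  rewrite ler_pdivlMr//; apply: (@le_trans _ _ (p * (7 / 8))).
    by apply: ler_piMr => //; rewrite mulr_ge0.
  exact: ler_wpM2l.
have a3 : m1 ^+ 2 <= p / 4.
  have -> : m1 ^+ 2 = `|m1| ^+ 2 by rewrite real_normK ?num_real.
  apply: (@le_trans _ _ ((2 * D1 * (p * (t * e))) ^+ 2)).
    by apply: lerXn2r; rewrite ?nnegrE ?m1_le// (le_trans _ m1_le).
  have -> : (2 * D1 * (p * (t * e))) ^+ 2 =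
     p * (4 * (p * t ^+ 2 * e * (D1 ^+ 2 * e))) by ring.
  rewrite -[p / 4]/(p * 4^-1); apply: ler_wpM2l => //.
  have b1 : p * t ^+ 2 * e <= 1.
    have t21 : t ^+ 2 <= 1 by rewrite exprn_ile1.
    have e1 : e <= 1 by move: e16 e_gt0; lra.
    have t20 : 0 <= t ^+ 2 by exact: sqr_ge0.
    have pt0 : 0 <= p * t ^+ 2 by exact: mulr_ge0.
    have pt1 : p * t ^+ 2 <= 1 by exact: mulr_ile1.
    exact: mulr_ile1.
  have b2 : 0 <= D1 ^+ 2 * e by rewrite mulr_ge0 ?sqr_ge0// ltW.
  have b3 : p * t ^+ 2 * e * (D1 ^+ 2 * e) <= D1 ^+ 2 * e by exact: ler_piMl.
  by have := D1e; lra.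
move: a2 a3 p_ge0; set B := p * A2 / om0; set M2 := m1 ^+ 2; lra.
Qed.
Let v_gt0 : 0 < v. Proof. by apply: lt_le_trans v_ge; rewrite divr_gt0. Qed.

(* Entries and mean are at most [lev] and the variance is at least [p / 2], which
   gives [(2 * lev) ^+ 2 / (p / 2)]. *)
Let k2 := 8 * lev ^+ 2 / p.
Let k2_ge0 : 0 <= k2. Proof. by rewrite divr_ge0// mulr_ge0// sqr_ge0. Qed.

Let val_bound (s : bool * option 'I_mm) : (val_sym lev h s - m1) ^+ 2 <= k2 * v.
Proof.
have a1 : `|val_sym lev h s| <= lev.
  rewrite /val_sym; case: (s.1); last by rewrite normr0 ltW.
  exact: cval_le h_gt0 mmh _.
apply: (@le_trans _ _ ((2 * lev) ^+ 2)).
  rewrite -real_normK ?num_real//; apply: lerXn2r; rewrite ?nnegrE//.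
    by rewrite mulr_ge0// ltW.
  apply: le_trans (ler_normB _ _) _; have := m1_tr; lra.
apply: (@le_trans _ _ (k2 * (p / 2))); last exact: ler_wpM2l.
by rewrite le_eqVlt; apply/orP; left; apply/eqP; rewrite /k2; field; rewrite gt_eqF.
Qed.

Let eta := h + `|m1|.
Let eta_ge0 : 0 <= eta. Proof. by rewrite addr_ge0// ltW. Qed.
Let r := Num.sqrt v.
Let c1 := Num.sqrt (nu / 8) * Num.sqrt Lam.

Let entries (w : T) j k :
  [forall k, small (tnth (conf X xi lev h mm w) j k)] ->
  `|sparse_matrix X xi w j k - r * z (tnth (conf X xi lev h mm w) j k)| <= eta.
Proof.
move=> /forallP /(_ k); rewrite tnth_mktuple !ffunE /sym /small_sym /=.
have r0 : 0 < r by rewrite sqrtr_gt0.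
rewrite /z_sym -/v -/r mulrC divfK; last by rewrite (gt_eqF r0).
rewrite -/m1 /sparse_matrix mxE /val_sym /=.
have tri (a b : R) : `|a - b| <= h -> `|a - (b - m1)| <= eta.
  move=> ab; have -> : a - (b - m1) = (a - b) + m1 by ring.
  by apply: le_trans (ler_normD _ _) _; rewrite lerD2r.
move=> hs; apply: tri; move: hs.
have [xi01 _] := sm_xi_bernoulli model (j, k).
case: (xi01 w) => ->.
  by rewrite eq_sym oner_eq0 /= => _; rewrite mul0r subr0 normr0 ltW.
rewrite eqxx mul1r /= => cN.
have [xt|/cidx_big e0] := boolP (- lev <= X (j, k) w < lev); last first.
  by move: cN; rewrite e0.
by have [] := cval_approx h_gt0 mmh xt.
Qed.

Let eta_le : eta <= 3 * D1 * (p * (t * e)).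
Proof.
have a0 : 0 <= p * (t * e) by rewrite mulr_ge0// mulr_ge0// ltW.
have a1 : p * (t * e) <= D1 * (p * (t * e)) by exact: ler_peMl.
by have := h_le; have := m1_le; rewrite /eta; lra.
Qed.

(* The rows contribute [nu N v / 2 >= nu Lam / 4]; half of it is kept, the other
   half pays for the perturbation of all entries by [eta]. *)
Let gap : c1 ^+ 2 <= v / 2 * (nu * N%:R) - N%:R * n%:R * eta ^+ 2.
Proof.
have -> : c1 ^+ 2 = nu / 8 * Lam.
  rewrite /c1 exprMn !sqr_sqrtr ?(ltW Lam_gt0)// divr_ge0// ltW//.
have a1 : nu * Lam / 4 <= v / 2 * (nu * N%:R).
  have -> : nu * Lam / 4 = (p / 2) * (nu * N%:R / 2) by rewrite /Lam; field.
  have -> : v / 2 * (nu * N%:R) = v * (nu * N%:R / 2) by field.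
  by apply: ler_wpM2r v_ge; rewrite divr_ge0// mulr_ge0// ltW.
have a2 : N%:R * n%:R * eta ^+ 2 <= 9 * (D1 ^+ 2 * e).
  apply: (@le_trans _ _ (N%:R * N%:R * (3 * D1 * (p * (t * e))) ^+ 2)).
    apply: ler_pM; rewrite ?mulr_ge0 ?sqr_ge0//.
      by apply: ler_wpM2l => //; rewrite ler_nat.
    apply: lerXn2r; rewrite ?nnegrE ?eta_le//; exact: le_trans eta_le.
  have -> : N%:R * N%:R * (3 * D1 * (p * (t * e))) ^+ 2 =
     9 * D1 ^+ 2 * t ^+ 2 * (Lam * e) ^+ 2 by rewrite /Lam; ring.
  have D2t : D1 ^+ 2 * t ^+ 2 <= D1 ^+ 2 * e.
    by apply: ler_wpM2l; [exact: sqr_ge0|exact: t2].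
  by rewrite LamE expr1n mulr1 -(mulrA 9); apply: ler_wpM2l.
have a3 : 72 * (D1 ^+ 2 * e) <= nu * Lam.
  have -> : nu * Lam = nu * Lam * (Lam * e) by rewrite LamE mulr1.
  by have := ler_wpM2r e_ge0 Lam2; lra.
lra.
Qed.

Lemma smin_bound_fixed :
  (P [set w | (smin (sparse_matrix X xi w) <= c1)%R]
   <= ((n%:R + 2) * expR (- m%:R))%:E)%E.
Proof.
pose x := good_row z small (n := n).
pose bad (s : N.-tuple {ffun 'I_n -> bool * option 'I_mm}) :=
  ~~ `[< pd (gram x s - (nu * N%:R)%:M) >].
have c10 : 0 <= c1 by rewrite mulr_ge0 ?sqrtr_ge0.
have mE : measurable [set w | smin (sparse_matrix X xi w) <= c1].
  apply: (measurable_smin_le (a := fun j k w => xi (j, k) w * X (j, k) w)) => // j k.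
  by apply: measurable_funM; exact: measurable_funPT.
have Ebad w : [set w | smin (sparse_matrix X xi w) <= c1] w ->
    bad (conf X xi lev h mm w).
  move=> /= sc; apply/asboolPn => pg; move: sc; apply/negP; rewrite -ltNge.
  have rv : r ^+ 2 = v by rewrite sqr_sqrtr// ltW.
  exact: (smin_from_gram n_gt0 eta_ge0 v_gt0 rv c10 (entries (w := w)) pg gap).
apply: le_trans (prob_le_conf model h_gt0 mmh jk0 mE Ebad) _; rewrite lee_fin.
have om1 : om0 ^+ n <= 1 by rewrite exprn_ile1// ltW.
have z1 := @z_mean R mm p lev h q om0_gt0.
have z2 := @z_var R mm p lev h q om0_gt0 v_gt0.
have z4 := @z_four R mm p lev h q p_ge0 p_le1 q_ge0 om0_gt0 v_gt0 k2 val_bound.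
apply: (core n_gt0 nyN m_gt0 _ _ om1 k2_ge0).
- move=> f; apply: prodr_ge0 => k _; exact: (weight_ge0 model).
- by apply: iid_sum; exact: (weight_sum _ _ h_gt0 mmh).
- exact: good_row_moment1 om0_gt0 z1 z2.
- apply: good_row_moment2 om0_gt0 z1 z2 z4 om0_le1 _ => s; exact: (weight_ge0 model).
- exact: mN.
- have -> : K * (m%:R * k2) = 8 * K * m%:R * lev ^+ 2 / p by rewrite /k2; field; rewrite gt_eqF.
  by rewrite ler_pdivrMr.
have b1 := bernoulli_ineq n (ltW om0_gt0) om0_le1.
have b2 : n%:R * (1 - om0) <= N%:R * (p * (mu * e ^+ 2)).
  apply: ler_pM => //; rewrite ?subr_ge0// ?ler_nat//.
  by rewrite om0_eq subKr.
have b3 : N%:R * (p * (mu * e ^+ 2)) = mu * e.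
  have -> : N%:R * (p * (mu * e ^+ 2)) = mu * e * (Lam * e) by rewrite /Lam; ring.
  by rewrite LamE mulr1.
have b4 : K * (mu * e) <= 1.
  by have := ler_wpM2r e_ge0 Lam3; rewrite LamE mulrA.
apply: le_trans b4; apply: ler_wpM2l; first exact: ltW.
by rewrite -b3; apply: le_trans b2.
Qed.
End FixedSize.

(** * The truncation level and the asymptotic bound *)

Section TruncationLevel.
Variables (R : realType) (delta B Lam L : R).
Hypotheses (delta_gt0 : 0 < delta) (B_gt0 : 0 < B) (L_ge1 : 1 <= L).
Hypothesis Lam_ge1 : 1 <= Lam.
Let k := varkappa delta.
Hypothesis BL : B * L `^ (3 / (2 * k)) <= Lam.

Let k_gt0 : 0 < k. Proof. by rewrite divr_gt0// mulr_gt0// addr_gt0. Qed.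
Let k_lt : k < 1 / 2.
Proof.
by rewrite /k /varkappa ltr_pdivrMr ?mulr_gt0 ?addr_gt0//; move: delta_gt0; lra.
Qed.
Let Lam_gt0 : 0 < Lam. Proof. exact: lt_le_trans Lam_ge1. Qed.

Definition trunc_level : R := Lam `^ (1 / 2 - k).
Local Notation lev := trunc_level.

Lemma trunc_level_ge1 : 1 <= lev.
Proof.
rewrite -[leLHS](powRr0 Lam) /lev; apply: ler_powR => //.
by rewrite subr_ge0 ltW.
Qed.

(** This choice of the exponent balances the truncation: the bound
[mu / lev `^ (4 + delta)] for a large entry becomes [mu / Lam ^+ 2]. *)
Lemma trunc_level_pow : lev `^ (4 + delta) = Lam ^+ 2.
Proof.
rewrite /lev -powRrM.
have -> : (1 / 2 - k) * (4 + delta) = 2%:R.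
  rewrite /k /varkappa; field; rewrite gt_eqF// addr_gt0//.
by rewrite powR_mulrn// ltW.
Qed.

Lemma trunc_level_sq : lev ^+ 2 * Lam `^ (2 * k) = Lam.
Proof.
rewrite -powR_mulrn ?powR_ge0// /lev -powRrM -powRD; last first.
  by apply/implyP => _; rewrite gt_eqF.
have -> : (1 / 2 - k) * 2%:R + 2 * k = 1 by field.
by rewrite powRr1// ltW.
Qed.

(** The growth hypothesis in the form in which it is used: with [L = ln N], a power
[L ^+ 3] is gained, one factor more than the [L ^+ 2] taken by [m]. *)
Lemma Lam_pow_ge : B `^ (2 * k) * L ^+ 3 <= Lam `^ (2 * k).
Proof.
have L0 : 0 <= L by exact: le_trans L_ge1.
have -> : B `^ (2 * k) * L ^+ 3 = (B * L `^ (3 / (2 * k))) `^ (2 * k).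
  have k20 : 2 * k != 0 by rewrite mulf_neq0// gt_eqF.
  by rewrite powRM ?powR_ge0 ?(ltW B_gt0)// -powRrM divfK// powR_mulrn.
have h2k : 0 <= 2 * k by rewrite mulr_ge0// ltW.
have hb : 0 <= B * L `^ (3 / (2 * k)) by rewrite mulr_ge0 ?powR_ge0// ltW.
by apply: (ge0_ler_powR h2k) BL; rewrite nnegrE// ltW.
Qed.

Lemma trunc_level_sq_le : lev ^+ 2 <= Lam.
Proof.
rewrite -[leRHS]trunc_level_sq ler_peMr ?sqr_ge0// -[leLHS](powRr0 Lam).
by apply: ler_powR => //; rewrite mulr_ge0// ltW.
Qed.

End TruncationLevel.

Lemma Lam_ge_log (R : realType) (delta B Lam L : R) : 0 < delta -> 0 < B -> 1 <= L ->
  B * L `^ (3 / (2 * varkappa delta)) <= Lam -> B * L <= Lam.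
Proof.
move=> d0 B0 L1; apply: le_trans; apply: ler_wpM2l; first exact: ltW.
have k0 : 0 < varkappa delta by rewrite divr_gt0// mulr_gt0// addr_gt0.
have k1 : varkappa delta < 1 / 2.
  by rewrite /varkappa ltr_pdivrMr ?mulr_gt0 ?addr_gt0//; lra.
rewrite -[leLHS]powRr1 ?(le_trans _ L1)//; apply: ler_powR => //.
have k2 : 0 < 2 * varkappa delta by rewrite mulr_gt0.
by rewrite ler_pdivlMr// mul1r; move: k1; set k := varkappa delta; lra.
Qed.

Lemma ln_cube_le_sqrt (R : realType) (N : R) : 1 <= N ->
  ln N ^+ 3 / 48 <= Num.sqrt N.
Proof.
move=> N1; have N0 : 0 < N by exact: lt_le_trans N1.
have L0 : 0 <= ln N by exact: ln_ge0.
have -> : Num.sqrt N = expR (ln N / 2).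
  have e : N = expR (ln N / 2) ^+ 2.
    by rewrite -expRM_natl mulrC divfK// lnK.
  by rewrite [in LHS]e sqrtr_sqr ger0_norm ?expR_ge0.
have := @expR_ge1Dxn R (ln N / 2) 2; rewrite divr_ge0// => /(_ isT).
have -> : 3`!%:R = 6 :> R by [].
have -> : (ln N / 2) ^+ 3 / 6 = ln N ^+ 3 / 48 by field.
lra.
Qed.

Lemma nat_powRN (R : realType) (N : nat) (Q : R) : (0 < N)%N ->
  N%:R `^ (- Q) = expR (- (Q * ln N%:R)) :> R.
Proof. by move=> N0; rewrite /powR gt_eqF ?ltr0n// mulNr. Qed.

Lemma eventually_ratio (R : realType) (y0 : R) (n : nat -> nat) :
  0 < y0 < 1 -> (fun N : nat => (n N)%:R / N%:R : R) @ \oo --> y0 ->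
  exists N0 : nat, forall N, (N0 <= N)%N -> (0 < N)%N ->
    (n N)%:R <= (1 + y0) / 2 * N%:R :> R.
Proof.
move=> /andP[y0p y01] /cvgrPdist_lt hn.
have e0 : 0 < (1 - y0) / 2 by rewrite divr_gt0// subr_gt0.
have [N0 _ h] := hn _ e0; exists N0 => N NN N_gt0.
have := h N NN; rewrite /= ltr_norml => /andP[h1 _].
rewrite -ler_pdivrMr ?ltr0n//; lra.
Qed.

Theorem corollary1p3 (R : realType) (y0 : R) (hy0 : 0 < y0 < 1)
    (n : nat -> nat)
    (hn : (fun N : nat => (n N)%:R / N%:R : R) @ \oo --> y0)
    (delta mu B : R) (hdelta : 0 < delta) (hmu : 0 < mu) (hB : 0 < B) :
  exists tau0 : R, 0 < tau0 /\
    forall Q A : R, 1 <= Q -> 0 < A ->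
    exists C : R, 0 < C /\
      forall tau : R, tau <= tau0 ->
      forall (N : nat) (n_gt0 : (0 < n N)%N) (n_lt_N : (n N < N)%N)
        (p : R) (d : measure_display) (T : measurableType d)
        (P : probability T R) (X xi : 'I_N * 'I_(n N) -> {RV P >-> R}),
      sparse_model p X xi ->
      (forall jk, 'E_P[fun t => (`|X jk t| `^ (4 + delta))%R] <= mu%:E)%E ->
      B * ln N%:R `^ (3 / (2 * varkappa delta)) <= N%:R * p ->
      let X11 := X (Ordinal (ltn_trans n_gt0 n_lt_N), Ordinal n_gt0) in
      (P [set t | (smin (sparse_matrix X xi t)
                     <= tau * Num.sqrt (N%:R * p))%R]
       <= (C * N%:R `^ (- Q))%:E
          + (N%:R ^+ 2 * p)%:E
            * P [set t | (A * (N%:R * p) `^ (1 / 2 - varkappa delta) * ln N%:R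
                            < `|X11 t|)%R])%E.
Proof.
have [/andP[y0p y01]] := (hy0, hy0); move=> _.
have [N0 hN0] := eventually_ratio hy0 hn.
set y := (1 + y0) / 2 in hN0.
have yp : 0 < y by rewrite divr_gt0// addr_gt0.
have y1 : y < 1 by rewrite /y ltr_pdivrMr//; lra.
have [nu [K [nu0 K0 core]]] := barrier_constants yp y1.
pose D1 := 1 + mu.
have D11 : 1 <= D1 by rewrite lerDl ltW.
pose B2 := B `^ (2 * varkappa delta).
have B20 : 0 < B2 by exact: powR_gt0.
(* [Lam0] is the size of [N p], and [L0] that of [ln N], from which on the bound
   at a fixed size applies.  For [ln N] below [L1] the constant makes the bound
   trivial. *)
pose Lam0 := 16 * D1 ^+ 2 + 72 * D1 ^+ 2 / nu + K * mu.
pose L0 := 1 + Lam0 / B + 16 * K / B2 + 96 * K + ln (N0.+1%:R).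
exists (Num.sqrt (nu / 8)); split; first by rewrite sqrtr_gt0 divr_gt0.
move=> Q A Q1 A0.
pose L1 := L0 + Q + 1.
exists (3 + expR (Q * L1)); split; first by rewrite addr_gt0// expR_gt0.
move=> tau htau N n_gt0 n_lt_N p d T P X xi model moments hB'.
lazy zeta; set X11 := X (Ordinal (ltn_trans n_gt0 n_lt_N), Ordinal n_gt0).
have N_gt0 : (0 < N)%N := ltn_trans n_gt0 n_lt_N.
have NR1 : 1 <= N%:R :> R by rewrite ler1n.
set L := ln N%:R in hB' *.
set E := [set t | _].
have tail0 : (0 <= (N%:R ^+ 2 * p)%:E * P [set t | (A * (N%:R * p) `^ (1 / 2 - varkappa delta) * L
                            < `|X11 t|)%R])%E.
  rewrite mule_ge0// lee_fin mulr_ge0 ?sqr_ge0//.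
  exact: p_ge0 model (Ordinal N_gt0, Ordinal n_gt0).
suff main : (P E <= ((3 + expR (Q * L1)) * N%:R `^ (- Q))%:E)%E.
  by apply: le_trans main _; rewrite leeDl.
have mE c : measurable [set t | smin (sparse_matrix X xi t) <= c].
  apply: (measurable_smin_le (a := fun j k w => xi (j, k) w * X (j, k) w)) => // j k.
  by apply: measurable_funM; exact: measurable_funPT.
have L_ge0 : 0 <= L by exact: ln_ge0.
have [LL|LL] := leP L1 L; last first.
  apply: (@le_trans _ _ 1%E); first exact/probability_le1/mE.
  rewrite lee_fin nat_powRN// -/L.
  apply: (@le_trans _ _ (expR (Q * L1) * expR (- (Q * L)))).
    rewrite -expRD -expR0 ler_expR -mulrBr mulr_ge0 ?subr_ge0 ?(ltW LL)//.
    by lra.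
  by apply: ler_wpM2r; rewrite ?expR_ge0// lerDr.
have D1sq : 1 <= D1 ^+ 2 by rewrite exprn_ege1.
have q1 : 0 <= 72 * D1 ^+ 2 / nu by rewrite divr_ge0 ?(ltW nu0)// mulr_ge0 ?sqr_ge0.
have q2 : 0 <= K * mu by rewrite mulr_ge0// ltW.
have T0 : 0 <= Lam0 by rewrite /Lam0; move: q1 q2 D1sq; clear; lra.
have lnN0 : 0 <= ln (N0.+1%:R : R) by apply: ln_ge0; rewrite ler1n.
have s1 : 0 <= Lam0 / B by rewrite divr_ge0// ltW.
have s2 : 0 <= 16 * K / B2.
  by rewrite divr_ge0 ?(ltW B20)// mulr_ge0// ltW.
have L_ge1 : 1 <= L by move: LL s1 s2 lnN0 Q1 K0; rewrite /L1 /L0; clear; lra.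
have LLam0 : Lam0 / B <= L by move: LL s1 s2 lnN0 Q1 K0; rewrite /L1 /L0; clear; lra.
have LB2 : 16 * K / B2 <= L by move: LL s1 s2 lnN0 Q1 K0; rewrite /L1 /L0; clear; lra.
have LK : 96 * K <= L by move: LL s1 s2 lnN0 Q1 K0; rewrite /L1 /L0; clear; lra.
have LQ : Q + 1 <= L by move: LL s1 s2 lnN0 Q1 K0; rewrite /L1 /L0; clear; lra.
have LN0 : ln (N0.+1%:R : R) <= L by move: LL s1 s2 lnN0 Q1 K0; rewrite /L1 /L0; clear; lra.
have NN0 : (N0 <= N)%N.
  move: LN0; rewrite /L ler_ln ?posrE ?ltr0n// ler_nat; exact: ltnW.
pose Lam := N%:R * p.
have LamL : B * L <= Lam by exact: Lam_ge_log hB'.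
have Lam0le : Lam0 <= Lam.
  by apply: le_trans LamL; rewrite mulrC -ler_pdivrMr.
have Lam1 : 16 * D1 ^+ 2 <= Lam by move: Lam0le q1 q2 D1sq; rewrite /Lam0; clear; lra.
have Lam3 : K * mu <= Lam by move: Lam0le q1 q2 D1sq; rewrite /Lam0; clear; lra.
have Lam_ge1 : 1 <= Lam by move: Lam1 D1sq; clear; lra.
have Lam2 : 72 * D1 ^+ 2 <= nu * Lam ^+ 2.
  have h1 : 72 * D1 ^+ 2 / nu <= Lam by move: Lam0le q1 q2 D1sq; rewrite /Lam0; clear; lra.
  rewrite [leRHS]mulrC -ler_pdivrMr//; apply: le_trans h1 _.
  have L00 : 0 <= Lam by exact: le_trans Lam_ge1.
  by rewrite expr2 ler_peMr.
(* [m] of order [(ln N)^2] makes [expR (- m)] smaller than any power of [N]. *)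
pose m := (Num.truncn (L ^+ 2)).+1.
have L2 : 1 <= L ^+ 2 by rewrite exprn_ege1.
have mL : L ^+ 2 <= m%:R by rewrite ltW// truncnS_gt.
have mL2 : m%:R <= 2 * L ^+ 2.
  have h1 : (Num.truncn (L ^+ 2))%:R <= L ^+ 2 by rewrite truncn_le// sqr_ge0.
  by rewrite /m -natr1; move: h1 L2; clear; lra.
pose lev := trunc_level delta Lam.
have lev1 : 1 <= lev by exact: trunc_level_ge1.
have levE : lev `^ (4 + delta) = Lam ^+ 2 by exact: trunc_level_pow.
have lev_sq : lev ^+ 2 <= Lam by exact: trunc_level_sq_le.
have mlev : 8 * K * m%:R * lev ^+ 2 <= Lam.
  rewrite -[leRHS](trunc_level_sq delta Lam_ge1) -/lev [leLHS]mulrC.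
  apply: ler_wpM2l; first exact: sqr_ge0.
  apply: le_trans _ (Lam_pow_ge hdelta hB L_ge1 Lam_ge1 hB').
  have h1 : 16 * K <= B2 * L by move: LB2; rewrite ler_pdivrMr// [leRHS]mulrC.
  apply: (@le_trans _ _ (8 * K * (2 * L ^+ 2))).
    by apply: ler_wpM2l mL2; rewrite mulr_ge0// ltW.
  have -> : 8 * K * (2 * L ^+ 2) = 16 * K * L ^+ 2 by ring.
  have -> : B `^ (2 * varkappa delta) * L ^+ 3 = B2 * L * L ^+ 2.
    by rewrite /B2; ring.
  by apply: ler_wpM2r => //; exact: sqr_ge0.
have mN : K * m%:R <= Num.sqrt N%:R.
  apply: le_trans (ln_cube_le_sqrt NR1); rewrite -/L ler_pdivlMr//.
  apply: (@le_trans _ _ (K * (2 * L ^+ 2) * 48)).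
    by apply: ler_wpM2r => //; apply: ler_wpM2l; rewrite // ltW.
  have -> : K * (2 * L ^+ 2) * 48 = 96 * K * L ^+ 2 by ring.
  by rewrite exprS; apply: ler_wpM2r => //; exact: sqr_ge0.
have fixed := smin_bound_fixed nu0 K0 core n_gt0 (ltnW n_lt_N) (hN0 N NN0 N_gt0)
  (ltn0Sn _ : (0 < m)%N) model hdelta hmu moments lev1 levE lev_sq Lam1 Lam2 Lam3 mlev mN.
apply: (le_trans _ (le_trans fixed _)).
  apply: le_measure; rewrite ?inE; [exact: mE|exact: mE|].
  move=> t /= h; apply: le_trans h _; apply: ler_wpM2r => //; exact: sqrtr_ge0.
rewrite lee_fin nat_powRN// -/L.
apply: (@le_trans _ _ (3 * expR (- (Q * L)))); last first.
  by apply: ler_wpM2r; rewrite ?expR_ge0// lerDl expR_ge0.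
have nb : (n N)%:R + 2 <= 3 * N%:R :> R.
  have h1 : (n N)%:R <= N%:R :> R by rewrite ler_nat ltnW.
  by move: h1 NR1; clear; lra.
apply: (@le_trans _ _ (3 * N%:R * expR (- m%:R))).
  by apply: ler_wpM2r; rewrite ?expR_ge0.
rewrite -mulrA; apply: ler_wpM2l => //.
rewrite -[X in X * _](@lnK _ N%:R) ?posrE ?ltr0n// -/L -expRD ler_expR.
have h1 : L * (Q + 1) <= L * L by apply: ler_wpM2l.
by move: mL h1; rewrite expr2; clear; lra.
Qed.
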